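(* Let $n\geq 2$ be an integer, $0<\alpha\leq 2$, $r>0$, and let $f:\Omega_r\times[0,\infty)\to[0,\infty)$ be subcritical and satisfy the assumptions $(\mathbf{f_1})$, $(\mathbf{f_2})$ and $(\mathbf{f_3})$ (all defined in the context). If $u\in C(\overline{\Omega_r})$ is a nonnegative solution to the integral equation $$u(x)=\int_{\Omega_r}G_\alpha(x,y)\,f(y,u(y))\,dy,\qquad x\in\overline{\Omega_r},$$ then $u\equiv 0$ in $\overline{\Omega_r}$.
   Context: $\Omega_r:=\{x\in\mathbb{R}^n : |x|>r\}$, and $\mathbb{R}_+=(0,\infty)$. Green's function: for $x,y\in\Omega_r$, $$G_\alpha(x,y):=\frac{C_{n,\alpha}}{|x-y|^{n-\alpha}}\int_0^{\frac{(|x|^2-r^2)(|y|^2-r^2)}{r^2|x-y|^2}}\frac{b^{\frac{\alpha}{2}-1}}{(1+b)^{\frac n2}}\,db,$$ and $G_\alpha(x,y):=0$ if $x$ or $y$ lies in $\mathbb{R}^n\setminus\Omega_r$; $C_{n,\alpha}>0$ is the normalizing constant (depending only on $n,\alpha$) for which $G_\alpha$ is the Green's function of $(-\Delta)^{\alpha/2}$ in $\Omega_r$ with Dirichlet conditions. Subcritical: if $0<\alpha<n$, $f$ is called subcritical if for all $(x,u)\in\Omega_r\times\mathbb{R}_+$ the quantity $\mu^{\frac{n+\alpha}{n-\alpha}}f(\mu^{\frac{2}{n-\alpha}}x,\mu^{-1}u)$ is strictly increasing with respect to $\mu\geq 1$, or for all $(x,u)\in\Omega_r\times\mathbb{R}_+$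 it is strictly increasing with respect to $\mu\leq 1$ ($\mu>0$ such that $\mu^{\frac{2}{n-\alpha}}x\in\Omega_r$). If $\alpha=n$, $f$ is called subcritical if the same holds with the quantity $\mu^{n}f(\mu x,u)$ ($\mu>0$ such that $\mu x\in\Omega_r$). Locally Lipschitz: $g(x,u)$ is locally Lipschitz on $u$ in $\Omega_r\times[0,\infty)$ if for any $u_0\in[0,\infty)$ and any bounded $\omega\subseteq\Omega_r$ there is a relatively open neighborhood $U(u_0)\subset[0,\infty)$ of $u_0$ such that $g$ is Lipschitz continuous in $u$ on $\omega\times U(u_0)$ (with a Lipschitz constant uniform in $x\in\omega$). $(\mathbf{f_1})$: $f(x,u)\leq f(x,v)$ whenever $x\in\Omega_r$ and $0\leq u\leq v$. $(\mathbf{f_2})$: there exists $\theta<\frac{\alpha}{n}$ such that $(|x|-r)^\theta f(x,u)$ is locally Lipschitz on $u$ in $\Omega_r\times[0,\infty)$. $(\mathbf{f_3})$: there exist a cone $\mathcal{C}\subset\mathbb{R}^n$ with vertex at $0$ (a solid cone, i.e. with nonempty interior), constants $\overline{C}>0$, $\sigma>1$, and, if $0<\alpha<n$, constants $-\alpha<\tau<+\infty$ and $0<p<\frac{n+\alpha+2\tau}{n-\alpha}$, or, if $\alpha=n$, constants $-\alpha\leq\tau<+\infty$ and $0<p<+\infty$, such that $f(x,u)\geq\overline{C}|x|^\tau u^p$ for all $(x,u)\in(\mathcal{C}\cap\Omega_{2\sigma r})\times[0,\infty)$. *)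

(* Defs.v *)
From HB Require Import structures.
From mathcomp Require Import all_boot all_order all_algebra.
From mathcomp Require Import all_classical all_reals all_analysis.

Set Implicit Arguments.
Unset Strict Implicit.
Unset Printing Implicit Defensive.

Import Order.TTheory GRing.Theory Num.Theory.
Import numFieldNormedType.Exports.

Local Open Scope classical_set_scope.
Local Open Scope ring_scope.

(** * Lebesgue measure on row vectors

  'rV[R]_n carries the sigma-algebra generated by its coordinates (for a real
  type R this is the Borel sigma-algebra), and [lebesgue_rV R n] is the n-fold
  product of the one-dimensional Lebesgue measure; see [lebesgue_rV_setX]. *)

Definition measure_rV_display : measure_display -> measure_display.
Proof. exact. Qed.

Section measurable_rV.
Context {d} {T : measurableType d} (n : nat).

Definition rV_coord (i : 'I_n) (x : 'rV[T]_n) : T := x ord0 i.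

Let rV_set0 : g_sigma_preimage rV_coord set0.
Proof. exact: sigma_algebra0. Qed.

Let rV_setC A : g_sigma_preimage rV_coord A -> g_sigma_preimage rV_coord (~` A).
Proof. exact: sigma_algebraC. Qed.

Let rV_bigcup (F : _^nat) : (forall i, g_sigma_preimage rV_coord (F i)) ->
  g_sigma_preimage rV_coord (\bigcup_i (F i)).
Proof. exact: sigma_algebra_bigcup. Qed.

HB.instance Definition _ := @isMeasurable.Build (measure_rV_display d)
  'rV[T]_n (g_sigma_preimage rV_coord) rV_set0 rV_setC rV_bigcup.

Lemma measurable_rV_coord i : measurable_fun setT (@rV_coord i).
Proof.
move=> _ A mA; rewrite setTI; apply: sub_sigma_algebra.
by rewrite (bigD1 i)//=; left; exists A => //; rewrite setTI.
Qed.

Lemma measurable_fun_rV d' (S : measurableType d') (f : S -> 'rV[T]_n) :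
  (forall i, measurable_fun setT (fun s => f s ord0 i)) ->
  measurable_fun setT f.
Proof.
move=> mf.
apply: (@measurability _ _ _ _ _ _ (\big[setU/set0]_(i < n)
  preimage_set_system setT (@rV_coord i) measurable)) => //.
move=> _ [A + <-].
elim/big_ind : _ => [//|P Q IHP IHQ [/IHP|/IHQ]//|i _ [B mB <-]].
by rewrite !setTI -[X in measurable X]setTI; exact: (mf i measurableT _ mB).
Qed.

End measurable_rV.

Section rV_cons.
Context {d} {T : measurableType d} (n : nat).

Definition rV_cons (p : T * 'rV[T]_n) : 'rV[T]_n.+1 :=
  \row_i (if unlift ord0 i is Some j then p.2 ord0 j else p.1).

Lemma measurable_rV_cons : measurable_fun setT rV_cons.
Proof.
apply: measurable_fun_rV => i.
under eq_fun do rewrite mxE.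
case: (unlift ord0 i) => [j|]; last exact: measurable_fst.
exact: (measurableT_comp (measurable_rV_coord j) measurable_snd).
Qed.

Definition rV_uncons (x : 'rV[T]_n.+1) : T * 'rV[T]_n :=
  (x ord0 ord0, \row_j x ord0 (lift ord0 j)).

Lemma measurable_rV_uncons : measurable_fun setT rV_uncons.
Proof.
apply/measurable_fun_pairP; split; first exact: measurable_rV_coord.
apply: measurable_fun_rV => i.
under eq_fun do rewrite /= mxE.
exact: measurable_rV_coord.
Qed.

Lemma rV_consK : cancel rV_cons rV_uncons.
Proof.
move=> [a x]; rewrite /rV_uncons /rV_cons mxE unlift_none; congr pair.
by apply/rowP => j; rewrite !mxE liftK.
Qed.

Lemma rV_unconsK : cancel rV_uncons rV_cons.
Proof.
move=> x; apply/rowP => i; rewrite !mxE.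
by case: unliftP => [j ->|->]//=; rewrite mxE.
Qed.

End rV_cons.

Section lebesgue_rV.
Context {R : realType}.
Local Notation RB := (measurableTypeR R).

Section succ.
Variables (n : nat) (mu : {sigma_finite_measure set 'rV[RB]_n -> \bar R}).

Definition lebesgue_rV_succ : set 'rV[RB]_n.+1 -> \bar R :=
  pushforward (@lebesgue_measure R \x mu)%E (@rV_cons _ RB n).

Let lebesgue_rV_succ0 : lebesgue_rV_succ set0 = 0%E.
Proof. by rewrite /lebesgue_rV_succ /pushforward preimage_set0 measure0. Qed.

Let lebesgue_rV_succ_ge0 A : (0 <= lebesgue_rV_succ A)%E.
Proof. by rewrite /lebesgue_rV_succ /pushforward measure_ge0. Qed.

Let lebesgue_rV_succ_sigma_additive : semi_sigma_additive lebesgue_rV_succ.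
Proof.
have mcons A : measurable A -> measurable (@rV_cons _ RB n @^-1` A).
  by move=> mA; rewrite -[X in measurable X]setTI; exact: measurable_rV_cons.
move=> F mF tF mUF; rewrite /lebesgue_rV_succ /pushforward preimage_bigcup.
apply: measure_semi_sigma_additive.
- by move=> k; exact: mcons.
- apply/trivIsetP => /= i j _ _ ij; rewrite -preimage_setI.
  by move/trivIsetP : tF => /(_ _ _ _ _ ij) ->//; rewrite preimage_set0.
- by rewrite -preimage_bigcup; exact: mcons.
Qed.

HB.instance Definition _ := isMeasure.Build _ _ _ lebesgue_rV_succ
  lebesgue_rV_succ0 lebesgue_rV_succ_ge0 lebesgue_rV_succ_sigma_additive.

Let lebesgue_rV_succ_sigma_finite : sigma_finite setT lebesgue_rV_succ.
Proof.
have /sigma_finiteP[F [TF ndF Foo]] := sigma_finiteT (@lebesgue_measure R).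
have /sigma_finiteP[G [TG ndG Goo]] := sigma_finiteT mu.
exists (fun k => @rV_uncons _ RB n @^-1` (F k `*` G k)).
  apply/esym; rewrite -subTset => x _.
  have [i _ Fi] : (\bigcup_i F i) (x ord0 ord0) by rewrite -TF.
  have [j _ Gj] : (\bigcup_i G i) (\row_j x ord0 (lift ord0 j)) by rewrite -TG.
  exists (maxn i j) => //; split => /=.
    by move: Fi; exact/subsetPset/ndF/leq_maxl.
  by move: Gj; exact/subsetPset/ndG/leq_maxr.
move=> k; have [mF Fk] := Foo k; have [mG Gk] := Goo k.
have mFG : measurable (F k `*` G k) by exact: measurableX.
split; first by rewrite -[X in measurable X]setTI; exact: measurable_rV_uncons.
rewrite /lebesgue_rV_succ /pushforward -comp_preimage.
rewrite (_ : _ \o _ = id); last exact/funext/rV_consK.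
by rewrite preimage_id product_measure1E// lte_mul_pinfty// ge0_fin_numE.
Qed.

HB.instance Definition _ := Measure_isSigmaFinite.Build _ _ _
  lebesgue_rV_succ lebesgue_rV_succ_sigma_finite.

End succ.

Fixpoint lebesgue_rV n : {sigma_finite_measure set 'rV[RB]_n -> \bar R} :=
  match n with
  | 0 => @dirac _ 'rV[RB]_0 (0 : 'rV[R]_0) R
  | n'.+1 => lebesgue_rV_succ (lebesgue_rV n')
  end.

Lemma lebesgue_rV_setX n (A : 'I_n -> set RB) :
  (forall i, measurable (A i)) ->
  lebesgue_rV n [set x | forall i, A i (x ord0 i)] =
  (\prod_(i < n) lebesgue_measure (A i))%E.
Proof.
elim: n A => [|n IH] A mA.
  rewrite big_ord0 /= diracE (_ : _ \in _ = true)//.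
  by apply/mem_set => -[].
rewrite big_ord_recl /= /lebesgue_rV_succ /pushforward.
rewrite (_ : _ @^-1` _ =
  A ord0 `*` [set x : 'rV[RB]_n | forall i, A (lift ord0 i) (x ord0 i)]).
  rewrite product_measure1E//; first by rewrite (IH (fun i => A (lift ord0 i))).
  rewrite (_ : [set _ | _] =
    \bigcap_(i in setT) (@rV_coord _ RB n i @^-1` A (lift ord0 i))).
    apply: fin_bigcap_measurable => // i _.
    by rewrite -[X in measurable X]setTI; exact: measurable_rV_coord.
  by apply/seteqP; split => [x h i _|x h i]; exact: h.
apply/seteqP; split => [[a x] h|[a x] [h0 h] i].
  split => [|i]; first by have := h ord0; rewrite mxE unlift_none.
  by have := h (lift ord0 i); rewrite mxE liftK.
by rewrite /= mxE; case: unliftP => [j ->|->]//; exact: h.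
Qed.

End lebesgue_rV.
Arguments lebesgue_rV R n : clear implicits.

(* Measurability with respect to the completed (Lebesgue) sigma-algebra:
   almost everywhere equal to a Borel function. *)
Definition lebesgue_measurable (R : realType) (n : nat) (D : set 'rV[R]_n)
    (g : 'rV[R]_n -> R) :=
  exists2 h : 'rV[R]_n -> R,
    measurable_fun (D : set 'rV[measurableTypeR R]_n) h &
    {ae lebesgue_rV R n, forall y, D y -> g y = h y}.

Section definitions.
Context {R : realType}.

(* The library norm on 'rV[R]_n is the sup norm. *)
Definition enorm n (x : 'rV[R]_n) : R := Num.sqrt (\sum_i x ord0 i ^+ 2).

Definition Omega n (r : R) : set 'rV[R]_n := [set x | r < enorm x].

Definition Gamma (s : R) : R :=
  \int[lebesgue_measure]_(t in `]0, +oo[) (t `^ (s - 1) * expR (- t)).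

(* The value of the normalizing constant is that of Blumenthal, Getoor and Ray.
   For alpha = n = 2 it is 1 / (4 * pi), which gives the logarithmic Green's
   function. *)
Definition green_cst (n : nat) (alpha : R) : R :=
  Gamma (n%:R / 2) / (2 `^ alpha * pi `^ (n%:R / 2) * Gamma (alpha / 2) ^+ 2).

(* The values on the diagonal x = y, where division by zero returns zero, are
   irrelevant: they are only ever integrated in y. *)
Definition green n (alpha r : R) (x y : 'rV[R]_n) : R :=
  if (r < enorm x) && (r < enorm y) then
    green_cst n alpha / enorm (x - y) `^ (n%:R - alpha) *
    \int[lebesgue_measure]_(b in `]0, ((enorm x ^+ 2 - r ^+ 2) *
          (enorm y ^+ 2 - r ^+ 2) / (r ^+ 2 * enorm (x - y) ^+ 2))[)
      (b `^ (alpha / 2 - 1) / (1 + b) `^ (n%:R / 2))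
  else 0.

Section nonlinearity.
Variables (n : nat) (alpha r : R) (f : 'rV[R]_n -> R -> R).

Definition scale_point (mu : R) (x : 'rV[R]_n) : 'rV[R]_n :=
  if alpha < n%:R then mu `^ (2 / (n%:R - alpha)) *: x else mu *: x.

Definition scale_fun (mu : R) (x : 'rV[R]_n) (v : R) : R :=
  if alpha < n%:R then
    mu `^ ((n%:R + alpha) / (n%:R - alpha)) * f (scale_point mu x) (mu^-1 * v)
  else mu ^+ n * f (scale_point mu x) v.

Definition scale_increasing (M : set R) :=
  forall x v, Omega r x -> 0 < v -> forall mu1 mu2, M mu1 -> M mu2 ->
    Omega r (scale_point mu1 x) -> Omega r (scale_point mu2 x) ->
    mu1 < mu2 -> scale_fun mu1 x v < scale_fun mu2 x v.

Definition subcritical :=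
  scale_increasing `[1, +oo[ \/ scale_increasing `]0, 1].

Definition f1 :=
  forall x u v, Omega r x -> 0 <= u -> u <= v -> f x u <= f x v.

Definition locally_lipschitz (g : 'rV[R]_n -> R -> R) :=
  forall (u0 : R) (omega : set 'rV[R]_n), 0 <= u0 -> omega `<=` Omega r ->
    (exists M, forall x, omega x -> enorm x <= M) ->
    exists2 V : set R, open V /\ V u0 &
      exists L : R, forall x v w, omega x ->
        V v -> 0 <= v -> V w -> 0 <= w -> `|g x v - g x w| <= L * `|v - w|.

Definition f2 :=
  exists2 theta : R, theta < alpha / n%:R &
    locally_lipschitz (fun x v => (enorm x - r) `^ theta * f x v).

Definition solid_cone (C : set 'rV[R]_n) :=
  (forall x t, C x -> 0 < t -> C (t *: x)) /\ interior C !=set0.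

Definition f3 :=
  exists (C : set 'rV[R]_n) (Cbar sigma tau p : R),
    [/\ solid_cone C, 0 < Cbar, 1 < sigma,
        (alpha < n%:R /\ [/\ - alpha < tau, 0 < p &
           p < (n%:R + alpha + 2 * tau) / (n%:R - alpha)]) \/
        (alpha = n%:R /\ - alpha <= tau /\ 0 < p) &
        forall x v, C x -> Omega (2 * sigma * r) x -> 0 <= v ->
          Cbar * enorm x `^ tau * v `^ p <= f x v].

(* The measurability clause is what makes the integral a Lebesgue integral; the
   right-hand side is an extended real, so the equation includes finiteness. *)
Definition nonneg_solution (u : 'rV[R]_n -> R) :=
  [/\ {within closure (@Omega n r), continuous u},
      forall x, closure (@Omega n r) x -> 0 <= u x,
      lebesgue_measurable (@Omega n r) (fun y => f y (u y)) &
      forall x, closure (@Omega n r) x ->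
        (u x)%:E = (\int[lebesgue_rV R n]_(y in @Omega n r)
                      (green alpha r x y * f y (u y))%:E)%E].

End nonlinearity.
End definitions.

(* Main.v *)
From HB Require Import structures.
Require Import Defs.
From mathcomp Require Import all_boot all_order all_algebra.
From mathcomp Require Import all_classical all_reals all_analysis.
From mathcomp Require Import measurable_realfun ring lra.
Import Order.TTheory GRing.Theory Num.Theory.
Import numFieldNormedType.Exports.
Set Implicit Arguments.
Unset Strict Implicit.
Unset Printing Implicit Defensive.
Local Open Scope classical_set_scope.
Local Open Scope ring_scope.

(** The proof is the method of scaling spheres. For a radius [lam > r], let
  [reflected alpha u lam] be the Kelvin transform of a positive solution [u] with
  respect to the sphere of radius [lam] around the origin. On the annulus between
  [r] and [lam] the solution stays below its Kelvin transform, for every [lam]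
  ([below_reflection_all]); this forces [u] to decay slowly, too slowly for the
  integral equation.

  The comparison rests on the shape of the Green's function. Up to a constant it
  is [kern n alpha q t], where [q] is the squared distance of the two points and
  [t] the product of their defects [enorm x ^+ 2 - r ^+ 2] divided by [r ^+ 2]
  ([greenE]). An inversion replaces distances and defects by larger quantities,
  up to factors absorbed by the Kelvin transform, and [kern] increases in [t],
  decreases in [q], and has increments in [t] that decrease in [q]
  ([kern_four_points]). Folding the integral over the domain onto the annulus
  gives [kelvin_comparison]: [u - reflected alpha u lam] is controlled by the
  part of the annulus on which it is positive, because by subcriticality the
  Kelvin transform is a strict supersolution ([subcritical_kelvin]).

  Two consequences drive the radius from [r] to infinity. If the inequality is
  known outside a thin shell next to the sphere of radius [lam], it holds on the
  whole annulus, since the Lipschitz condition makes the integral operator a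
  contraction on functions supported in the shell ([narrow_region]); and once it
  holds it is strict ([strictly_below]), so that by compactness it survives a
  small increase of the radius.

  The sphere that exchanges [x] with a point of norm [2 * r] yields a lower bound
  of order [enorm x `^ (- ((n%:R - alpha) / 2))] ([initial_lower_bound]). Inserted
  in the integral equation, where the nonlinearity is bounded below on a cone, a
  lower bound with exponent [m] becomes one with exponent [alpha + tau + p * m]
  ([power_lower_bound_step]). The bound on [p] makes these exponents increase by
  steps bounded below until the new exponent is nonnegative
  ([exponent_iteration]), and then infinitely many disjoint boxes contribute a
  fixed amount to one value of [u], which is absurd ([lower_bound_diverges]). Thus
  [u] is not positive everywhere, and a solution that vanishes at one point of the
  domain vanishes identically ([solution_positive]).

  The change of variables under an inversion ([integral_inversion]) is obtained
  from homogeneity: Lebesgue measure and its image under the inversion, weighted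
  by the Jacobian, both scale like [c ^+ n] under dilations, and they are nearly
  equal on thin shells next to the fixed sphere. *)

(** * Scaling of Lebesgue measure *)

Section image_measure.
Context d d' (S : measurableType d) (T : measurableType d') (R : realType).

Lemma measurable_preimage (g : S -> T) (A : set T) :
  measurable_fun setT g -> measurable A -> measurable (g @^-1` A).
Proof. by move=> mg mA; rewrite -[X in measurable X]setTI; exact: mg. Qed.

Definition image_measure (mu : {measure set S -> \bar R}) (g : S -> T)
    (mg : measurable_fun setT g) : {measure set T -> \bar R} :=
  measure_function_pushforward__canonical__measure_function_Measure mu mg.

End image_measure.

Lemma le_measure_null d (T : measurableType d) (R : realType)
    (mu : {measure set T -> \bar R}) (A B N : set T) :
  measurable A -> measurable B -> measurable N -> mu N = 0%E ->
  A `<=` B `|` N -> (mu A <= mu B)%E.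
Proof.
move=> mA mB mN N0 AB; rewrite -[leRHS]adde0 -N0.
apply: le_trans (measureU2 _ mB mN).
by apply: le_measure; rewrite ?inE//; exact: measurableU.
Qed.

Section lebesgue_scaling.
Context {R : realType}.
Local Notation RB := (measurableTypeR R).
Implicit Types c : R.

Lemma mule_invl c (x : \bar R) : 0 < c -> (c%:E * (c^-1%:E * x) = x)%E.
Proof. by move=> c0; rewrite muleA -EFinM divff ?mul1e// gt_eqF. Qed.

Lemma lebesgue_measure_scale c (A : set RB) : 0 < c -> measurable A ->
  lebesgue_measure ((fun s : RB => (c * s : RB)) @^-1` A) =
  ((c^-1)%:E * lebesgue_measure A)%E.
Proof.
move=> c0 mA.
have mc : measurable_fun setT (fun s : RB => (c * s : RB)).
  exact: measurable_funM.
pose k : {nonneg R} := NngNum (ltW c0).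
have := @lebesgue_measure_unique R (mscale k (image_measure lebesgue_measure mc)).
move=> /(_ _ A mA) ->.
  rewrite /= /mscale /image_measure /= /pushforward.
  by rewrite muleCA mule_invl.
move=> _ [[a b] _ <-]; rewrite /= /mscale /image_measure /= /pushforward.
rewrite (_ : _ @^-1` _ = `](c^-1 * a), (c^-1 * b)]%classic).
  rewrite !lebesgue_measure_itv /= !lte_fin ltr_pM2l ?invr_gt0//.
  case: ifPn => _; last by rewrite mule0.
  rewrite -!EFinB -EFinM; congr EFin; field; lra.
apply/seteqP; split => x; rewrite /= !in_itv /= ltr_pdivrMl// ler_pdivlMl//.
Qed.

Lemma measurable_scale_rV n c : measurable_fun setT
  (fun x : 'rV[RB]_n => (c *: (x : 'rV[R]_n) : 'rV[RB]_n)).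
Proof.
apply: measurable_fun_rV => i; under eq_fun do rewrite mxE.
apply: measurable_funM => //; exact: measurable_rV_coord.
Qed.

(** By induction on the dimension: a product measure is determined by
  rectangles, and dilations act on the two factors separately. *)
Lemma lebesgue_rV_scale n c (A : set 'rV[RB]_n) : 0 < c -> measurable A ->
  lebesgue_rV R n ((fun x : 'rV[R]_n => c *: x) @^-1` A) =
  ((c^-1 ^+ n)%:E * lebesgue_rV R n A)%E.
Proof.
move=> c0; elim: n A => [|n IH] A mA.
  by rewrite expr0 mul1e /= !diracE; congr (_%:R%:E); congr nat_of_bool;
    apply/idP/idP => /set_mem h; apply/mem_set; move: h => /=; rewrite scaler0.
rewrite /= /lebesgue_rV_succ /pushforward.
pose S (p : RB * 'rV[RB]_n) : RB * 'rV[RB]_n :=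
  (c * p.1, c *: (p.2 : 'rV[R]_n)).
have mS : measurable_fun setT S.
  apply/measurable_fun_pairP; split.
    by apply: measurable_funM => //; exact: measurable_fst.
  exact: (measurableT_comp (measurable_scale_rV _) measurable_snd).
pose k : {nonneg R} := NngNum (exprn_ge0 n.+1 (ltW c0)).
pose m := mscale k (image_measure (lebesgue_measure \x lebesgue_rV R n)%E mS).
have := @product_measure_unique _ _ _ _ R lebesgue_measure (lebesgue_rV R n) m.
move=> /(_ _ (@rV_cons _ RB n @^-1` A)) ->; last 2 first.
- move=> X Y mX mY; rewrite /m /= /mscale /image_measure /= /pushforward.
  rewrite (_ : _ @^-1` _ = ((fun s : RB => (c * s : RB)) @^-1` X) `*`
    ((fun x : 'rV[R]_n => c *: x) @^-1` Y)); last by [].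
  rewrite product_measure1E/= ?lebesgue_measure_scale ?IH//; last 2 first.
  - by apply: measurable_preimage => //; exact: measurable_funM.
  - exact: (measurable_preimage (measurable_scale_rV c)).
  have cE : ((c^-1)%:E * (c^-1 ^+ n)%:E)%E = ((c ^+ n.+1)^-1)%:E.
    by rewrite -EFinM -exprS exprVn.
  rewrite [X in (_ * X)%E = _]muleACA cE; apply: mule_invl.
  exact: exprn_gt0.
- by apply: measurable_preimage mA; exact: measurable_rV_cons.
rewrite /m /= /mscale /image_measure /= /pushforward muleA -EFinM -exprMn mulVf ?gt_eqF//.
rewrite expr1n mul1e; congr (product_measure1 _ _ _).
apply/funext => -[s x]; rewrite /preimage /=; congr (A _).
apply/rowP => i; rewrite /= !mxE.
by case: unliftP => [j _|_]//=; rewrite mxE.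
Qed.

End lebesgue_scaling.

(** * Integration against a density *)

Section density.
Local Open Scope ereal_scope.
Context d (T : measurableType d) (R : realType).
Variables (mu : {measure set T -> \bar R}) (w : T -> R).
Hypotheses (mw : measurable_fun setT w) (w0 : forall x, (0 <= w x)%R).

Definition density of measurable_fun setT w & (forall x, (0 <= w x)%R) :=
  fun A : set T => \int[mu]_(x in A) (w x)%:E.

Let density0 : density mw w0 set0 = 0.
Proof. by rewrite /density integral_set0. Qed.

Let density_ge0 A : 0 <= density mw w0 A.
Proof. by apply: integral_ge0 => x _; rewrite lee_fin. Qed.

Let density_sigma_additive : semi_sigma_additive (density mw w0).
Proof.
by apply: semi_sigma_additive_nng_induced => //; exact/measurable_EFinP.
Qed.

HB.instance Definition _ := isMeasure.Build _ _ _ (density mw w0)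
  density0 density_ge0 density_sigma_additive.

Import HBNNSimple.

(** Both sides are additive and pass to increasing limits, so that only
  indicators have to be compared. *)
Lemma integral_density (f : T -> \bar R) :
  measurable_fun setT f -> (forall x, 0 <= f x) ->
  \int[density mw w0]_x f x = \int[mu]_x ((w x)%:E * f x).
Proof.
move=> mf f0; pose f_ := nnsfun_approx measurableT mf.
have f_cvg x : (f_ n x)%:E @[n --> \oo] --> f x.
  by apply: cvg_nnsfun_approx => // y _; exact: f0.
transitivity (limn (fun n => \int[density mw w0]_x (f_ n x)%:E)).
  rewrite -monotone_convergence//=.
  - by apply: eq_integral => x _; apply/esym/cvg_lim => //.
  - by move=> n; exact/measurable_EFinP/measurable_funTS.
  - by move=> n x _; rewrite lee_fin.
  - by move=> x _ m n mn; rewrite lee_fin; exact/lefP/nd_nnsfun_approx.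
transitivity (limn (fun n => \int[mu]_x ((w x)%:E * (f_ n x)%:E))); last first.
  rewrite -monotone_convergence//=.
  - apply: eq_integral => x _; apply/cvg_lim => //.
    by apply: cvgeZl => //.
  - move=> n; rewrite -[X in measurable_fun _ X]/(EFin \o (w \* f_ n)%R).
    by apply/measurable_EFinP; exact: measurable_funM.
  - by move=> n x _; rewrite -EFinM lee_fin mulr_ge0.
  - move=> x _ m n mn; rewrite -!EFinM lee_fin ler_wpM2l//.
    exact/lefP/nd_nnsfun_approx.
congr (limn _); apply/funext => n.
have mpre r : measurable (f_ n @^-1` [set r]).
  by rewrite -[X in measurable X]setTI; exact: measurable_funP.
transitivity (\sum_(k \in range (f_ n))
    \int[mu]_x (k * (w x * \1_(f_ n @^-1` [set k]) x))%:E).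
  under eq_integral do rewrite fimfunE -fsumEFin//.
  rewrite ge0_integral_fsum//; last 2 first.
  - by move=> y; exact/measurable_EFinP/measurable_funM.
  - by move=> y x _; rewrite nnfun_muleindic_ge0.
  apply: eq_fsbigr => r rf; rewrite integralZl_indic_nnsfun// integral_indic//=.
  have r0 : (0 <= r)%R by move: rf; rewrite inE => -[x _ <-].
  under [RHS]eq_integral do rewrite EFinM.
  rewrite ge0_integralZl//.
    rewrite setIT; congr (_ * _); rewrite /density integral_mkcond.
    apply: eq_integral => x _; rewrite patchE indicE; case: ifPn => _;
    by rewrite ?mulr1 ?mulr0.
    by apply/measurable_EFinP; apply: measurable_funM.
  by move=> x _; rewrite lee_fin mulr_ge0.
transitivity (\int[mu]_x \sum_(k \in range (f_ n))
    (k * (w x * \1_(f_ n @^-1` [set k]) x))%:E); last first.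
  apply: eq_integral => x _; rewrite fsumEFin// -EFinM; congr EFin.
  rewrite [in RHS]fimfunE mulr_fsumr//.
  by apply: eq_fsbigr => r _; rewrite mulrCA.
rewrite ge0_integral_fsum//.
- move=> r; apply/measurable_EFinP/measurable_funM => //.
  exact: measurable_funM.
- move=> r x _; rewrite mulrCA EFinM mule_ge0 ?lee_fin// -lee_fin.
  exact: nnfun_muleindic_ge0.
Qed.

End density.

(** * The Euclidean norm and inversions in spheres *)

Section euclidean_norm.
Context {R : realType} {n : nat}.
Implicit Types (x y : 'rV[R]_n) (c : R).

Definition dot x y : R := \sum_i x ord0 i * y ord0 i.

Lemma enorm_ge0 x : 0 <= enorm x.
Proof. exact: sqrtr_ge0. Qed.

Lemma enorm_sqr x : enorm x ^+ 2 = dot x x.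
Proof.
rewrite /enorm sqr_sqrtr; last by apply: sumr_ge0 => i _; exact: sqr_ge0.
by apply: eq_bigr => i _; rewrite expr2.
Qed.

Lemma enormZ c x : enorm (c *: x) = `|c| * enorm x.
Proof.
rewrite /enorm -sqrtr_sqr -sqrtrM ?sqr_ge0// mulr_sumr.
by congr Num.sqrt; apply: eq_bigr => i _; rewrite mxE exprMn.
Qed.

Lemma coord_le_enorm x i : `|x ord0 i| <= enorm x.
Proof.
rewrite -sqrtr_sqr ler_wsqrtr// (bigD1 i)//= lerDl.
by rewrite sumr_ge0// => j _; exact: sqr_ge0.
Qed.

Lemma enorm_eq0 x : (enorm x == 0) = (x == 0).
Proof.
apply/eqP/eqP => [x0|->].
  apply/rowP => i; rewrite mxE; apply/eqP; rewrite -normr_le0 -x0.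
  exact: coord_le_enorm.
by rewrite /enorm big1 ?sqrtr0// => i _; rewrite mxE expr0n.
Qed.

Lemma enorm_gt0 x : (0 < enorm x) = (x != 0).
Proof. by rewrite lt_def enorm_ge0 andbT enorm_eq0. Qed.

Lemma enorm0 : enorm (0 : 'rV[R]_n) = 0.
Proof. by apply/eqP; rewrite enorm_eq0. Qed.

Lemma dotZl c x y : dot (c *: x) y = c * dot x y.
Proof. by rewrite mulr_sumr; apply: eq_bigr => i _; rewrite mxE mulrA. Qed.

Lemma dotC x y : dot x y = dot y x.
Proof. by apply: eq_bigr => i _; rewrite mulrC. Qed.

Lemma dotZr c x y : dot x (c *: y) = c * dot x y.
Proof. by rewrite dotC dotZl dotC. Qed.

Lemma enormB_sqr x y :
  enorm (x - y) ^+ 2 = enorm x ^+ 2 - 2 * dot x y + enorm y ^+ 2.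
Proof.
rewrite !enorm_sqr /dot mulr_sumr -sumrB -big_split/=.
by apply: eq_bigr => i _; rewrite !mxE; ring.
Qed.

Lemma enormB_sqr_le x y :
  enorm (x - y) ^+ 2 <= 2 * (enorm x ^+ 2 + enorm y ^+ 2).
Proof.
have : 0 <= enorm (x + y) ^+ 2 by exact: sqr_ge0.
rewrite -[y in x + y]opprK !enormB_sqr -(scaleN1r y) dotZr enormZ normrN1; lra.
Qed.

Definition inversion (lam : R) y : 'rV[R]_n := (lam ^+ 2 / enorm y ^+ 2) *: y.

Lemma enorm_inversion lam y : y != 0 ->
  enorm (inversion lam y) = lam ^+ 2 / enorm y.
Proof.
rewrite -enorm_gt0 => y0; rewrite /inversion enormZ ger0_norm.
  by field; rewrite gt_eqF.
by rewrite divr_ge0// sqr_ge0.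
Qed.

Lemma inversion_neq0 lam y : 0 < lam -> y != 0 -> inversion lam y != 0.
Proof.
move=> lam0 y0; rewrite -enorm_gt0 enorm_inversion// divr_gt0 ?exprn_gt0//.
by rewrite enorm_gt0.
Qed.

Lemma direction_inversion lam y : 0 < lam -> y != 0 ->
  (enorm (inversion lam y))^-1 *: inversion lam y = (enorm y)^-1 *: y.
Proof.
move=> lam0 y0; rewrite enorm_inversion// /inversion scalerA; congr (_ *: _).
move: y0; rewrite -enorm_gt0 => y0; field.
by rewrite !gt_eqF.
Qed.

End euclidean_norm.

Section measurability.
Context {R : realType} {n : nat}.
Local Notation RB := (measurableTypeR R).
Local Notation V := 'rV[RB]_n.

(** The inverse of a nonnegative number, including the convention at [0], is its
  power [-1]. *)
Lemma measurable_invr_nneg d (T : measurableType d) (f : T -> R) :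
  (forall x, 0 <= f x) -> measurable_fun setT f ->
  measurable_fun setT (fun x => (f x)^-1).
Proof.
move=> f0 mf; rewrite (_ : (fun _ => _) = (fun x => f x `^ (-1))).
  exact: (measurableT_comp (measurable_powR _) mf).
by apply/funext => x; rewrite powR_inv1.
Qed.

Lemma measurable_enorm : measurable_fun setT (fun x : V => enorm (x : 'rV[R]_n)).
Proof.
rewrite (_ : (fun _ => _) =
  (Num.sqrt \o (fun x : V => \sum_(i < n) (x ord0 i : R) ^+ 2))) //.
apply: measurableT_comp.
  by apply: continuous_measurable_fun; exact: sqrt_continuous.
apply: measurable_sum => i; apply: measurable_funX.
exact: measurable_rV_coord.
Qed.

Lemma measurable_scale_fun d (T : measurableType d) (c : T -> R) (f : T -> V) :
  measurable_fun setT c -> measurable_fun setT f ->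
  measurable_fun setT (fun x => (c x *: (f x : 'rV[R]_n) : V)).
Proof.
move=> mc mf; apply: measurable_fun_rV => i; under eq_fun do rewrite mxE.
apply: measurable_funM => //; exact: (measurableT_comp (measurable_rV_coord i)).
Qed.

Lemma measurable_sub_rV (a : V) :
  measurable_fun setT (fun x : V => ((a : 'rV[R]_n) - x : V)).
Proof.
apply: measurable_fun_rV => i; under eq_fun do rewrite !mxE.
apply: measurable_funB => //; exact: measurable_rV_coord.
Qed.

Lemma measurable_inversion (lam : R) :
  measurable_fun setT (fun x : V => (inversion lam x : V)).
Proof.
apply: measurable_scale_fun => //; apply: measurable_funM => //.
apply: measurable_invr_nneg => [x|]; first exact: sqr_ge0.
apply: measurable_funX; exact: measurable_enorm.
Qed.

Lemma measurable_direction :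
  measurable_fun setT (fun x : V => ((enorm x)^-1 *: (x : 'rV[R]_n) : V)).
Proof.
apply: measurable_scale_fun => //; apply: measurable_invr_nneg => [x|].
  exact: enorm_ge0.
exact: measurable_enorm.
Qed.

End measurability.

(** * Homogeneous measures are determined by thin sectors *)

Section sectors.
Context {R : realType} {n : nat}.
Local Notation RB := (measurableTypeR R).
Local Notation V := 'rV[RB]_n.
Implicit Types (a b c p q : R) (B : set V).

(** Truncated cones. The radii range over a half-open interval, so that adjacent
  sectors are disjoint. *)
Definition sector a b B : set V :=
  [set y : 'rV[R]_n | a < enorm y <= b /\ B ((enorm y)^-1 *: y)].

Lemma measurable_sector a b B : measurable B -> measurable (sector a b B).
Proof.
move=> mB; rewrite (_ : sector a b B =
  (fun y : V => enorm (y : 'rV[R]_n)) @^-1` `]a, b] `&`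
  (fun y : V => (enorm y)^-1 *: (y : 'rV[R]_n) : V) @^-1` B).
  apply: measurableI.
    by apply: measurable_preimage => //; exact: measurable_enorm.
  by apply: measurable_preimage mB; exact: measurable_direction.
by apply/seteqP; split => y; rewrite /sector /= in_itv.
Qed.

Lemma scale_sector a b c B : 0 < c ->
  (fun y : V => (c *: (y : 'rV[R]_n) : V)) @^-1` sector a b B =
  sector (c^-1 * a) (c^-1 * b) B.
Proof.
move=> c0; apply/seteqP; split => y; rewrite /sector /=;
  rewrite enormZ gtr0_norm// scalerA invfM mulrAC mulVf ?gt_eqF// mul1r;
  by rewrite ltr_pdivrMl// ler_pdivlMl.
Qed.

Lemma sector_split a b c B : a <= c -> c <= b ->
  sector a b B = sector a c B `|` sector c b B.
Proof.
move=> ac cb; apply/seteqP; split => y; rewrite /sector /=.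
  move=> [/andP[ay yb] By]; have [yc|cy] := leP (enorm y) c.
    by left; rewrite ay.
  by right; rewrite yb.
move=> [[/andP[ay yc] By]|[/andP[cy yb] By]]; split=> //.
  by rewrite ay (le_trans yc).
by rewrite yb (le_lt_trans ac).
Qed.

Lemma sector_disjoint a b c B : [disjoint sector a c B & sector c b B].
Proof.
apply/disj_setPS => y; rewrite /sector /=.
by move=> [[/andP[_ yc] _] [/andP[cy _] _]]; rewrite ltNge yc in cy.
Qed.

(** The property shared by Lebesgue measure and by its image under an inversion,
  once the latter is weighted by the Jacobian; it reduces their equality to a
  comparison on arbitrarily thin sectors. *)
Definition homogeneous (M : set V -> \bar R) := forall c (A : set V), 0 < c ->
  measurable A ->
  M ((fun y : V => (c *: (y : 'rV[R]_n) : V)) @^-1` A) = ((c^-1 ^+ n)%:E * M A)%E.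

Definition finite_on_sectors (M : set V -> \bar R) :=
  forall a b B, 0 < a -> measurable B -> (M (sector a b B) < +oo)%E.

Section homogeneous_measure.
Variable M : {measure set V -> \bar R}.
Hypotheses (homM : homogeneous M) (finM : finite_on_sectors M).
Variable B : set V.
Hypothesis mB : measurable B.

Definition sector_mass q := fine (M (sector 1 q B)).

Lemma sector_massE q : M (sector 1 q B) = (sector_mass q)%:E.
Proof. by rewrite /sector_mass fineK// ge0_fin_numE// finM. Qed.

Lemma measure_sector a b : 0 < a ->
  M (sector a b B) = (a ^+ n * sector_mass (b / a))%:E.
Proof.
move=> a0; have := homM (c := a^-1) (A := sector 1 (b / a) B).
rewrite invr_gt0 => /(_ a0 (measurable_sector _ _ mB)).
rewrite scale_sector ?invr_gt0// invrK mulr1.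
by rewrite [X in sector a X](_ : _ = b) ?sector_massE//; field; lra.
Qed.

Lemma sector_massM p q : 1 <= p -> 1 <= q ->
  sector_mass (p * q) = sector_mass p + p ^+ n * sector_mass q.
Proof.
move=> p1 q1; have p0 : 0 < p by lra.
have pq : p <= p * q by rewrite ler_peMr// ltW.
apply: EFin_inj; rewrite -sector_massE (sector_split _ p1 pq).
rewrite measureU//; [|exact: measurable_sector..|].
  rewrite EFinD -sector_massE; congr (_ + _)%E.
  apply: etrans (measure_sector _ p0) _.
  by rewrite [X in sector_mass X](_ : _ = q)//; field; lra.
by apply/disj_set2P; exact: sector_disjoint.
Qed.

(** Splitting the sector of ratio [p * q] at [p] or at [q] gives the same mass;
  hence the mass is a constant multiple of [q ^+ n - 1]. *)
Lemma sector_mass_proportional p q : 1 <= p -> 1 <= q ->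
  sector_mass p * (q ^+ n - 1) = sector_mass q * (p ^+ n - 1).
Proof.
move=> p1 q1; have := sector_massM p1 q1; rewrite mulrC sector_massM//; lra.
Qed.

End homogeneous_measure.

Lemma ler_expr_gt1 m (x y : R) : (forall q, 1 < q -> x <= q ^+ m * y) -> x <= y.
Proof.
move=> h; have : (fun q : R => q ^+ m * y) @ (1 : R)^'+ --> (1 ^+ m * y).
  apply: cvg_at_right_filter; apply: cvgM; last exact: cvg_cst.
  exact: exprn_continuous.
rewrite expr1n mul1r => /cvgr_to_ge; apply.
by near=> q; apply: h; near: q; exact: nbhs_right_gt.
Unshelve. all: by end_near. Qed.

(** The thinner the sector, the closer the factor [q ^+ m] is to [1]; by
  proportionality all sectors profit from the comparison on the thinnest ones. *)
Lemma comparable_homogeneous m (M M' : {measure set V -> \bar R}) :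
  homogeneous M -> finite_on_sectors M ->
  homogeneous M' -> finite_on_sectors M' -> (0 < n)%N ->
  (forall q B, 1 < q -> measurable B ->
    sector_mass M B q <= q ^+ m * sector_mass M' B q) ->
  forall p B, 1 < p -> measurable B -> sector_mass M B p <= sector_mass M' B p.
Proof.
move=> hM fM hM' fM' n0 MM' p B p1 mB; apply: (@ler_expr_gt1 m) => q q1.
have q1' : 0 < q ^+ n - 1 by rewrite subr_gt0 exprn_egt1// -lt0n.
have p1' : 0 < p ^+ n - 1 by rewrite subr_gt0 exprn_egt1// -lt0n.
rewrite -(ler_pM2r q1') -mulrA.
rewrite (sector_mass_proportional hM fM mB (ltW p1) (ltW q1)).
rewrite (sector_mass_proportional hM' fM' mB (ltW p1) (ltW q1)) mulrA.
by rewrite ler_pM2r// MM'.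
Qed.

Definition punctured : set V := ~` [set (0 : 'rV[R]_n)].

Lemma measurable_punctured : measurable punctured.
Proof.
rewrite (_ : punctured =
    (fun y : V => enorm (y : 'rV[R]_n)) @^-1` `]0, +oo[).
  by apply: measurable_preimage => //; exact: measurable_enorm.
apply/seteqP; split => y; rewrite /punctured /= in_itv/= andbT enorm_gt0.
  by move/eqP.
by move=> /eqP.
Qed.

(** Log-polar coordinates turn the sectors into rectangles with arbitrary
  bounded sides, so that sectors determine a measure. *)
Definition log_polar (y : V) : RB * V :=
  (ln (enorm (y : 'rV[R]_n)), (enorm (y : 'rV[R]_n))^-1 *: (y : 'rV[R]_n)).

Lemma measurable_log_polar : measurable_fun setT log_polar.
Proof.
apply/measurable_fun_pairP; split; last exact: measurable_direction.
apply: (measurableT_comp (@measurable_ln R)); exact: measurable_enorm.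
Qed.

Definition log_polar_inv (p : RB * V) : V := expR p.1 *: (p.2 : 'rV[R]_n).

Lemma measurable_log_polar_inv : measurable_fun setT log_polar_inv.
Proof.
apply: measurable_scale_fun; last exact: measurable_snd.
apply: (measurableT_comp (@measurable_expR R)); exact: measurable_fst.
Qed.

Lemma log_polarK y : punctured y -> log_polar_inv (log_polar y) = y.
Proof.
move=> /eqP; rewrite -enorm_gt0 => y0.
by rewrite /log_polar_inv /= lnK ?posrE// scalerA divff ?gt_eqF// scale1r.
Qed.

Lemma log_polar_rectangle (a b : R) B :
  log_polar @^-1` (`]a, b]%classic `*` B) `&` punctured =
  sector (expR a) (expR b) B.
Proof.
apply/seteqP; split => y; rewrite /sector /punctured /=.
  move=> [[]]; rewrite in_itv/= => yab By /eqP; rewrite -enorm_gt0 => y0.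
  split => //; rewrite -[enorm y]lnK ?posrE// ltr_expR ler_expR.
  by move: yab; rewrite ?lnK ?posrE.
move=> [/andP[ay yb] By].
have y0 : 0 < enorm y by apply: le_lt_trans ay; exact: expR_ge0.
split; last by apply/eqP; rewrite -enorm_gt0.
split=> //; rewrite in_itv/= -[a]expRK -[b]expRK.
by rewrite ltr_ln ?ler_ln ?posrE ?expR_gt0// ay.
Qed.

(** In log-polar coordinates this is uniqueness of a measure on a product space,
  applied first in the radial variable and then to the products themselves. *)
Lemma measure_eq_on_sectors (M M' : {measure set V -> \bar R}) :
  finite_on_sectors M ->
  (forall a b B, 0 < a -> a < b -> measurable B ->
    M (sector a b B) = M' (sector a b B)) ->
  forall A, measurable A -> M (A `&` punctured) = M' (A `&` punctured).
Proof.
move=> fM MM' A mA.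
pose N := image_measure (mrestr M measurable_punctured) measurable_log_polar.
pose N' := image_measure (mrestr M' measurable_punctured) measurable_log_polar.
have NE X : N X = M (log_polar @^-1` X `&` punctured) by [].
have N'E X : N' X = M' (log_polar @^-1` X `&` punctured) by [].
have rect a b B : measurable B ->
    N (`]a, b]%classic `*` B) = N' (`]a, b]%classic `*` B).
  move=> mB; rewrite NE N'E log_polar_rectangle; have [ba|ab] := leP b a.
    rewrite (_ : sector _ _ _ = set0) ?measure0//.
    rewrite -subset0 => y [/andP[h1 h2] _]; have := lt_le_trans h1 h2.
    by rewrite ltr_expR ltNge ba.
  by apply: MM' => //; [exact: expR_gt0|rewrite ltr_expR].
have Nfin (a b : R) : (N (`]a, b]%classic `*` setT) < +oo)%E.
  by rewrite NE log_polar_rectangle fM// expR_gt0.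
pose g k : set RB := `](- k%:R : R), k%:R]%classic.
have gT : \bigcup_k g k = setT.
  apply/seteqP; split => // x _; exists (Num.bound `|x|) => //=.
  have /ltr_normlP[h1 h2] := archi_boundP (normr_ge0 x).
  by rewrite /g /= in_itv/= ltrNl h1 ltW.
have cyl X B : measurable X -> measurable B -> N (X `*` B) = N' (X `*` B).
  move=> mX mB; have mTB : measurable ([set: RB] `*` B) by exact: measurableX.
  pose m := image_measure (mrestr N mTB) measurable_fst.
  pose m' := image_measure (mrestr N' mTB) measurable_fst.
  have fstE Y : fst @^-1` Y `&` ([set: RB] `*` B) = Y `*` B.
    by apply/seteqP; split => -[x y] /=; tauto.
  have mE Y : m Y = N (Y `*` B) by rewrite -fstE.
  have m'E Y : m' Y = N' (Y `*` B) by rewrite -fstE.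
  rewrite -mE -m'E; apply: (@measure_unique _ R RB (@ocitv R : set (set RB)) g _ _ _ _ m m') => //.
  - exact: ocitvI.
  - by move=> k; exact: is_ocitv.
  - by move=> _ [[a b] _ <-]; rewrite mE m'E rect.
  - move=> k; rewrite mE (le_lt_trans _ (Nfin (- k%:R) k%:R))//.
    apply: le_measure; rewrite ?inE; [|exact: measurableX|].
      by apply: measurableX => //; exact: measurable_itv.
    by move=> x [].
have AE : A `&` punctured =
    log_polar @^-1` (log_polar_inv @^-1` A) `&` punctured.
  by apply/seteqP; split => y [Ay py]; split => //=; move: Ay; rewrite /= log_polarK.
rewrite AE -NE -N'E.
pose G := [set X `*` Y |
  X in (measurable : set (set RB)) & Y in (measurable : set (set V))].
apply: (@measure_unique _ R (RB * V)%type G (fun k => g k `*` setT) _ _ _ _ N N') => //.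
- exact: measurable_prod_measurableType.
- move=> _ _ [X mX [Y mY <-]] [X' mX' [Y' mY' <-]]; rewrite -setXI.
  exists (X `&` X'); first exact: measurableI.
  by exists (Y `&` Y') => //; exact: measurableI.
- by move=> k; exists (g k); [exact: measurable_itv|exists setT].
- by rewrite -setX_bigcupl gT setXTT.
- by move=> _ [X mX [Y mY <-]]; exact: cyl.
- by move=> k; exact: Nfin.
- by apply: measurable_preimage mA; exact: measurable_log_polar_inv.
Qed.

End sectors.

(** * Lebesgue measure of cubes, points and spheres *)

Section bounded_density.
Context d (T : measurableType d) (R : realType) (mu : {measure set T -> \bar R}).
Variables (w : T -> R) (E : set T) (K : R).
Hypotheses (mE : measurable E) (mw : measurable_fun setT w).
Hypothesis w0 : forall x, E x -> 0 <= w x.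

Lemma integral_le_cst : 0 <= K -> (forall x, E x -> w x <= K) ->
  (\int[mu]_(x in E) (w x)%:E <= K%:E * mu E)%E.
Proof.
move=> K0 wK; rewrite -integral_cst//; apply: ge0_le_integral => //.
- by apply/measurable_EFinP; exact: measurable_funTS.
Qed.

Lemma integral_ge_cst : 0 <= K -> (forall x, E x -> K <= w x) ->
  (K%:E * mu E <= \int[mu]_(x in E) (w x)%:E)%E.
Proof.
move=> K0 wK; rewrite -integral_cst//; apply: ge0_le_integral => //.
- by apply/measurable_EFinP; exact: measurable_funTS.
Qed.

End bounded_density.

Section lebesgue_homogeneous.
Context {R : realType} {n : nat}.
Local Notation RB := (measurableTypeR R).
Local Notation V := 'rV[RB]_n.
Local Notation mu := (lebesgue_rV R n).

Lemma homogeneous_lebesgue : homogeneous mu.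
Proof. by move=> c A c0 mA; exact: lebesgue_rV_scale. Qed.

Definition cube (x : 'rV[R]_n) (b : R) : set V :=
  [set y : 'rV[R]_n | forall i, `](x ord0 i - b), (x ord0 i + b)[%classic (y ord0 i)].

Lemma measurable_cube x b : measurable (cube x b).
Proof.
rewrite (_ : cube x b = \bigcap_(i in [set: 'I_n])
    (@rV_coord _ RB n i @^-1` `](x ord0 i - b), (x ord0 i + b)[%classic)).
  apply: fin_bigcap_measurable => // i _.
  by apply: measurable_preimage; [exact: measurable_rV_coord|exact: measurable_itv].
by apply/seteqP; split => [y h i _|y h i]; exact: h.
Qed.

Lemma lebesgue_cube x b : 0 <= b -> mu (cube x b) = ((2 * b) ^+ n)%:E.
Proof.
move=> b0; rewrite /cube.
rewrite (lebesgue_rV_setX (A := fun i => `](x ord0 i - b), (x ord0 i + b)[%classic)).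
  under eq_bigr => i _.
    rewrite lebesgue_measure_itv/= lte_fin ltrD2l.
    rewrite (_ : (if _ then _ else _) = (2 * b)%:E); last first.
      case: ifPn => bb; first by rewrite -EFinB; congr EFin; lra.
      by congr EFin; lra.
    over.
  by rewrite prodEFin prodr_const card_ord.
by move=> i; exact: measurable_itv.
Qed.

Lemma sector_cube a b c B : b < c -> sector a b B `<=` cube 0 c.
Proof.
move=> bc y [/andP[_ yb] _] i /=; rewrite in_itv/= mxE sub0r add0r.
rewrite -ltr_norml (le_lt_trans _ bc)// (le_trans _ yb)//.
exact: coord_le_enorm.
Qed.

Lemma finite_on_sectors_lebesgue : finite_on_sectors mu.
Proof.
move=> a b B a0 mB; apply: (@le_lt_trans _ _ (mu (cube 0 (Num.max 0 b + 1)))).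
  apply: le_measure; rewrite ?inE; [exact: measurable_sector|exact: measurable_cube|].
  by apply: sector_cube; rewrite ltr_pwDr// le_max lexx orbT.
by rewrite lebesgue_cube ?ltry// addr_ge0// le_max lexx.
Qed.

Lemma measurable_point (x : 'rV[R]_n) : measurable [set x : V].
Proof.
rewrite (_ : [set _] = (fun y : V => enorm (x - y : 'rV[R]_n)) @^-1` [set 0]).
  apply: measurable_preimage => //.
  exact: (measurableT_comp measurable_enorm (measurable_sub_rV x)).
apply/seteqP; split => y /=; first by move=> ->; rewrite subrr enorm0.
by move=> /eqP; rewrite enorm_eq0 subr_eq0 => /eqP ->.
Qed.

Lemma lebesgue_point (x : 'rV[R]_n) : (0 < n)%N -> mu [set x] = 0%E.
Proof.
move=> n0; apply/eqP; rewrite eq_le measure_ge0 andbT.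
apply/lee_addgt0Pr => e e0; rewrite add0e.
have e10 : 0 < Num.min 1 e by rewrite lt_min ltr01.
apply: (@le_trans _ _ (mu (cube x (Num.min 1 e / 2)))).
  apply: le_measure; rewrite ?inE; [exact: measurable_point|exact: measurable_cube|].
  by move=> _ -> i /=; rewrite in_itv/=; apply/andP; split; lra.
rewrite lebesgue_cube; last lra.
rewrite lee_fin (_ : 2 * _ = Num.min 1 e); last lra.
apply: (@le_trans _ _ (Num.min 1 e ^+ 1)).
  by apply: ler_wiXn2l => //; [exact: ltW|by rewrite ge_min lexx].
by rewrite expr1 ge_min lexx orbT.
Qed.

Definition sphere c : set V := [set y : 'rV[R]_n | enorm y = c].

Lemma measurable_sphere c : measurable (sphere c).
Proof.
rewrite (_ : sphere c = (fun y : V => enorm (y : 'rV[R]_n)) @^-1` [set c]) //.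
by apply: measurable_preimage => //; exact: measurable_enorm.
Qed.

(** Shells of ratio [q] inside the sphere have a mass proportional to
  [q ^+ n - 1], which tends to [0] as [q] tends to [1]. *)
Lemma lebesgue_sphere c : (0 < n)%N -> 0 < c -> mu (sphere c) = 0%E.
Proof.
move=> n0 c0; apply/eqP; rewrite eq_le measure_ge0 andbT.
pose sm := sector_mass mu setT.
have sms q := sector_massE finite_on_sectors_lebesgue (@measurableT _ V) q.
pose k := sm 2 / (2 ^+ n - 1).
have k0 : 0 < 2 ^+ n - 1 :> R by rewrite subr_gt0 exprn_egt1 ?ltr1n// -lt0n.
have smE q : 1 < q -> sm q = (q ^+ n - 1) * k.
  move=> q1; rewrite /k mulrC mulrAC; apply: (canRL (mulfK _)).
    by rewrite gt_eqF.
  apply: sector_mass_proportional => //.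
  - exact: homogeneous_lebesgue.
  - exact: finite_on_sectors_lebesgue.
  - exact: ltW.
  - by rewrite ler1n.
have sle q : 1 < q -> (mu (sphere c) <= (c ^+ n * (q ^+ n - 1) * k)%:E)%E.
  move=> q1; apply: (@le_trans _ _ (mu (sector (c / q) c setT))).
    apply: le_measure; rewrite ?inE; [exact: measurable_sphere|exact: measurable_sector|].
    move=> y yc; split => //; rewrite yc lexx ltr_pdivrMr ?ltr_pMr//; lra.
  rewrite (measure_sector homogeneous_lebesgue finite_on_sectors_lebesgue)//; last first.
    by rewrite divr_gt0//; lra.
  rewrite (_ : c / (c / q) = q); last by field; rewrite !gt_eqF//; lra.
  rewrite -/sm smE// lee_fin mulrA.
  have q1n : 0 <= q ^+ n - 1 by rewrite subr_ge0 exprn_ege1 ?ltW.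
  have k0' : 0 <= k by rewrite divr_ge0 ?fine_ge0// ltW.
  rewrite ler_wpM2r// ler_wpM2r// lerXn2r ?nnegrE ?divr_ge0 ?ltW//; first lra.
  by rewrite ltr_pdivrMr ?ltr_pMr//; lra.
have sfin : mu (sphere c) \is a fin_num.
  by rewrite ge0_fin_numE// (le_lt_trans (sle 2 _)) ?ltry// ltr1n.
rewrite -(fineK sfin) lee_fin.
have : fine (mu (sphere c)) + c ^+ n * k <= c ^+ n * k.
  apply: (@ler_expr_gt1 _ n) => q q1.
  have := sle q q1; rewrite -(fineK sfin) lee_fin; lra.
lra.
Qed.

End lebesgue_homogeneous.

(** * The change of variables formula for an inversion *)

Section inversion_change_of_variables.
Context {R : realType} {n : nat}.
Local Notation RB := (measurableTypeR R).
Local Notation V := 'rV[RB]_n.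
Local Notation mu := (lebesgue_rV R n).
Variable lam : R.
Hypotheses (n0 : (0 < n)%N) (lam0 : 0 < lam).

Definition inversion_jacobian (y : V) : R := (lam / enorm (y : 'rV[R]_n)) ^+ (2 * n).

Lemma inversion_jacobian_ge0 y : 0 <= inversion_jacobian y.
Proof. by rewrite exprn_ge0// divr_ge0// ?enorm_ge0// ltW. Qed.

Lemma measurable_inversion_jacobian : measurable_fun setT inversion_jacobian.
Proof.
apply: measurable_funX; apply: measurable_funM => //.
apply: measurable_invr_nneg; last exact: measurable_enorm.
by move=> x; exact: enorm_ge0.
Qed.

Let inv (y : V) : V := inversion lam y.

Let minv : measurable_fun setT inv.
Proof. exact: measurable_inversion. Qed.

(** Its equality with Lebesgue measure is the change of variables formula. *)
Definition inverted_lebesgue : {measure set V -> \bar R} :=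
  image_measure (density mu measurable_inversion_jacobian inversion_jacobian_ge0) minv.

Lemma inverted_lebesgueE A : inverted_lebesgue A =
  (\int[mu]_(y in inv @^-1` A) (inversion_jacobian y)%:E)%E.
Proof. by []. Qed.

Lemma inverted_homogeneous : homogeneous inverted_lebesgue.
Proof.
move=> c A c0 mA; rewrite !inverted_lebesgueE.
have ci0 : 0 < c^-1 by rewrite invr_gt0.
have ck0 : 0 <= c^-1 ^+ (2 * n) by rewrite exprn_ge0// ltW.
pose sc := fun y : V => c^-1 *: (y : 'rV[R]_n) : V.
have msc : measurable_fun setT sc by exact: measurable_scale_rV.
have mE : measurable (inv @^-1` A) by exact: measurable_preimage mA.
have -> : inv @^-1` ((fun y : V => c *: (y : 'rV[R]_n) : V) @^-1` A) =
    sc @^-1` (inv @^-1` A).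
  apply/funext => y; rewrite /preimage /=; congr (A _); rewrite /inv /sc.
  rewrite /inversion enormZ gtr0_norm// !scalerA; congr (_ *: _).
  have [->|] := eqVneq (enorm y) 0; first by rewrite mulr0 expr0n/= invr0 !mulr0 mul0r.
  by move=> y0; field; rewrite y0 gt_eqF.
transitivity (\int[mu]_(y in sc @^-1` (inv @^-1` A))
    ((fun z => (c^-1 ^+ (2 * n) * inversion_jacobian z)%:E) \o sc) y)%E.
  apply: eq_integral => y _ /=; congr EFin; rewrite /inversion_jacobian /sc.
  rewrite enormZ gtr0_norm// -exprMn; congr (_ ^+ _).
  have [->|] := eqVneq (enorm y) 0; first by rewrite mulr0 invr0 !mulr0.
  by move=> y0; field; rewrite y0 gt_eqF.
rewrite -ge0_integral_pushforward//; last 2 first.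
- apply/measurable_EFinP/measurable_funM => //; apply: measurable_funTS.
  exact: measurable_inversion_jacobian.
- by move=> y _; rewrite lee_fin mulr_ge0// inversion_jacobian_ge0.
pose k : {nonneg R} := NngNum (exprn_ge0 n (ltW c0)).
rewrite (@eq_measure_integral _ _ _ _ (mscale k mu)); last first.
  move=> X mX _; rewrite /= /mscale /pushforward/=.
  by apply: etrans (lebesgue_rV_scale ci0 mX) _; rewrite invrK.
rewrite ge0_integral_mscale//; last 2 first.
- apply/measurable_EFinP/measurable_funM => //; apply: measurable_funTS.
  exact: measurable_inversion_jacobian.
- by move=> y _; rewrite lee_fin mulr_ge0// inversion_jacobian_ge0.
under eq_integral do rewrite EFinM.
rewrite ge0_integralZl//; last 2 first.
- apply/measurable_EFinP; apply: measurable_funTS; exact: measurable_inversion_jacobian.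
- by move=> y _; rewrite lee_fin inversion_jacobian_ge0.
rewrite muleA -EFinM; congr (_%:E * _)%E.
by rewrite /= mul2n -addnn exprD mulrA -exprMn divff ?gt_eqF// expr1n mul1r.
Qed.

(** Inversion exchanges the open and the closed end of a sector: this is why null
  spheres enter the comparison below. *)
Lemma inversion_sector a b B (y : V) : 0 < a -> sector a b B (inv y) <->
  (lam ^+ 2 / b <= enorm y < lam ^+ 2 / a /\ B ((enorm y)^-1 *: (y : 'rV[R]_n)))
  /\ 0 < b.
Proof.
move=> a0; split.
  move=> [/andP[ay yb] By].
  have y0 : (y : 'rV[R]_n) != 0.
    apply/eqP => y0; move: ay; rewrite /inv y0 /inversion scaler0 enorm0; lra.
  have b0 : 0 < b by lra.
  move: ay yb By; rewrite /inv direction_inversion// enorm_inversion//.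
  move: y0; rewrite -enorm_gt0 => y0.
  rewrite ltr_pdivlMr// ler_pdivrMr// => ay yb By.
  by rewrite ltr_pdivlMr// ler_pdivrMr// [_ * b]mulrC yb [_ * a]mulrC ay.
move=> [[/andP[h1 h2] By] b0].
have y0 : 0 < enorm y by apply: lt_le_trans h1; rewrite divr_gt0// exprn_gt0.
rewrite /sector /= /inv direction_inversion -?enorm_gt0// enorm_inversion -?enorm_gt0//.
move: h1 h2; rewrite ltr_pdivlMr// ler_pdivrMr// => h1 h2.
by rewrite ltr_pdivlMr// ler_pdivrMr// [b * _]mulrC h1 [a * _]mulrC h2.
Qed.

Lemma inverted_finite_on_sectors : finite_on_sectors inverted_lebesgue.
Proof.
move=> a b B a0 mB; rewrite inverted_lebesgueE.
have mE : measurable (inv @^-1` sector a b B).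
  by apply: measurable_preimage => //; exact: measurable_sector.
have [b0|b0] := leP b 0.
  rewrite (_ : _ @^-1` _ = set0) ?integral_set0 ?ltry//.
  rewrite -subset0 => y /= /(inversion_sector _ _ _ a0) [_]; lra.
pose K := (b / lam) ^+ (2 * n).
have K0 : 0 <= K by rewrite exprn_ge0// divr_ge0 ?ltW.
apply: (@le_lt_trans _ _ (K%:E * mu (sector (lam ^+ 2 / b / 2) (lam ^+ 2 / a) B))%E).
  apply: (@le_trans _ _ (K%:E * mu (inv @^-1` sector a b B))%E).
    apply: integral_le_cst => //.
  - exact: measurable_inversion_jacobian.
  - by move=> y _; exact: inversion_jacobian_ge0.
  - move=> y /(inversion_sector _ _ _ a0) [[/andP[h1 _] _] _].
    rewrite lerXn2r ?nnegrE ?divr_ge0 ?enorm_ge0 ?(ltW b0) ?(ltW lam0)//.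
    have y0 : 0 < enorm y by apply: lt_le_trans h1; rewrite divr_gt0// exprn_gt0.
    rewrite ler_pdivrMr// mulrAC ler_pdivlMr// -expr2.
    by move: h1; rewrite ler_pdivrMr// mulrC.
  - apply: lee_wpmul2l; first by rewrite lee_fin.
    apply: le_measure; rewrite ?inE//; first exact: measurable_sector.
    move=> y /(inversion_sector _ _ _ a0) [[/andP[h1 h2] By] _]; split => //.
    rewrite (ltW h2) andbT; apply: lt_le_trans h1.
    have : 0 < lam ^+ 2 / b by rewrite divr_gt0// exprn_gt0.
    lra.
rewrite lte_mul_pinfty//; apply: finite_on_sectors_lebesgue => //.
by rewrite !divr_gt0// exprn_gt0.
Qed.

(** The spheres are null, so that inversion maps the shell between [lam] and
  [lam * q] to the shell between [lam / q] and [lam], where the Jacobian lies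
  between [1] and [q ^+ (2 * n)]. *)
Lemma inverted_thin_sector q B : 1 < q -> measurable B ->
  (mu (sector (lam / q) lam B) <= inverted_lebesgue (sector lam (lam * q) B))%E /\
  (inverted_lebesgue (sector lam (lam * q) B) <=
    (q ^+ (2 * n))%:E * mu (sector (lam / q) lam B))%E.
Proof.
move=> q1 mB; have q0 : 0 < q by lra.
have lq0 : 0 < lam / q by rewrite divr_gt0.
pose E := inv @^-1` sector lam (lam * q) B.
have mE : measurable E.
  by apply: measurable_preimage => //; exact: measurable_sector.
have EE y : E y <->
    lam / q <= enorm y < lam /\ B ((enorm y)^-1 *: (y : 'rV[R]_n)).
  rewrite /E /= inversion_sector//.
  rewrite (_ : lam ^+ 2 / (lam * q) = lam / q); last by field; rewrite !gt_eqF.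
  rewrite (_ : lam ^+ 2 / lam = lam); last by field; rewrite gt_eqF.
  by split => [[]//|h]; split => //; rewrite mulr_gt0.
have muE : mu E = mu (sector (lam / q) lam B).
  apply/eqP; rewrite eq_le; apply/andP; split.
    apply: le_measure_null (lebesgue_sphere n0 lq0) _ => //.
    - exact: measurable_sector.
    - exact: measurable_sphere.
    - move=> y /EE [/andP[]]; rewrite le_eqVlt => /orP[/eqP h _ _|h1 h2 By].
        by right.
      by left; split => //; rewrite h1 ltW.
  apply: le_measure_null (lebesgue_sphere n0 lam0) _ => //.
  - exact: measurable_sector.
  - exact: measurable_sphere.
  - move=> y [/andP[h1]]; rewrite le_eqVlt => /orP[/eqP h _|h2 By].
      by right.
    by left; apply/EE; rewrite h2 ltW.
rewrite inverted_lebesgueE -/E -muE; split.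
  rewrite -[X in (X <= _)%E]mul1e; apply: integral_ge_cst => //.
  - exact: measurable_inversion_jacobian.
  - move=> y /EE [/andP[h1 h2] _]; rewrite exprn_ege1//.
    have y0 : 0 < enorm y by lra.
    by rewrite ler_pdivlMr// mul1r ltW.
apply: integral_le_cst => //.
- exact: measurable_inversion_jacobian.
- by move=> y _; exact: inversion_jacobian_ge0.
- by rewrite exprn_ge0// ltW.
- move=> y /EE [/andP[h1 h2] _]; rewrite lerXn2r ?nnegrE ?divr_ge0 ?enorm_ge0 ?(ltW q0) ?(ltW lam0)//.
  have y0 : 0 < enorm y by lra.
  by rewrite ler_pdivrMr// mulrC -ler_pdivrMr.
Qed.

(** Two homogeneous measures that agree on thin sectors up to a factor tending
  to [1] agree on all sectors. *)
Lemma inverted_lebesgue_sector a b B : 0 < a -> a < b -> measurable B ->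
  inverted_lebesgue (sector a b B) = mu (sector a b B).
Proof.
move=> a0 ab mB.
have hI := inverted_homogeneous; have fI := inverted_finite_on_sectors.
have hM := @homogeneous_lebesgue R n; have fM := @finite_on_sectors_lebesgue R n.
rewrite (measure_sector hI fI mB _ a0) (measure_sector hM fM mB _ a0).
congr (_ * _)%:E.
have ba : 1 < b / a by rewrite ltr_pdivlMr// mul1r.
have thin q C : 1 < q -> measurable C ->
    sector_mass mu C q <= q ^+ n * sector_mass inverted_lebesgue C q /\
    sector_mass inverted_lebesgue C q <= q ^+ n * sector_mass mu C q.
  move=> q1 mC; have q0 : 0 < q by lra.
  have [] := inverted_thin_sector q1 mC.
  rewrite (measure_sector hI fI mC _ lam0).
  rewrite (measure_sector hM fM mC _ (divr_gt0 lam0 q0)).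
  rewrite (_ : lam * q / lam = q); last by field; rewrite gt_eqF.
  rewrite (_ : lam / (lam / q) = q); last by field; rewrite !gt_eqF.
  rewrite -EFinM !lee_fin expr_div_n.
  have ln0 : 0 < lam ^+ n by rewrite exprn_gt0.
  have qn0 : 0 < q ^+ n by rewrite exprn_gt0.
  rewrite -[X in X <= _]mulrA ler_pM2l// mulrC ler_pdivrMr// [_ * q ^+ n]mulrC.
  move=> h1 h2; split => //; rewrite -(ler_pM2l ln0) (le_trans h2)//.
  rewrite mul2n -addnn exprD le_eqVlt; apply/orP; left; apply/eqP.
  by field; rewrite gt_eqF.
apply/eqP; rewrite eq_le; apply/andP; split.
- apply: (comparable_homogeneous (m := n) hI fI hM fM) => // q C q1 mC.
  by have [] := thin q C q1 mC.
- apply: (comparable_homogeneous (m := n) hM fM hI fI) => // q C q1 mC.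
  by have [] := thin q C q1 mC.
Qed.

Lemma lebesgue_inversion A : measurable A -> inverted_lebesgue A = mu A.
Proof.
move=> mA.
have m0 : measurable [set (0 : 'rV[R]_n) : V].
  by rewrite -[X in measurable X]setCK; apply: measurableC; exact: measurable_punctured.
have split0 (M : {measure set V -> \bar R}) : M [set (0 : 'rV[R]_n)] = 0%E ->
    M A = M (A `&` punctured).
  move=> M0; apply/eqP; rewrite eq_le; apply/andP; split.
    apply: le_measure_null M0 _ => //.
      by apply: measurableI => //; exact: measurable_punctured.
    by move=> y Ay; have [->|/eqP y0] := eqVneq y 0; [right|left].
  apply: le_measure; rewrite ?inE//.
    by apply: measurableI => //; exact: measurable_punctured.
rewrite split0; last first.
  rewrite inverted_lebesgueE (_ : _ @^-1` _ = [set (0 : 'rV[R]_n)]).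
    apply: le_anti; rewrite integral_ge0 ?andbT; last first.
      by move=> y _; rewrite lee_fin inversion_jacobian_ge0.
    rewrite -[leRHS](mul0e (mu [set (0 : 'rV[R]_n)])).
    apply: integral_le_cst => //.
    - exact: measurable_inversion_jacobian.
    - by move=> y _; exact: inversion_jacobian_ge0.
    - move=> y ->; rewrite /inversion_jacobian enorm0 invr0 mulr0 expr0n muln_eq0/=.
      by rewrite -[n == 0%N]negbK -lt0n n0.
  apply/seteqP; split => y /=; last by move=> ->; rewrite /inv /inversion scaler0.
  move=> h; apply/eqP; rewrite -[_ == _]negbK; apply/negP => y0.
  by have /eqP := inversion_neq0 lam0 y0; apply.
rewrite [in RHS]split0; last exact: lebesgue_point.
apply: measure_eq_on_sectors => //.
- exact: inverted_finite_on_sectors.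
- exact: inverted_lebesgue_sector.
Qed.

(** No derivative is computed: the two measures are compared only next to the fixed
  sphere, where the Jacobian is close to [1], and homogeneity does the rest. *)
Lemma integral_inversion (f : V -> \bar R) :
  measurable_fun setT f -> (forall x, 0 <= f x)%E ->
  (\int[mu]_x f x = \int[mu]_y ((inversion_jacobian y)%:E * f (inversion lam y)))%E.
Proof.
move=> mf f0; rewrite (@eq_measure_integral _ _ _ _ inverted_lebesgue); last first.
  by move=> A mA _; apply/esym/lebesgue_inversion.
rewrite /inverted_lebesgue /image_measure ge0_integral_pushforward//.
rewrite preimage_setT integral_density//.
  by apply: measurableT_comp => //.
by move=> y; exact: f0.
Qed.

End inversion_change_of_variables.

(** * Integrals of negative powers of a weight *)

Section dyadic_bound.
Context d (T : measurableType d) (R : realType) (mu : {measure set T -> \bar R}).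
Variables (w : T -> R) (E : set T) (K a s : R).
Hypotheses (mE : measurable E) (mw : measurable_fun setT w).
Hypothesis w0 : forall x, 0 <= w x.
Hypotheses (K0 : 0 <= K) (s0 : 0 < s) (sa : s < a).
Hypothesis growth : forall rho, 0 < rho ->
  (mu (E `&` [set x | (w x <= rho)%R]) <= (K * rho `^ a)%:E)%E.

Definition dyadic_cst : R := 2 `^ s / (1 - 2^-1 `^ (a - s)).

Let q : R := 2^-1 `^ (a - s).

Let q0 : 0 < q. Proof. by rewrite powR_gt0// invr_gt0. Qed.

Let q1 : q < 1.
Proof.
rewrite /q [ltRHS](_ : _ = 1 `^ (a - s)); last by rewrite powR1.
rewrite gt0_ltr_powR ?subr_gt0 ?nnegrE ?invr_ge0//.
by rewrite invf_lt1// ltr1n.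
Qed.

Lemma dyadic_cst_ge0 : 0 <= dyadic_cst.
Proof. by rewrite divr_ge0 ?powR_ge0// subr_ge0 ltW. Qed.

Let mw_le rho : measurable (E `&` [set x | w x <= rho]).
Proof.
apply: measurableI => //.
rewrite (_ : [set _ | _] = w @^-1` `]-oo, rho]); last first.
  by apply/seteqP; split => x; rewrite /= in_itv.
exact: measurable_preimage.
Qed.

Let powRX (x y : R) k : 0 < x -> (x ^+ k) `^ y = (x `^ y) ^+ k.
Proof.
move=> x0; rewrite -powR_mulrn ?ltW// -powRrM mulrC powRrM powR_mulrn//.
exact: powR_ge0.
Qed.

Lemma dyadic_scale (rho x : R) : 0 < x -> x <= rho ->
  exists k, rho * 2^-1 ^+ k.+1 < x <= rho * 2^-1 ^+ k.
Proof.
move=> x0 xr; have r0 : 0 < rho by lra.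
have : exists k, rho * 2^-1 ^+ k < x.
  have : rho * 2^-1 ^+ k @[k --> \oo] --> (0 : R).
    by apply: (@cvg_geometric R rho 2^-1); rewrite ger0_norm ?invf_lt1 ?ltr1n.
  move=> /cvgr_lt /(_ _ x0) [k _ /(_ k (leqnn k))]; by exists k.
move=> /ex_minnP[[|k] hk hmin]; first by move: hk; rewrite expr0; lra.
exists k; rewrite hk/= leNgt; apply/negP => h.
by have := hmin k h; rewrite ltnn.
Qed.

(** On the layer where [w] is of size [rho / 2 ^+ k], the integrand is of size
  [(rho / 2 ^+ k) `^ (- s)] and the layer has measure at most
  [K * (rho / 2 ^+ k) `^ a]; since [s < a] the contributions form a convergent
  geometric series. *)
Lemma dyadic_integral rho : 0 < rho ->
  (\int[mu]_(x in E `&` [set x | (w x <= rho)%R]) (w x `^ (- s))%:E <=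
    (dyadic_cst * K * rho `^ (a - s))%:E)%E.
Proof.
move=> r0.
pose rk k := rho * 2^-1 ^+ k.
have rk0 k : 0 < rk k by rewrite mulr_gt0// exprn_gt0.
pose F k := E `&` [set x | w x <= rk k].
pose c k := rk k.+1 `^ (- s).
have cmF k : measurable_fun setT (fun x => (c k * \1_(F k) x)%:E).
  apply/measurable_EFinP; apply: measurable_funM => //.
  by apply: measurable_indic; exact: mw_le.
have cF0 k x : (0 <= (c k * \1_(F k) x)%:E)%E.
  by rewrite lee_fin mulr_ge0 ?powR_ge0.
apply: (@le_trans _ _
  (\int[mu]_(x in E `&` [set x | (w x <= rho)%R])
     (\sum_(k <oo) (c k * \1_(F k) x)%:E))%E).
  apply: ge0_le_integral => //.
  - by move=> x _; rewrite lee_fin powR_ge0.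
  - apply/measurable_EFinP; apply: measurable_funTS.
    exact: (measurableT_comp (measurable_powR _) mw).
  - apply: measurable_funTS; apply: ge0_emeasurable_sum => //.
  - move=> x [Ex wx]; have [w00|wpos] := leP (w x) 0.
      have -> : w x = 0 by apply: le_anti; rewrite w00 w0.
      by rewrite powR0 ?oppr_eq0 ?gt_eqF// nneseries_ge0.
    have [k /andP[h1 h2]] := dyadic_scale wpos wx.
    apply: le_trans (nneseries_lim_ge k.+1 _) => //.
    rewrite big_nat_recr//= -[leLHS]add0e; apply: leeD.
      by apply: sume_ge0 => i _.
    rewrite lee_fin indicE mem_set// mulr1 /c !powRN lef_pV2 ?posrE ?powR_gt0//.
    by rewrite ge0_ler_powR ?nnegrE ?(ltW h1) ?ltW.
rewrite integral_nneseries//; last by move=> k; exact: measurable_funTS.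
apply: (@le_trans _ _
  (\sum_(k <oo) (geometric (2 `^ s * K * rho `^ (a - s)) q k)%:E)%E).
  apply: lee_nneseries => [k _ _|k _]; first exact: integral_ge0.
  apply: (@le_trans _ _ ((c k)%:E * mu (F k))%E).
    under eq_integral do rewrite EFinM.
    rewrite ge0_integralZl//; last 2 first.
    - by apply/measurable_EFinP; apply: measurable_indic; exact: mw_le.
    - by rewrite lee_fin powR_ge0.
    apply: lee_wpmul2l; first by rewrite lee_fin powR_ge0.
    rewrite integral_indic; [|exact: mw_le..].
    apply: (@le_measure _ _ _ mu); rewrite ?inE; [|exact: mw_le|by move=> x []].
    by apply: measurableI; exact: mw_le.
  apply: le_trans (lee_wpmul2l _ (growth (rk0 k))) _.
    by rewrite lee_fin powR_ge0.
  rewrite -EFinM lee_fin le_eqVlt; apply/orP; left; apply/eqP.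
  have h0 : 0 < 2^-1 :> R by rewrite invr_gt0.
  have pD x : 0 < x -> x `^ (a - s) = x `^ a * x `^ (- s).
    by move=> x0; rewrite powRD// (gt_eqF x0) implybT.
  have h2s : 2 `^ s = 2^-1 `^ (- s) :> R.
    by rewrite -(@powR_inv1 _ 2)// -powRrM mulN1r opprK.
  rewrite /c /rk /q h2s !powRM ?exprn_ge0 ?(ltW r0)// !powRX// !pD//.
  by rewrite exprS /= exprMn; ring.
apply: lime_le => /=.
  by apply: is_cvg_nneseries => k _ _; rewrite lee_fin mulr_ge0 ?exprn_ge0 ?mulr_ge0 ?powR_ge0.
apply: nearW => N; rewrite sumEFin lee_fin.
have := @geometric_seriesE R (2 `^ s * K * rho `^ (a - s)) q.
rewrite lt_eqF// => /(_ isT) /(congr1 (fun f => f N)).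
rewrite /series /= => ->.
rewrite /dyadic_cst -/q ler_pdivrMr ?subr_gt0//.
rewrite (_ : _ * K * _ * (1 - q) = 2 `^ s * K * rho `^ (a - s)); last first.
  by field; rewrite subr_eq0 gt_eqF.
rewrite -mulrA ler_piMr// ?mulr_ge0 ?powR_ge0//.
by rewrite gerBl exprn_ge0// ltW.
Qed.

(** Splitting at the level [rho], below which [dyadic_integral] applies and above
  which the integrand is at most [rho `^ (- s)]. Choosing [rho] first, the
  integral is small as soon as the measure of [S] is small. *)
Lemma singular_integral S rho (m : R) : 0 < rho -> measurable S -> S `<=` E ->
  (mu S <= m%:E)%E ->
  (\int[mu]_(x in S) (w x `^ (- s))%:E <=
    (dyadic_cst * K * rho `^ (a - s) + rho `^ (- s) * m)%:E)%E.
Proof.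
move=> r0 mS SE Sm.
have mws : measurable_fun setT (fun x => w x `^ (- s)).
  exact: (measurableT_comp (measurable_powR _) mw).
pose L := E `&` [set x | w x <= rho].
have mL D : measurable_fun D (\1_L : T -> R).
  by apply: measurable_indic; exact: mw_le.
apply: (@le_trans _ _ (\int[mu]_(x in S) ((w x `^ (- s) * \1_L x)%:E +
    (rho `^ (- s))%:E))%E).
  apply: ge0_le_integral => //.
  - by move=> x _; rewrite lee_fin powR_ge0.
  - by apply/measurable_EFinP; exact: measurable_funTS.
  - apply: emeasurable_funD => //; apply/measurable_EFinP; apply: measurable_funTS.
    by apply: measurable_funM => //.
  - move=> x Sx; rewrite -EFinD lee_fin indicE.
    have [wr|wr] := leP (w x) rho.
      rewrite mem_set ?mulr1 ?lerDl ?powR_ge0//; split => //; exact: SE.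
    rewrite memNset ?mulr0 ?add0r; last by move=> [_ /=]; rewrite leNgt wr.
    rewrite !powRN lef_pV2 ?posrE ?powR_gt0//; last exact: lt_trans wr.
    by rewrite ge0_ler_powR ?nnegrE// ?ltW// ?(lt_trans r0).
rewrite ge0_integralD//; last 3 first.
- by move=> x _; rewrite lee_fin mulr_ge0 ?powR_ge0.
- by apply/measurable_EFinP; apply: measurable_funTS; apply: measurable_funM.
- by move=> x _; rewrite lee_fin powR_ge0.
rewrite integral_cst// EFinD; apply: leeD; last first.
  by rewrite EFinM lee_wpmul2l// lee_fin powR_ge0.
apply: le_trans (dyadic_integral r0); rewrite -/L.
rewrite [leRHS]integral_mkcond; apply: (@le_trans _ _
    (\int[mu]_x (w x `^ (- s) * \1_L x)%:E)%E).
  apply: ge0_subset_integral => //.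
  - by apply/measurable_EFinP; apply: measurable_funM.
  - by move=> x _; rewrite lee_fin mulr_ge0 ?powR_ge0.
rewrite le_eqVlt; apply/orP; left; apply/eqP; apply: eq_integral => x _.
by rewrite patchE indicE; case: ifPn => _; rewrite ?mulr1 ?mulr0.
Qed.

End dyadic_bound.

(** * Singular weights on thin shells *)

Section thin_shells.
Context {R : realType} {n : nat}.
Local Notation RB := (measurableTypeR R).
Local Notation V := 'rV[RB]_n.
Local Notation mu := (lebesgue_rV R n).
Hypothesis n0 : (0 < n)%N.

(** By homogeneity the measure is a multiple of [b ^+ n - a ^+ n]. *)
Lemma lebesgue_shell (Lam : R) : 0 < Lam -> exists2 k, 0 <= k &
  forall a b, 0 < a -> a <= b -> b <= Lam ->
  (mu (sector a b setT) <= (k * (b - a))%:E)%E.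
Proof.
move=> Lam0; have hM := @homogeneous_lebesgue R n.
have fM := @finite_on_sectors_lebesgue R n.
pose sm := sector_mass mu setT.
have k0 : 0 < 2 ^+ n - 1 :> R by rewrite subr_gt0 exprn_egt1 ?ltr1n// -lt0n.
pose c := sm 2 / (2 ^+ n - 1).
have c0 : 0 <= c by rewrite divr_ge0 ?fine_ge0// ltW.
exists (c * (n%:R * Lam ^+ n.-1)); first by rewrite mulr_ge0// mulr_ge0// exprn_ge0// ltW.
move=> a b a0 ab bL; rewrite (measure_sector hM fM)// lee_fin -/sm.
have smE q : 1 <= q -> sm q = (q ^+ n - 1) * c.
  move=> q1; rewrite /c mulrC mulrAC; apply: (canRL (mulfK _)).
    by rewrite gt_eqF.
  by apply: sector_mass_proportional => //; rewrite ler1n.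
rewrite smE; last by rewrite ler_pdivlMr// mul1r.
rewrite [leLHS](_ : _ = c * (b ^+ n - a ^+ n)); last first.
  by rewrite expr_div_n; field; rewrite expf_neq0// gt_eqF.
rewrite -[leRHS]mulrA ler_wpM2l// subrXX mulrC ler_wpM2r ?subr_ge0//.
apply: (@le_trans _ _ (\sum_(i < n) Lam ^+ n.-1)); last first.
  by rewrite sumr_const card_ord mulr_natl.
apply: ler_sum => i _; have b0 : 0 < b by lra.
have iE : n.-1 = (n.-1 - i + i)%N by rewrite subnK// -ltnS prednK.
rewrite [X in _ <= _ ^+ X]iE exprD ler_pM ?exprn_ge0 ?(ltW a0) ?(ltW b0)//.
  by rewrite lerXn2r ?nnegrE ?(ltW b0) ?(ltW Lam0).
by rewrite lerXn2r ?nnegrE ?(ltW a0) ?(ltW Lam0) ?(le_trans ab).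
Qed.

Lemma lebesgue_ball (x : 'rV[R]_n) rho : 0 < rho ->
  (mu (setT `&` [set y : V | (enorm (x - y) <= rho)%R]) <=
    (4 ^+ n * rho `^ n%:R)%:E)%E.
Proof.
move=> r0; rewrite setTI.
have mB : measurable [set y : V | enorm (x - y) <= rho].
  rewrite (_ : [set _ | _] =
      (fun y : V => enorm (x - y : 'rV[R]_n)) @^-1` `]-oo, rho]).
    apply: measurable_preimage => //.
    exact: (measurableT_comp measurable_enorm (measurable_sub_rV x)).
  by apply/seteqP; split => y; rewrite /= in_itv.
apply: (@le_trans _ _ (mu (cube x (2 * rho)))).
  apply: (@le_measure _ _ _ mu); rewrite ?inE//; first exact: measurable_cube.
  move=> y /= xy i; have := le_trans (coord_le_enorm (x - y) i) xy.
  by rewrite /= in_itv/= !mxE ler_norml => /andP[h1 h2]; apply/andP; split; lra.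
rewrite lebesgue_cube ?mulr_ge0 ?(ltW r0)// lee_fin powR_mulrn ?(ltW r0)//.
by rewrite -exprMn mulrA -natrM.
Qed.

Lemma powR_small (c C eta : R) : 0 < c -> 0 <= C -> 0 < eta ->
  exists2 rho, 0 < rho & C * rho `^ c <= eta.
Proof.
move=> c0 C0 eta0; have D0 : 0 < C + 1 by lra.
exists ((eta / (C + 1)) `^ c^-1); first by rewrite powR_gt0// divr_gt0.
rewrite -powRrM mulVf ?gt_eqF// powRr1 ?divr_ge0 ?(ltW eta0) ?(ltW D0)//.
by rewrite mulrA ler_pdivrMr// mulrC ler_pM2l// lerDl.
Qed.

(** The two singularities met in the integral equation: on the diagonal of the
  Green's function and on the boundary of the domain. *)
Definition singular_weight (r s1 s2 : R) (x y : 'rV[R]_n) : R :=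
  enorm (x - y) `^ (- s1) + `|enorm y - r| `^ (- s2).

Lemma measurable_singular_weight r s1 s2 x :
  measurable_fun setT (fun y : V => singular_weight r s1 s2 x y).
Proof.
apply: measurable_funD; apply: (measurableT_comp (measurable_powR _)).
  exact: (measurableT_comp measurable_enorm (measurable_sub_rV x)).
apply: measurableT_comp => //; apply: measurable_funB => //.
exact: measurable_enorm.
Qed.

Lemma singular_weight_ge0 r s1 s2 x y : 0 <= singular_weight r s1 s2 x y.
Proof. by rewrite addr_ge0 ?powR_ge0. Qed.

(** Balls grow like [rho ^+ n] and shells around the sphere of radius [r] like
  [rho], so that both singularities are integrable. The uniformity in [x] makes
  the integral operator of the narrow region principle a contraction. *)
Lemma integral_thin_shell (Lam r s1 s2 eta : R) :
  0 < r -> r < Lam -> 0 < s1 -> s1 < n%:R -> 0 < s2 -> s2 < 1 -> 0 < eta ->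
  exists2 delta, 0 < delta & forall x a b,
    r <= a -> a <= b -> b <= Lam -> b - a <= delta ->
    (\int[mu]_(y in sector a b setT) (singular_weight r s1 s2 x y)%:E
      <= eta%:E)%E.
Proof.
move=> r0 rL s10 s1n s20 s21 eta0; have Lam0 : 0 < Lam by lra.
have [k k0 hk] := lebesgue_shell Lam0.
have eta4 : 0 < eta / 4 by lra.
have c10 : 0 <= dyadic_cst n%:R s1 * 4 ^+ n.
  by rewrite mulr_ge0 ?exprn_ge0// dyadic_cst_ge0.
have c20 : 0 <= dyadic_cst 1 s2 * k by rewrite mulr_ge0// dyadic_cst_ge0.
have d10 : 0 < n%:R - s1 by rewrite subr_gt0.
have d20 : 0 < 1 - s2 by rewrite subr_gt0.
have [rho1 r10 h1] := powR_small d10 c10 eta4.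
have [rho2 r20 h2] := powR_small d20 c20 eta4.
pose D := (rho1 `^ (- s1) + rho2 `^ (- s2)) * k.
have D0 : 0 <= D by rewrite mulr_ge0// addr_ge0 ?powR_ge0.
(* [D + 1] instead of [D], which may vanish *)
exists (eta / 2 / (D + 1)); first by rewrite !divr_gt0//; lra.
move=> x a b ra ab bL bad; have a0 : 0 < a by lra.
have mS : measurable (sector a b [set: V]) by exact: measurable_sector.
have Sk := hk a b a0 ab bL.
have mw1 : measurable_fun setT (fun y : V => enorm (x - y : 'rV[R]_n)).
  exact: (measurableT_comp measurable_enorm (measurable_sub_rV x)).
have mw2 : measurable_fun setT (fun y : V => `|enorm (y : 'rV[R]_n) - r|).
  by apply: measurableT_comp => //; apply: measurable_funB => //; exact: measurable_enorm.
have mE : measurable (sector r Lam [set: V]) by exact: measurable_sector.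
have growth2 rho : 0 < rho ->
    (mu (sector r Lam setT `&` [set y : V | `|enorm (y : 'rV[R]_n) - r| <= rho]%R)
      <= (k * rho `^ 1)%:E)%E.
  move=> rho0; rewrite powRr1 ?(ltW rho0)//.
  have rm : r <= Num.min Lam (r + rho) by rewrite le_min; apply/andP; split; lra.
  apply: (@le_trans _ _ (mu (sector r (Num.min Lam (r + rho)) setT))).
    apply: (@le_measure _ _ _ mu); rewrite ?inE; [|exact: measurable_sector|].
      apply: measurableI => //.
      rewrite (_ : [set _ | _] = (fun y : V => `|enorm (y : 'rV[R]_n) - r|)
          @^-1` `]-oo, rho]); first exact: measurable_preimage.
      by apply/seteqP; split => y; rewrite /= in_itv.
    move=> y [[/andP[ry yL] _] /=]; rewrite ler_norml => /andP[_ yr]; split => //.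
    by rewrite ry le_min yL/=; lra.
  apply: le_trans (hk _ _ r0 rm _) _; first by rewrite ge_min lexx.
  rewrite lee_fin ler_wpM2l// lerBlDl ge_min lexx; exact: orbT.
have SE : sector a b [set: V] `<=` sector r Lam setT.
  by move=> y [/andP[ay yb] _]; split => //; rewrite (le_lt_trans ra ay) (le_trans yb).
have I1 := singular_integral measurableT mw1 (fun=> enorm_ge0 _) _ s10 s1n
  (lebesgue_ball x) r10 mS (@subsetT _ _) Sk.
have I2 := singular_integral mE mw2 (fun=> normr_ge0 _) k0 s20 s21
  growth2 r20 mS SE Sk.
under eq_integral do rewrite EFinD.
rewrite ge0_integralD//; last 3 first.
- by move=> y _; rewrite lee_fin powR_ge0.
- apply/measurable_EFinP; apply: measurable_funTS.
  exact: (measurableT_comp (measurable_powR _) mw1).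
- apply/measurable_EFinP; apply: measurable_funTS.
  exact: (measurableT_comp (measurable_powR _) mw2).
apply: le_trans (leeD (I1 _) I2) _; first by rewrite exprn_ge0.
rewrite -EFinD lee_fin.
have hD : D * (b - a) <= eta / 2.
  apply: (@le_trans _ _ (D * (eta / 2 / (D + 1)))); first by rewrite ler_wpM2l.
  by rewrite mulrA ler_pdivrMr; nra.
move: hD h1 h2; rewrite /D; clear.
move: (rho1 `^ _) (rho1 `^ _) (rho2 `^ _) (rho2 `^ _) (dyadic_cst _ _ * _) => p p' q q' c.
move: (dyadic_cst _ _ * _) (b - a) => c' w; lra.
Qed.

End thin_shells.

(** * The kernel of the Green's function *)

Section kernel.
Context {R : realType}.
Local Notation RB := (measurableTypeR R).
Local Notation lam := (@lebesgue_measure R).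
Variables (n : nat) (alpha : R).
Hypotheses (n2 : (2 <= n)%N) (al0 : 0 < alpha) (al2 : alpha <= 2).

(** The integrand of the Green's function after the substitution [c = q * b]. The
  squared distance [q] leaves the bounds of integration for the integrand, which
  makes the monotonicity in [q] of all increments visible. *)
Definition psi (q c : R) : R := c `^ (alpha / 2 - 1) * (q + c) `^ (- (n%:R / 2)).

Lemma psi_ge0 q c : 0 <= psi q c.
Proof. by rewrite mulr_ge0 ?powR_ge0. Qed.

Lemma measurable_psi q D : measurable_fun D (psi q : RB -> R).
Proof.
apply: measurable_funTS; apply: measurable_funM.
  exact: measurable_powR.
apply: (measurableT_comp (measurable_powR _)); exact: measurable_funD.
Qed.

Lemma psi_nonincreasing q Q c : 0 < q -> q <= Q -> 0 < c -> psi Q c <= psi q c.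
Proof.
move=> q0 qQ c0; rewrite ler_wpM2l ?powR_ge0// !powRN.
rewrite lef_pV2 ?posrE ?powR_gt0 ?addr_gt0//; last exact: lt_le_trans qQ.
by rewrite ge0_ler_powR ?nnegrE ?divr_ge0 ?lerD2r// addr_ge0 ?ltW// (lt_le_trans q0).
Qed.

Lemma psi_scale k q c : 0 < k -> 0 < q -> 0 < c ->
  psi (k * q) (k * c) = k `^ (- ((n%:R - alpha) / 2) - 1) * psi q c.
Proof.
move=> k0 q0 c0; rewrite /psi -mulrDr !powRM ?ltW ?addr_gt0//.
rewrite (_ : - ((n%:R - alpha) / 2) - 1 = (alpha / 2 - 1) + - (n%:R / 2)); last lra.
by rewrite (@powRD _ k (alpha / 2 - 1)) ?(gt_eqF k0) ?implybT//; ring.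
Qed.

Definition ekern (q t : R) : \bar R := (\int[lam]_(c in `]0%R, t[) (psi q c)%:E)%E.

(** The factor [(1 + c) `^ (- (n%:R / 2))] is at most [c `^ (- gam)], since
  [gam < n%:R / 2]. *)
Lemma ekern_le (gam : R) : 0 < gam -> gam < alpha / 2 ->
  exists2 C : R, 0 <= C & forall t : R, 0 <= t ->
    (ekern 1 t <= (C * t `^ (alpha / 2 - gam))%:E)%E.
Proof.
have A0 := al0; have A2 := al2.
(* positive even when alpha = 2, as needed for the dyadic decomposition *)
move=> g0 ga; pose s : R := 1 - alpha / 2 + gam.
have s0 : 0 < s by rewrite /s; lra.
have s1 : s < 1 by rewrite /s; lra.
exists (dyadic_cst 1 s); first exact: dyadic_cst_ge0.
move=> t; rewrite le_eqVlt => /orP[/eqP <-|t0].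
  by rewrite /ekern set_itvoo0 integral_set0 lee_fin mulr_ge0 ?powR_ge0 ?dyadic_cst_ge0.
have growth (rho : R) : 0 < rho ->
    (lam (`]0%R, +oo[%classic `&` [set x : RB | (`|(x : R)| <= rho)%R]) <= (1 * rho `^ 1)%:E)%E.
  move=> r0; rewrite mul1r powRr1 ?(ltW r0)//.
  apply: (@le_trans _ _ (lam `[0, rho]%classic)); last first.
    by rewrite lebesgue_measure_itv/= lte_fin r0 oppr0 adde0.
  apply: (@le_measure _ _ _ lam); rewrite ?inE//.
    apply: measurableI => //.
    rewrite (_ : [set _ | _] = `[- rho, rho]%classic) //.
    by apply/seteqP; split => x; rewrite /= in_itv/= ler_norml.
  by move=> x [/=]; rewrite !in_itv/= andbT ler_norml => /ltW -> /andP[_ ->].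
have mabs : measurable_fun setT (fun x : RB => `|(x : R)|).
  exact: measurableT_comp.
have mpos : measurable (`]0, +oo[%classic : set RB) by exact: measurable_itv.
have := dyadic_integral mpos mabs (fun=> normr_ge0 _) ler01 s0 s1 growth t0.
rewrite mulr1 (_ : 1 - s = alpha / 2 - gam); last by rewrite /s; lra.
apply: le_trans.
rewrite /ekern; apply: (@le_trans _ _ (\int[lam]_(x in `]0%R, t[) (`|x| `^ (- s))%:E)%E).
  apply: ge0_le_integral => //.
  - by move=> x _; rewrite lee_fin psi_ge0.
  - by apply/measurable_EFinP; exact: measurable_psi.
  - apply/measurable_EFinP; apply: measurable_funTS.
    apply: (measurableT_comp (measurable_powR _)); exact: measurableT_comp.
  - move=> x; rewrite /= in_itv/= => /andP[x0 xt]; rewrite lee_fin gtr0_norm// /psi.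
    rewrite (_ : - s = (alpha / 2 - 1) + - gam); last by rewrite /s; lra.
    rewrite (@powRD _ x (alpha / 2 - 1)) ?(gt_eqF x0) ?implybT// ler_wpM2l ?powR_ge0//.
    rewrite !powRN lef_pV2 ?posrE ?powR_gt0//; last lra.
    apply: (@le_trans _ _ ((1 + x) `^ gam)).
      by rewrite ge0_ler_powR ?nnegrE//; lra.
    apply: ler_powR; first lra.
    have : 2 <= n%:R :> R by rewrite ler_nat.
    lra.
apply: ge0_subset_integral => //.
- apply: measurableI => //.
  rewrite (_ : [set _ | _] = `[- t, t]%classic) //.
  by apply/seteqP; split => x; rewrite /= in_itv/= ler_norml.
- apply/measurable_EFinP; apply: measurable_funTS.
  apply: (measurableT_comp (measurable_powR _)); exact: measurableT_comp.
- move=> x; rewrite /= !in_itv/= andbT => /andP[x0 xt]; split => //.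
  by rewrite gtr0_norm// ltW.
Qed.

Lemma ekern_fin1 t : ekern 1 t \is a fin_num.
Proof.
rewrite ge0_fin_numE; last by apply: integral_ge0 => x _; rewrite lee_fin psi_ge0.
have [t0|t0] := leP t 0.
  by rewrite /ekern set_itv_ge ?integral_set0 ?ltry// bnd_simp -leNgt.
have [||C _ /(_ t (ltW t0))] := @ekern_le (alpha / 4); [have := al0; lra..|].
by move=> /le_lt_trans; apply; rewrite ltry.
Qed.

Lemma ekern_scale k q t : 0 < k -> 0 < q ->
  ekern (k * q) (k * t) = ((k `^ (- ((n%:R - alpha) / 2)))%:E * ekern q t)%E.
Proof.
move=> k0 q0; pose sc := fun x : RB => k * x : RB.
have msc : measurable_fun setT sc by exact: measurable_funM.
rewrite /ekern; transitivity
   (\int[mscale (NngNum (ltW k0)) (image_measure lam msc)]_(c in `]0%R, (k * t)%R[)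
      (psi (k * q)%R c)%:E)%E.
  apply: eq_measure_integral => A mA _; rewrite /= /mscale /image_measure /=.
  apply: etrans (esym (mule_invl (lam A) k0)) _; congr (_ * _)%E.
  by apply/esym; exact: lebesgue_measure_scale.
rewrite ge0_integral_mscale//; last 2 first.
- by apply/measurable_EFinP; exact: measurable_psi.
- by move=> x _; rewrite lee_fin psi_ge0.
have mkt : measurable (`]0, k * t[%classic : set RB) by exact: measurable_itv.
have mpkq : measurable_fun `]0, k * t[%classic (fun x : RB => (psi (k * q) x)%:E).
  by apply/measurable_EFinP; exact: measurable_psi.
have ppkq : {in `]0, k * t[%classic, forall x : RB, (0 <= (psi (k * q) x)%:E)%E}.
  by move=> x _; rewrite lee_fin psi_ge0.
apply: etrans (congr1 (mule k%:E) (ge0_integral_pushforward msc lam mkt mpkq ppkq)) _.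
rewrite (_ : sc @^-1` _ = `]0, t[%classic); last first.
  by apply/seteqP; split => x; rewrite /= !in_itv/= /sc pmulr_rgt0// ltr_pM2l.
have mq : measurable_fun `]0, t[%classic (fun x : RB => (psi q x)%:E).
  by apply/measurable_EFinP; exact: measurable_psi.
have mkq : measurable_fun `]0, t[%classic (fun x : RB => (psi (k * q) (sc x))%:E).
  apply/measurable_EFinP; apply: measurable_funTS.
  by apply: measurableT_comp msc; exact: measurable_psi.
have p0 x : (0 <= (psi q x)%:E)%E by rewrite lee_fin psi_ge0.
have pk0 x : (0 <= (psi (k * q) (sc x))%:E)%E by rewrite lee_fin psi_ge0.
have c0 : (0 <= (k `^ (- ((n%:R - alpha) / 2)))%:E)%E by rewrite lee_fin powR_ge0.
have k0' : (0 <= k%:E)%E by rewrite lee_fin ltW.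
have mI : measurable (`]0, t[%classic : set RB) by exact: measurable_itv.
rewrite -(ge0_integralZl lam mI mq (fun x _ => p0 x) c0).
apply: etrans (esym (ge0_integralZl lam mI mkq (fun x _ => pk0 x) k0')) _.
apply: eq_integral => x; rewrite inE/= in_itv/= => /andP[x0 xt].
rewrite /sc psi_scale// -!EFinM mulrA; congr (_ * _)%:E.
rewrite -[X in X * _](powRr1 (ltW k0)) -powRD ?(gt_eqF k0) ?implybT//.
by congr (_ `^ _); lra.
Qed.

Lemma ekern_ge0 q t : (0 <= ekern q t)%E.
Proof. by apply: integral_ge0 => x _; rewrite lee_fin psi_ge0. Qed.

Lemma ekern_fin q t : 0 < q -> ekern q t \is a fin_num.
Proof.
move=> q0; have -> : q = q * 1 by rewrite mulr1.
rewrite (_ : t = q * (t / q)); last by field; rewrite gt_eqF.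
by rewrite ekern_scale// fin_numM// ekern_fin1.
Qed.

Definition ekern_inc q s t : \bar R :=
  (\int[lam]_(c in `]0%R, t[ `\` `]0%R, s[) (psi q c)%:E)%E.

Lemma measurable_inc (s t : R) : measurable (`]0, t[%classic `\` `]0, s[%classic : set RB).
Proof. by apply: measurableD; exact: measurable_itv. Qed.

Lemma ekern_incE q s t : s <= t -> ekern q t = (ekern q s + ekern_inc q s t)%E.
Proof.
move=> st; rewrite /ekern /ekern_inc -ge0_integral_setU//.
- congr (integral _ _ _); rewrite setDUK// => x; rewrite /= !in_itv/=.
  by move=> /andP[-> xs]; rewrite (lt_le_trans xs).
- exact: measurable_inc.
- by apply/measurable_EFinP; exact: measurable_psi.
- by move=> x _; rewrite lee_fin psi_ge0.
- by apply/disj_setPS => x [/= xs []].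
Qed.

Lemma ekern_inc_ge0 q s t : (0 <= ekern_inc q s t)%E.
Proof. by apply: integral_ge0 => x _; rewrite lee_fin psi_ge0. Qed.

Lemma ekern_inc_nonincreasing q Q s t : 0 < q -> q <= Q ->
  (ekern_inc Q s t <= ekern_inc q s t)%E.
Proof.
move=> q0 qQ; apply: ge0_le_integral => //.
- exact: measurable_inc.
- by move=> x _; rewrite lee_fin psi_ge0.
- by apply/measurable_EFinP; exact: measurable_psi.
- by apply/measurable_EFinP; exact: measurable_psi.
- move=> x [/=]; rewrite in_itv/= => /andP[x0 _] _.
  by rewrite lee_fin psi_nonincreasing.
Qed.

Lemma ekern_inc_gt0 q s t : 0 < q -> 0 <= s -> s < t -> (0 < ekern_inc q s t)%E.
Proof.
have A2 := al2.
move=> q0 s0 st; have t0 : 0 < t by lra.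
pose m := t `^ (alpha / 2 - 1) * (q + t) `^ (- (n%:R / 2)).
have m0 : 0 < m by rewrite mulr_gt0 ?powR_gt0// addr_gt0.
have mst : measurable (`]s, t[%classic : set RB) by exact: measurable_itv.
apply: (@lt_le_trans _ _ (m%:E * lam `]s, t[%classic)%E).
  by rewrite lebesgue_measure_itv/= lte_fin st -EFinB -EFinM lte_fin mulr_gt0// subr_gt0.
apply: (@le_trans _ _ (\int[lam]_(c in `]s, t[) (psi q c)%:E)%E).
  apply: integral_ge_cst => //; first exact: measurable_psi.
    exact: ltW.
  move=> x /=; rewrite in_itv/= => /andP[sx xt]; have x0 : 0 < x by lra.
  rewrite ler_pM ?powR_ge0//.
    rewrite (_ : alpha / 2 - 1 = - (1 - alpha / 2)); last lra.
    rewrite !powRN lef_pV2 ?posrE ?powR_gt0//.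
    by rewrite ge0_ler_powR ?nnegrE; lra.
  rewrite !powRN lef_pV2 ?posrE ?powR_gt0 ?addr_gt0//.
  by rewrite ge0_ler_powR ?nnegrE ?divr_ge0//; lra.
apply: ge0_subset_integral => //.
- exact: measurable_inc.
- by apply/measurable_EFinP; exact: measurable_psi.
- by move=> x _; rewrite lee_fin psi_ge0.
- move=> x /=; rewrite !in_itv/= => /andP[sx xt]; split.
    by rewrite xt (le_lt_trans s0).
  by move=> /andP[_ xs]; move: sx; rewrite ltNge (ltW xs).
Qed.

(** Up to its constant, the Green's function of the exterior of a ball in terms
  of the squared distance [q] and of the normalized product [t] of the defects of
  the two points. *)
Definition kern (q t : R) : R :=
  q `^ (- ((n%:R - alpha) / 2)) * fine (ekern 1 (t / q)).

Lemma kernE q t : 0 < q -> (kern q t)%:E = ekern q t.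
Proof.
move=> q0; apply: etrans (EFinM _ _) _; rewrite (fineK (ekern_fin1 _)).
apply: etrans (esym (ekern_scale _ q0 ltr01)) _; rewrite mulr1.
by congr ekern; field; rewrite gt_eqF.
Qed.

Lemma kern_ge0 q t : 0 <= kern q t.
Proof. by rewrite mulr_ge0 ?powR_ge0// fine_ge0// ekern_ge0. Qed.

Lemma kern0 t : kern 0 t = 0.
Proof.
by rewrite /kern invr0 mulr0 /ekern set_itvoo0 integral_set0/= mulr0.
Qed.

Lemma kern_t0 q : 0 < q -> kern q 0 = 0.
Proof.
by move=> q0; apply: EFin_inj; rewrite kernE// /ekern set_itvoo0 integral_set0.
Qed.

(** A power [gam] is moved from the defects to the squared distance; the exponent
  of the distance is then larger than [- n], hence integrable. *)
Lemma kern_le (gam : R) : 0 < gam -> gam < alpha / 2 ->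
  exists2 C : R, 0 <= C & forall q t : R, 0 <= q -> 0 <= t ->
    kern q t <= C * t `^ (alpha / 2 - gam) * q `^ (- (n%:R / 2 - gam)).
Proof.
move=> g0 ga; have [C C0 hC] := ekern_le g0 ga; exists C => // q t.
rewrite le_eqVlt => /orP[/eqP <-|q0] t0.
  by rewrite kern0 !mulr_ge0 ?powR_ge0.
have := hC (t / q) (divr_ge0 t0 (ltW q0)).
rewrite -[ekern _ _]fineK ?ekern_fin1// lee_fin => h.
rewrite /kern; apply: le_trans (ler_wpM2l (powR_ge0 _ _) h) _.
rewrite powRM ?invr_ge0 ?(ltW q0)// -(powR_inv1 (ltW q0)) -powRrM.
rewrite [X in _ <= _ * q `^ X](_ : _ =
  - ((n%:R - alpha) / 2) + -1 * (alpha / 2 - gam)); last lra.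
rewrite (@powRD _ q) ?(gt_eqF q0) ?implybT//.
by rewrite le_eqVlt; apply/orP; left; apply/eqP; ring.
Qed.

Lemma measurable_kern d (T : measurableType d) (q t : T -> R) :
  (forall x, 0 <= q x) -> measurable_fun setT q -> measurable_fun setT t ->
  measurable_fun setT (fun x => kern (q x) (t x)).
Proof.
move=> q0 mq mt; apply: measurable_funM.
  exact: (measurableT_comp (measurable_powR _) mq).
have mtq : measurable_fun setT (fun x => t x / q x).
  apply: measurable_funM => //; exact: measurable_invr_nneg.
have mE : measurable_fun setT (fun z : R => fine (ekern 1 z)).
  apply: nondecreasing_measurable => // z z' zz'; apply: fine_le.
  - exact: ekern_fin1.
  - exact: ekern_fin1.
  - by rewrite (ekern_incE _ zz') leeDl// ekern_inc_ge0.
exact: (measurableT_comp mE mtq).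
Qed.

(* keeps unification from unfolding the integrals *)
Opaque psi ekern ekern_inc kern.

(** The source of the conformal covariance of the Green's function: an inversion
  multiplies the squared distance and the product of the defects by one common
  factor. *)
Lemma kern_scale k q t : 0 < k -> 0 <= q ->
  kern (k * q) (k * t) = k `^ (- ((n%:R - alpha) / 2)) * kern q t.
Proof.
move=> k0; rewrite le_eqVlt => /orP[/eqP <-|q0].
  by rewrite mulr0 !kern0 mulr0.
by apply: EFin_inj; rewrite kernE ?mulr_gt0// ekern_scale// EFinM kernE.
Qed.

Lemma kern_nondecreasing q s t : 0 < q -> s <= t -> kern q s <= kern q t.
Proof.
move=> q0 st; rewrite -lee_fin !kernE// (ekern_incE _ st) leeDl//.
exact: ekern_inc_ge0.
Qed.

Lemma kern_increasing q s t : 0 < q -> 0 <= s -> s < t -> kern q s < kern q t.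
Proof.
move=> q0 s0 st; rewrite -lte_fin !kernE// (ekern_incE _ (ltW st)).
by rewrite lteDl ?ekern_fin// ekern_inc_gt0.
Qed.

Lemma ekern_inc_fin q s t : 0 < q -> s <= t -> ekern_inc q s t \is a fin_num.
Proof.
move=> q0 st; have := ekern_fin t q0; rewrite (ekern_incE q st).
by rewrite fin_numD => /andP[].
Qed.

Lemma kern_incE q s t : 0 < q -> s <= t ->
  kern q t = kern q s + fine (ekern_inc q s t).
Proof.
move=> q0 st; have := ekern_incE q st; rewrite -!(kernE _ q0) => E.
apply: EFin_inj; apply: etrans E _; apply: etrans _ (esym (EFinD _ _)).
by rewrite (fineK (ekern_inc_fin q0 st)); exact: erefl.
Qed.

(** The increment is an integral of [psi q], which is nonincreasing in [q]. *)
Lemma kern_increment q Q s t : 0 < q -> q <= Q -> s <= t ->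
  kern Q t - kern Q s <= kern q t - kern q s.
Proof.
move=> q0 qQ st; have Q0 : 0 < Q by lra.
have := fine_le (ekern_inc_fin Q0 st) (ekern_inc_fin q0 st)
  (ekern_inc_nonincreasing s t q0 qQ).
move: (kern_incE q0 st) (kern_incE Q0 st).
move: (kern q t) (kern Q t) (kern q s) (kern Q s) => a b c e.
move: (fine (ekern_inc q s t)) (fine (ekern_inc Q s t)) => f g -> ->.
lra.
Qed.

Lemma kern_nonincreasing q Q t : 0 < q -> q <= Q -> 0 <= t -> kern Q t <= kern q t.
Proof.
move=> q0 qQ t0; have := kern_increment q0 qQ t0.
by rewrite !kern_t0 ?subr0//; lra.
Qed.

Lemma kern_gt0 q t : 0 < q -> 0 < t -> 0 < kern q t.
Proof. by move=> q0 t0; rewrite -(kern_t0 q0) kern_increasing. Qed.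

End kernel.

(** * The Green's function under inversion *)

Section green_kernel.
Context {R : realType}.
Variables (n : nat) (alpha r : R).
Hypotheses (n2 : (2 <= n)%N) (al0 : 0 < alpha) (al2 : alpha <= 2) (r0 : 0 < r).
Implicit Types (x y : 'rV[R]_n) (lam : R).

Local Notation K := (kern n alpha).
Local Notation C := (green_cst n alpha).

(** Up to normalization, the factor by which the Green's function degenerates at
  the boundary of the domain. *)
Definition defect x : R := enorm x ^+ 2 - r ^+ 2.

Lemma greenE x y : Omega r x -> Omega r y ->
  green alpha r x y = C * K (enorm (x - y) ^+ 2) (defect x * defect y / r ^+ 2).
Proof.
move=> xO yO; rewrite /green xO yO /= /kern -mulrA; congr (_ * _).
have -> : (enorm (x - y) ^+ 2) `^ (- ((n%:R - alpha) / 2)) =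
    (enorm (x - y) `^ (n%:R - alpha))^-1.
  rewrite -powR_mulrn ?enorm_ge0// -powRrM -powRN; congr (_ `^ _); lra.
congr (_ * _); rewrite /ekern /Rintegral; congr fine.
rewrite (_ : _ / (r ^+ 2 * _) = defect x * defect y / r ^+ 2 / enorm (x - y) ^+ 2).
  by apply: eq_integral => b _; rewrite /psi powRN.
by rewrite /defect invfM mulrA.
Qed.

Lemma green_cst_ge0 : 0 <= C.
Proof.
have G0 s : 0 <= Gamma s.
  by apply: Rintegral_ge0 => x _; rewrite mulr_ge0 ?powR_ge0 ?expR_ge0.
apply: divr_ge0; first exact: G0.
apply: mulr_ge0; last exact: sqr_ge0.
by apply: mulr_ge0; exact: powR_ge0.
Qed.

Lemma defect_gt0 x : Omega r x -> 0 < defect x.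
Proof.
rewrite /Omega /defect /= => rx; rewrite subr_gt0.
by rewrite ltr_pXn2r ?nnegrE ?enorm_ge0 ?(ltW r0).
Qed.

(** The dual defect of [x] is the defect of its inversion, up to the factor by
  which inversion distorts distances at [x]. *)
Definition codefect lam x : R := lam ^+ 2 - r ^+ 2 * enorm x ^+ 2 / lam ^+ 2.

(** The squared distance of [y] to the inversion of [x], divided by the factor
  that also appears in [codefect]; it is symmetric in [x] and [y]. *)
Definition cross lam x y : R :=
  enorm x ^+ 2 * enorm y ^+ 2 / lam ^+ 2 - 2 * dot x y + lam ^+ 2.

(** The conformal factor of the Kelvin transform. *)
Definition kelvin lam x : R := (lam / enorm x) `^ (n%:R - alpha).

Lemma defect_inversion lam x : 0 < lam -> x != 0 ->
  defect (inversion lam x) = lam ^+ 2 / enorm x ^+ 2 * codefect lam x.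
Proof.
move=> l0 x0; rewrite /defect /codefect enorm_inversion//.
by move: x0; rewrite -enorm_gt0 => x0; field; rewrite !gt_eqF.
Qed.

Lemma cross_inversionl lam x y : 0 < lam -> x != 0 ->
  enorm (inversion lam x - y) ^+ 2 = lam ^+ 2 / enorm x ^+ 2 * cross lam x y.
Proof.
move=> l0 x0; rewrite enormB_sqr enorm_inversion// /inversion dotZl /cross.
by move: x0; rewrite -enorm_gt0 => x0; field; rewrite !gt_eqF.
Qed.

Lemma cross_inversionr lam x y : 0 < lam -> y != 0 ->
  enorm (x - inversion lam y) ^+ 2 = lam ^+ 2 / enorm y ^+ 2 * cross lam x y.
Proof.
move=> l0 y0; rewrite enormB_sqr enorm_inversion// /inversion dotZr /cross.
by move: y0; rewrite -enorm_gt0 => y0; field; rewrite !gt_eqF.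
Qed.

Lemma dist_inversion lam x y : 0 < lam -> x != 0 -> y != 0 ->
  enorm (inversion lam x - inversion lam y) ^+ 2 =
  lam ^+ 2 / enorm x ^+ 2 * (lam ^+ 2 / enorm y ^+ 2) * enorm (x - y) ^+ 2.
Proof.
move=> l0 x0 y0; rewrite enormB_sqr !enorm_inversion// /inversion dotZl dotZr.
rewrite enormB_sqr.
move: x0 y0; rewrite -!enorm_gt0 => x0 y0; field; by rewrite !gt_eqF.
Qed.

Lemma cross_dist lam x y : 0 < lam -> cross lam x y - enorm (x - y) ^+ 2 =
  (lam ^+ 2 - enorm x ^+ 2) * (lam ^+ 2 - enorm y ^+ 2) / lam ^+ 2.
Proof. by move=> l0; rewrite /cross enormB_sqr; field; rewrite gt_eqF. Qed.

Lemma codefect_defect lam x : 0 < lam -> codefect lam x - defect x =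
  (lam ^+ 2 - enorm x ^+ 2) * (lam ^+ 2 + r ^+ 2) / lam ^+ 2.
Proof. by move=> l0; rewrite /codefect /defect; field; rewrite gt_eqF. Qed.

Lemma kelvinE lam x : 0 < lam ->
  (lam ^+ 2 / enorm x ^+ 2) `^ (- ((n%:R - alpha) / 2)) = (kelvin lam x)^-1.
Proof.
move=> l0; rewrite -expr_div_n -powR_mulrn; last by rewrite divr_ge0 ?enorm_ge0 ?ltW.
by rewrite -powRrM /kelvin -powRN; congr (_ `^ _); lra.
Qed.

Lemma kelvin_gt0 lam x : 0 < lam -> x != 0 -> 0 < kelvin lam x.
Proof. by rewrite -enorm_gt0 => l0 x0; rewrite powR_gt0// divr_gt0. Qed.

Lemma Omega_inversion lam x : 0 < lam -> x != 0 ->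
  Omega r (inversion lam x) <-> r * enorm x < lam ^+ 2.
Proof.
by move=> l0 x0; rewrite /Omega /= enorm_inversion// ltr_pdivlMr ?enorm_gt0.
Qed.

Lemma cross_ge0 lam x y : 0 < lam -> x != 0 -> 0 <= cross lam x y.
Proof.
move=> l0 x0; have := sqr_ge0 (enorm (inversion lam x - y)).
rewrite cross_inversionl// pmulr_rge0// divr_gt0 ?exprn_gt0//.
by rewrite enorm_gt0.
Qed.

Lemma green_inversionl lam x y : 0 < lam -> x != 0 ->
  Omega r (inversion lam x) -> Omega r y ->
  kelvin lam x * green alpha r (inversion lam x) y =
  C * K (cross lam x y) (codefect lam x * defect y / r ^+ 2).
Proof.
move=> l0 x0 xO yO; rewrite greenE// cross_inversionl// defect_inversion//.
have k0 : 0 < lam ^+ 2 / enorm x ^+ 2 by rewrite divr_gt0 ?exprn_gt0 ?enorm_gt0.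
rewrite [X in K _ X](_ : _ = lam ^+ 2 / enorm x ^+ 2 *
  (codefect lam x * defect y / r ^+ 2)); last by ring.
rewrite (kern_scale n2 al0 al2 _ k0) ?cross_ge0// kelvinE//.
by rewrite mulrCA mulVKf ?gt_eqF ?kelvin_gt0.
Qed.

Lemma green_inversionr lam x y : 0 < lam -> x != 0 -> y != 0 ->
  Omega r x -> Omega r (inversion lam y) ->
  kelvin lam y * green alpha r x (inversion lam y) =
  C * K (cross lam x y) (defect x * codefect lam y / r ^+ 2).
Proof.
move=> l0 x0 y0 xO yO; rewrite greenE// cross_inversionr// defect_inversion//.
have k0 : 0 < lam ^+ 2 / enorm y ^+ 2 by rewrite divr_gt0 ?exprn_gt0 ?enorm_gt0.
rewrite [X in K _ X](_ : _ = lam ^+ 2 / enorm y ^+ 2 *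
  (defect x * codefect lam y / r ^+ 2)); last by ring.
rewrite (kern_scale n2 al0 al2 _ k0) ?cross_ge0// kelvinE//.
by rewrite mulrCA mulVKf ?gt_eqF ?kelvin_gt0.
Qed.

Lemma green_inversionlr lam x y : 0 < lam -> x != 0 -> y != 0 ->
  Omega r (inversion lam x) -> Omega r (inversion lam y) ->
  kelvin lam x * (kelvin lam y * green alpha r (inversion lam x) (inversion lam y)) =
  C * K (enorm (x - y) ^+ 2) (codefect lam x * codefect lam y / r ^+ 2).
Proof.
move=> l0 x0 y0 xO yO; rewrite greenE// dist_inversion// !defect_inversion//.
have kx : 0 < lam ^+ 2 / enorm x ^+ 2 by rewrite divr_gt0 ?exprn_gt0 ?enorm_gt0.
have ky : 0 < lam ^+ 2 / enorm y ^+ 2 by rewrite divr_gt0 ?exprn_gt0 ?enorm_gt0.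
rewrite [X in K _ X](_ : _ = lam ^+ 2 / enorm x ^+ 2 * (lam ^+ 2 / enorm y ^+ 2) *
  (codefect lam x * codefect lam y / r ^+ 2)); last by ring.
rewrite (kern_scale n2 al0 al2 _ (mulr_gt0 kx ky)) ?sqr_ge0//.
rewrite powRM ?(ltW kx) ?(ltW ky)// !kelvinE//.
have := kelvin_gt0 l0 x0; have := kelvin_gt0 l0 y0.
move: (kelvin lam x) (kelvin lam y) (K _ _) => a b c b0 a0.
by field; rewrite !gt_eqF.
Qed.

(** The four values of the Green's function at a pair of points below the sphere
  of radius [lam] and at their inversions; here [ax < ax'] and [ay < ay'] are
  the defects and codefects of the two points, and [d <= D] the squared distance
  of the two points and their cross distance. The second inequality is read off
  from [kern_increment] when [ax' * ay <= ax * ay'], and from monotonicity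
  otherwise. *)
Lemma kern_four_points (d D ax ax' ay ay' : R) : 0 < d -> d <= D ->
  0 < ax -> ax < ax' -> 0 < ay -> ay < ay' ->
  (K D (ax * ay') < K d (ax' * ay')) /\
  (K d (ax * ay) - K D (ax' * ay) <= K d (ax' * ay') - K D (ax * ay')).
Proof.
move=> d0 dD ax0 axx ay0 ayy; have D0 : 0 < D by lra.
have lt1 : ax * ay' < ax' * ay' by rewrite ltr_pM2r//; lra.
have le1 : ax * ay <= ax * ay' by rewrite ler_pM2l// ltW.
have le2 : ax * ay <= ax' * ay by rewrite ler_pM2r// ltW.
have le3 : ax' * ay <= ax' * ay' by rewrite ler_pM2l ?ltW//; lra.
have ge0 : 0 <= ax * ay' by rewrite mulr_ge0; lra.
split.
  apply: le_lt_trans (kern_nonincreasing n2 al0 al2 d0 dD ge0) _.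
  exact: kern_increasing.
have [h|h] := leP (ax' * ay) (ax * ay').
  have := kern_increment n2 al0 al2 d0 dD h.
  have := kern_nondecreasing n2 al0 al2 d0 (ltW lt1).
  have := kern_nondecreasing n2 al0 al2 d0 le2.
  move: (K d _) (K d _) (K d _) (K d _) (K D _) (K D _) => *; lra.
have := kern_nondecreasing n2 al0 al2 D0 (ltW h).
have := kern_nondecreasing n2 al0 al2 d0 (le_trans le2 le3).
move: (K d _) (K d _) (K D _) (K D _) => *; lra.
Qed.

End green_kernel.

(** * Folding an integral along a sphere *)

Section lower_integral.
Local Open Scope ereal_scope.
Context d (T : measurableType d) (R : realType) (mu : {measure set T -> \bar R}).
Import HBNNSimple.

(** The integral of a nonnegative function is a supremum over the simple functions
  below it, and these may be set to [0] on a null set. This covers integrands that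
  are only equal almost everywhere to Borel functions, such as the composition of
  the nonlinearity with a solution. *)
Lemma nneg_integral_le_off_null (D N : set T) (f g : T -> \bar R) :
  measurable N -> mu N = 0 ->
  (forall x, D x -> 0 <= f x) -> (forall x, D x -> 0 <= g x) ->
  (forall x, D x -> ~ N x -> f x <= g x) ->
  \int[mu]_(x in D) f x <= \int[mu]_(x in D) g x.
Proof.
move=> mN N0 f0 g0 fg; rewrite !ge0_integralE//.
apply: ub_ereal_sup => _ /= [s sf <-].
have mNC : measurable (~` N) by exact: measurableC.
pose s' := mul_nnsfun s (indic_nnsfun R mNC).
apply: (@le_trans _ _ (sintegral mu s')); last first.
  apply: ereal_sup_ubound; exists s' => // x.
  rewrite /s' /= /mindic indicE; case: (boolP (x \in ~` N)) => xN.
    rewrite mulr1; apply: le_trans (sf x) _; rewrite !patchE.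
    by case: ifPn => // xD; apply: fg; [exact: set_mem|exact: (set_mem xN)].
  rewrite mulr0 patchE; case: ifPn => // xD; apply: g0; exact: set_mem.
rewrite -!integralT_nnsfun le_eqVlt; apply/orP; left; apply/eqP.
apply: ge0_ae_eq_integral => //.
- exact/measurable_EFinP.
- exact/measurable_EFinP.
- by move=> x _; rewrite lee_fin.
- by move=> x _; rewrite lee_fin.
- exists N; split => // x; apply: contra_notP => xN _.
  by rewrite /s' /= /mindic indicE mem_set// mulr1.
Qed.

Lemma nneg_integral_eq_off_null (D N : set T) (f g : T -> \bar R) :
  measurable N -> mu N = 0 ->
  (forall x, D x -> 0 <= f x) -> (forall x, D x -> 0 <= g x) ->
  (forall x, D x -> ~ N x -> f x = g x) ->
  \int[mu]_(x in D) f x = \int[mu]_(x in D) g x.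
Proof.
move=> mN N0 f0 g0 fg; apply/eqP; rewrite eq_le; apply/andP; split;
  apply: nneg_integral_le_off_null mN N0 _ _ _ => // x Dx Nx; by rewrite fg.
Qed.

End lower_integral.

Section folding.
Context {R : realType} {n : nat}.
Local Notation RB := (measurableTypeR R).
Local Notation V := 'rV[RB]_n.
Local Notation mu := (lebesgue_rV R n).
Variables (r lam : R).
Hypotheses (n0 : (0 < n)%N) (r0 : 0 < r) (rl : r < lam).

Definition annulus : set V := [set y : 'rV[R]_n | r < enorm y < lam].

Definition outer_annulus : set V :=
  [set y : 'rV[R]_n | lam < enorm y < lam ^+ 2 / r].

(** The part of the domain that the inversion maps to neither annulus. *)
Definition beyond : set V :=
  [set y : 'rV[R]_n | enorm y = lam \/ lam ^+ 2 / r <= enorm y].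

Lemma measurable_enorm_itv (i : interval R) :
  measurable [set y : V | enorm (y : 'rV[R]_n) \in i].
Proof.
rewrite (_ : [set _ | _] = (fun y : V => enorm (y : 'rV[R]_n)) @^-1` [set` i]) //.
by apply: measurable_preimage => //; exact: measurable_enorm.
Qed.

Lemma measurable_annulus : measurable annulus.
Proof.
rewrite (_ : annulus = [set y : V | enorm (y : 'rV[R]_n) \in `]r, lam[]).
  exact: measurable_enorm_itv.
by apply/seteqP; split => y; rewrite /= in_itv.
Qed.

Lemma measurable_outer_annulus : measurable outer_annulus.
Proof.
rewrite (_ : outer_annulus =
    [set y : V | enorm (y : 'rV[R]_n) \in `]lam, (lam ^+ 2 / r)[]).
  exact: measurable_enorm_itv.
by apply/seteqP; split => y; rewrite /= in_itv.
Qed.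

Lemma measurable_beyond : measurable beyond.
Proof.
rewrite (_ : beyond = sphere lam `|`
    [set y : V | enorm (y : 'rV[R]_n) \in `[lam ^+ 2 / r, +oo[]).
  by apply: measurableU; [exact: measurable_sphere|exact: measurable_enorm_itv].
by apply/seteqP; split => y; rewrite /= in_itv/= andbT.
Qed.

Lemma measurable_Omega s : measurable (@Omega R n s : set V).
Proof.
rewrite (_ : Omega s = [set y : V | enorm (y : 'rV[R]_n) \in `]s, +oo[]).
  exact: measurable_enorm_itv.
by apply/seteqP; split => y; rewrite /= in_itv/= andbT.
Qed.

Lemma lam2r : lam < lam ^+ 2 / r.
Proof.
have h := r0; have h' := rl.
by rewrite ltr_pdivlMr// expr2 ltr_pM2l//; lra.
Qed.

Lemma OmegaE : @Omega R n r = annulus `|` (outer_annulus `|` beyond).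
Proof.
have h := r0; have h' := rl; have h2 := lam2r.
apply/seteqP; split => y; rewrite /Omega /annulus /outer_annulus /beyond /=.
  move=> ry; have [yl|yl|->] := ltgtP (enorm y) lam.
  - by left; rewrite ry.
  - right; have [h3|h3] := ltP (enorm y) (lam ^+ 2 / r); first by left.
    by right; right.
  - by right; right; left.
by move=> [/andP[]//|[/andP[]|[|]]]; lra.
Qed.

Lemma inversion_outer_annulus (y : 'rV[R]_n) :
  outer_annulus (inversion lam y) <-> annulus y.
Proof.
have l0 : 0 < lam by exact: lt_trans rl.
rewrite /outer_annulus /annulus /=.
have [->|y0] := eqVneq y 0.
  rewrite /inversion scaler0 enorm0; split => /andP[]; last by rewrite ltNge ltW.
  by rewrite ltNge ltW.
rewrite enorm_inversion//; move: y0; rewrite -enorm_gt0 => y0.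
rewrite ltr_pdivlMr// expr2 ltr_pM2l// ltr_pM2l ?mulr_gt0// ltf_pV2 ?posrE//.
by split => /andP[-> ->].
Qed.

(** The inversion exchanges the two annuli, so that the outer one can be folded
  onto the inner one. *)
Lemma integral_fold (f : V -> R) : measurable_fun setT f -> (forall y, 0 <= f y) ->
  (\int[mu]_(y in @Omega R n r) (f y)%:E =
   \int[mu]_(y in annulus) (f y + inversion_jacobian lam y * f (inversion lam y))%:E +
   \int[mu]_(y in beyond) (f y)%:E)%E.
Proof.
move=> mf f0; have l0 : 0 < lam by exact: lt_trans rl.
have mA := measurable_annulus; have mO := measurable_outer_annulus.
have mB := measurable_beyond.
have h2 := lam2r.
have mfE D : measurable_fun D (fun y : V => (f y)%:E).
  by apply/measurable_EFinP; exact: measurable_funTS.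
have f0E y : (0 <= (f y)%:E)%E by rewrite lee_fin.
have mfi : measurable_fun setT (fun y : V => f (inversion lam y)).
  exact: (measurableT_comp mf (measurable_inversion lam)).
rewrite OmegaE ge0_integral_setU//; last 2 first.
- exact: measurableU.
- apply/disj_setPS => y [/= /andP[_ h] []].
    by move=> /andP[h' _]; move: h; rewrite ltNge ltW.
  by move=> []; [move=> yE; move: h; rewrite yE ltxx|move: h2 h; lra].
rewrite ge0_integral_setU//; last first.
  apply/disj_setPS => y [/= /andP[h h'] []]; last by rewrite leNgt h'.
  by move=> yE; move: h; rewrite yE ltxx.
rewrite addeA; congr (_ + _)%E.
under [RHS]eq_integral do rewrite EFinD.
rewrite ge0_integralD//; last 2 first.
- move=> y _; rewrite lee_fin mulr_ge0// inversion_jacobian_ge0//.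
- apply/measurable_EFinP; apply: measurable_funTS; apply: measurable_funM => //.
  exact: measurable_inversion_jacobian.
congr (_ + _)%E.
rewrite integral_mkcond [RHS]integral_mkcond (integral_inversion n0 l0); last 2 first.
- exact: (iffLR (measurable_restrictT _ mO) (mfE _)).
- by move=> y; rewrite patchE; case: ifPn.
apply: eq_integral => y _; rewrite !patchE.
have -> : (inversion lam y \in outer_annulus) = (y \in annulus).
  by apply/idP/idP => /set_mem h; apply/mem_set; apply/inversion_outer_annulus.
by case: ifPn => _; rewrite ?EFinM// mule0.
Qed.

End folding.

(** * Comparison of a potential with its Kelvin transform *)

Opaque kern.

(** The pointwise form of the comparison. Here [a], [b], [m], [g] stand for the
  values of the Green's function, with their Kelvin factors, at two points, after
  inversion of the first, of the second, and of both; [h] and [k] stand for the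
  source at a point and the source of the Kelvin transform there, and [e] for
  an error. When [e = 0] the two sides differ by [(g - m - (a - b)) * h]; the
  error costs at most [g * e]. *)
Lemma reflection_inequality (R : realType) (a b m g h k e : R) :
  m <= g -> a - b <= g - m -> h <= k + e -> 0 <= m -> 0 <= h -> 0 <= e ->
  a * h + m * k + Num.max 0 (g - m) * Num.max 0 (k - h) <= b * h + g * k + g * e.
Proof.
move=> mg ab hke m0 h0 e0.
have H1 : (a - b) * h <= (g - m) * h by rewrite ler_wpM2r.
rewrite [Num.max 0 (g - m)]max_r ?subr_ge0//.
have ge : 0 <= g * e by rewrite mulr_ge0// (le_trans m0).
have [hk|kh] := leP h k; first by rewrite max_r ?subr_ge0//; nra.
rewrite max_l ?subr_le0 ?(ltW kh)// mulr0 addr0.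
have H2 : (g - m) * h <= (g - m) * (k + e) by rewrite ler_wpM2l// subr_ge0.
have H3 : 0 <= m * e by rewrite mulr_ge0.
nra.
Qed.

Section kelvin_comparison.
Context {R : realType}.
Variables (n : nat) (alpha r : R).
Hypotheses (n2 : (2 <= n)%N) (al0 : 0 < alpha) (al2 : alpha <= 2) (r0 : 0 < r).
Local Notation RB := (measurableTypeR R).
Local Notation V := 'rV[RB]_n.
Local Notation mu := (lebesgue_rV R n).
Local Notation K := (kern n alpha).
Local Notation C := (green_cst n alpha).
Local Notation kelv := (kelvin alpha).

Let n0 : (0 < n)%N. Proof. exact: leq_trans n2. Qed.

(** After substituting the inversion, the Kelvin transform of the potential of [h]
  is an integral against this source; what the Jacobian contributes besides is the
  Kelvin factor of [y], by [jacobian_kelvin]. *)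
Definition kelvin_source (lam : R) (h : V -> R) (y : V) : R :=
  (lam / enorm (y : 'rV[R]_n)) `^ (n%:R + alpha) * h (inversion lam y).

(** The Green's function at the inversions of [x] and [y], with both Kelvin
  factors; see [green_inversionlr]. *)
Definition reflected_green (lam : R) (x y : 'rV[R]_n) : R :=
  C * K (enorm (x - y) ^+ 2) (codefect r lam x * codefect r lam y / r ^+ 2).

(** The Green's function at [x] and the inversion of [y], with the Kelvin factor
  of [y]; see [green_inversionr]. *)
Definition mixed_green (lam : R) (x y : 'rV[R]_n) : R :=
  C * K (cross lam x y) (defect r x * codefect r lam y / r ^+ 2).

Lemma measurable_sqr_dist (x : 'rV[R]_n) :
  measurable_fun setT (fun y : V => enorm (x - y : 'rV[R]_n) ^+ 2).
Proof.
apply: measurable_funX.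
exact: (measurableT_comp measurable_enorm (measurable_sub_rV x)).
Qed.

Lemma measurable_sqr_enorm :
  measurable_fun setT (fun y : V => enorm (y : 'rV[R]_n) ^+ 2).
Proof. by apply: measurable_funX; exact: measurable_enorm. Qed.

Lemma measurable_defect : measurable_fun setT (fun y : V => defect r (y : 'rV[R]_n)).
Proof. by apply: measurable_funB => //; exact: measurable_sqr_enorm. Qed.

Lemma measurable_codefect lam :
  measurable_fun setT (fun y : V => codefect r lam (y : 'rV[R]_n)).
Proof.
apply: measurable_funB => //; apply: measurable_funM => //.
by apply: measurable_funM => //; exact: measurable_sqr_enorm.
Qed.

Lemma measurable_cross lam x :
  measurable_fun setT (fun y : V => cross lam x (y : 'rV[R]_n)).
Proof.
apply: measurable_funD => //; apply: measurable_funB.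
  apply: measurable_funM => //.
  by apply: measurable_funM => //; exact: measurable_sqr_enorm.
apply: measurable_funM => //; apply: measurable_sum => i.
by apply: measurable_funM => //; exact: measurable_rV_coord.
Qed.

Lemma measurable_kern_dist (x : 'rV[R]_n) (a : R) (b : V -> R) :
  measurable_fun setT b ->
  measurable_fun setT (fun y : V => C * K (enorm (x - y) ^+ 2) (a * b y / r ^+ 2)).
Proof.
move=> mb; apply: measurable_funM => //; apply: measurable_kern => //.
- by move=> y; exact: sqr_ge0.
- exact: measurable_sqr_dist.
- by apply: measurable_funM => //; apply: measurable_funM.
Qed.

Lemma measurable_reflected_green lam x :
  measurable_fun setT (fun y : V => reflected_green lam x y).
Proof. by apply: (measurable_kern_dist x (codefect r lam x)); exact: measurable_codefect. Qed.

Lemma reflected_green_ge0 lam x y : 0 <= reflected_green lam x y.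
Proof. by apply: mulr_ge0; [exact: green_cst_ge0|exact: kern_ge0]. Qed.

Lemma mixed_green_ge0 lam x y : 0 <= mixed_green lam x y.
Proof. by apply: mulr_ge0; [exact: green_cst_ge0|exact: kern_ge0]. Qed.

Section comparison.
Variables (lam : R) (x : 'rV[R]_n).
Hypotheses (rx : r < enorm x) (xl : enorm x < lam).

Let x0 : x != 0. Proof. by rewrite -enorm_gt0; exact: lt_trans rx. Qed.

Let l0 : 0 < lam. Proof. by exact: lt_trans (lt_trans r0 rx) xl. Qed.

Let rl : r < lam. Proof. exact: lt_trans rx xl. Qed.

Let xO : Omega r x. Proof. exact: rx. Qed.

Lemma annulus_inversion_Omega (y : 'rV[R]_n) : annulus r lam y ->
  [/\ Omega r y, y != 0 & Omega r (inversion lam y)].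
Proof.
move=> /andP[ry yl]; have y0 : y != 0 by rewrite -enorm_gt0; exact: lt_trans ry.
split => //; apply/Omega_inversion => //.
by rewrite expr2; apply: ltr_pM => //; [exact: ltW|exact: enorm_ge0].
Qed.

Let xlO : Omega r (inversion lam x).
Proof. by have [] := @annulus_inversion_Omega x; rewrite /annulus /= ?rx. Qed.

(** Inversion moves a point of the annulus away from the boundary of the domain,
  where the Green's function vanishes. *)
Lemma codefect_gt_defect (y : 'rV[R]_n) : annulus r lam y ->
  0 < defect r y /\ defect r y < codefect r lam y.
Proof.
move=> yA; have [yO y0 _] := annulus_inversion_Omega yA; split.
  exact: defect_gt0.
rewrite -subr_gt0 codefect_defect// divr_gt0 ?exprn_gt0// mulr_gt0//.
  by move/andP : yA => [ry yl]; rewrite subr_gt0 ltr_pXn2r ?nnegrE ?enorm_ge0 ?(ltW l0).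
by rewrite addr_gt0 ?exprn_gt0.
Qed.

Lemma jacobian_kelvin (y : 'rV[R]_n) : y != 0 ->
  inversion_jacobian lam y = kelv lam y * (lam / enorm y) `^ (n%:R + alpha).
Proof.
rewrite -enorm_gt0 => y0; have ly : 0 < lam / enorm y by rewrite divr_gt0.
rewrite /inversion_jacobian /kelvin -powRD ?(gt_eqF ly) ?implybT//.
by rewrite -powR_mulrn ?(ltW ly)//; congr (_ `^ _); rewrite natrM; ring.
Qed.

(** Beyond the sphere the inversion of [x] is nearer than [x], since the product
  in [cross_dist] is nonpositive there, and its defect is larger, both up to the
  Kelvin factor. *)
Lemma green_beyond (y : 'rV[R]_n) : beyond r lam y ->
  green alpha r x y <= kelv lam x * green alpha r (inversion lam x) y.
Proof.
move=> yB; have yl : lam <= enorm y.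
  case: yB => [->//|]; apply: le_trans; rewrite ltW// lam2r//.
have yO : Omega r y by exact: lt_le_trans yl.
have [dx xx] : 0 < defect r x /\ defect r x < codefect r lam x.
  by apply: codefect_gt_defect; rewrite /annulus /= rx.
have dy := defect_gt0 r0 yO.
rewrite green_inversionl// greenE// ler_wpM2l ?green_cst_ge0//.
have D0 : 0 < cross lam x y.
  have : 0 < enorm (inversion lam x - y) ^+ 2.
    rewrite exprn_gt0// enorm_gt0 subr_eq0; apply/eqP => yE.
    move: yB; rewrite /beyond /= -yE enorm_inversion//.
    have ex : 0 < enorm x by rewrite enorm_gt0.
    case=> [lE|]; last by rewrite leNgt ltr_pM2l ?exprn_gt0// ltf_pV2 ?posrE// rx.
    have : lam * enorm x < lam * lam by rewrite ltr_pM2l.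
    by rewrite -expr2 -[X in X * _ < _]lE divfK ?gt_eqF// ltxx.
  rewrite cross_inversionl// pmulr_rgt0// divr_gt0 ?exprn_gt0//.
  by rewrite enorm_gt0.
have Dd : cross lam x y <= enorm (x - y) ^+ 2.
  rewrite -subr_le0 cross_dist// pmulr_lle0 ?invr_gt0 ?exprn_gt0//.
  rewrite pmulr_rle0; first by rewrite subr_le0 lerXn2r ?nnegrE ?enorm_ge0 ?(ltW l0).
  by rewrite subr_gt0 ltr_pXn2r ?nnegrE ?enorm_ge0 ?(ltW l0).
have r2 : 0 < (r ^+ 2)^-1 by rewrite invr_gt0 exprn_gt0.
apply: le_trans (kern_nonincreasing n2 al0 al2 D0 Dd _) _.
  by rewrite !mulr_ge0 ?(ltW r2) ?(ltW dx) ?(ltW dy).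
by apply: kern_nondecreasing => //; rewrite ler_wpM2r ?(ltW r2)// ler_wpM2r ?(ltW dy) ?(ltW xx).
Qed.

Lemma four_greens (y : 'rV[R]_n) : annulus r lam y -> y != x ->
  [/\ mixed_green lam x y <= reflected_green lam x y,
      0 < C -> mixed_green lam x y < reflected_green lam x y &
      green alpha r x y - kelv lam x * green alpha r (inversion lam x) y <=
      reflected_green lam x y - mixed_green lam x y].
Proof.
move=> yA yx; have [yO y0 ylO] := annulus_inversion_Omega yA.
have [dx xx] : 0 < defect r x /\ defect r x < codefect r lam x.
  by apply: codefect_gt_defect; rewrite /annulus /= rx.
have [dy yy] := codefect_gt_defect yA.
have r2 : 0 < (r ^+ 2)^-1 by rewrite invr_gt0 exprn_gt0.
have d0 : 0 < enorm (x - y) ^+ 2.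
  by rewrite exprn_gt0// enorm_gt0 subr_eq0 eq_sym.
have dD : enorm (x - y) ^+ 2 <= cross lam x y.
  rewrite -subr_ge0 cross_dist// divr_ge0 ?exprn_ge0 ?(ltW l0)//.
  move/andP : yA => [_ yl].
  by apply: mulr_ge0; rewrite subr_ge0 lerXn2r ?nnegrE ?enorm_ge0 ?(ltW l0) ?(ltW xl) ?(ltW yl).
have := @kern_four_points R n alpha n2 al0 al2 _ _ (defect r x / r ^+ 2)
  (codefect r lam x / r ^+ 2) _ _ d0 dD _ _ dy yy.
rewrite divr_gt0 ?exprn_gt0// ltr_pM2r// => /(_ isT xx).
rewrite ![_ / r ^+ 2 * _]mulrAC => -[lt4 le4].
have C0 := green_cst_ge0 n alpha.
split.
- by rewrite ler_wpM2l// ltW.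
- by move=> Cp; rewrite ltr_pM2l.
- rewrite green_inversionl// greenE// -!mulrBr; exact: ler_wpM2l.
Qed.

Variables (h E : V -> R).
Hypotheses (mh : measurable_fun setT h) (h0 : forall y, 0 <= h y).
Hypotheses (mE : measurable_fun setT E) (E0 : forall y, 0 <= E y).
Hypothesis hE : {ae mu, forall y, annulus r lam y ->
  h y <= kelvin_source lam h y + E y}.

(** The amount by which the comparison improves where the source of the Kelvin
  transform exceeds [h]. The truncations make it nonnegative everywhere. *)
Definition kelvin_gap (y : V) : R :=
  Num.max 0 (reflected_green lam x y - mixed_green lam x y) *
  Num.max 0 (kelvin_source lam h y - h y).

Lemma measurable_kelvin_source : measurable_fun setT (kelvin_source lam h).
Proof.
apply: measurable_funM; last first.
  exact: (measurableT_comp mh (measurable_inversion lam)).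
apply: (measurableT_comp (measurable_powR _)); apply: measurable_funM => //.
by apply: measurable_invr_nneg; [exact: enorm_ge0|exact: measurable_enorm].
Qed.

Lemma measurable_kelvin_gap : measurable_fun setT kelvin_gap.
Proof.
apply: measurable_funM; apply: measurable_maxr => //; apply: measurable_funB => //.
- exact: measurable_reflected_green.
- apply: measurable_funM => //; apply: measurable_kern => //.
  + by move=> y; exact: cross_ge0.
  + exact: measurable_cross.
  + by apply: measurable_funM => //; apply: measurable_funM => //; exact: measurable_codefect.
- exact: measurable_kelvin_source.
Qed.

Lemma kelvin_gap_ge0 y : 0 <= kelvin_gap y.
Proof. by rewrite mulr_ge0// le_max lexx. Qed.

(** Both potentials are folded onto the annulus, where [four_greens] and
  [reflection_inequality] compare the integrands; what remains beyond it is
  handled by [green_beyond]. *)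
Lemma kelvin_comparison :
  (\int[mu]_(y in @Omega R n r) (green alpha r x y * h y)%:E +
   \int[mu]_(y in annulus r lam) (kelvin_gap y)%:E <=
   (kelv lam x)%:E *
     \int[mu]_(y in @Omega R n r) (green alpha r (inversion lam x) y * h y)%:E +
   \int[mu]_(y in annulus r lam) (reflected_green lam x y * E y)%:E)%E.
Proof.
have mA := @measurable_annulus R n r lam.
have mO := @measurable_Omega R n r.
have mB := @measurable_beyond R n r lam.
have C0 := green_cst_ge0 n alpha.
have k0 := kelvin_gt0 alpha l0 x0.
pose f1 (y : V) := C * K (enorm (x - y) ^+ 2) (defect r x * defect r y / r ^+ 2) * h y.
pose g2 (y : V) := C * K (enorm (inversion lam x - y) ^+ 2)
  (defect r (inversion lam x) * defect r y / r ^+ 2) * h y.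
have f1E y : Omega r y -> f1 y = green alpha r x y * h y.
  by move=> yO; rewrite /f1 greenE.
have g2E y : Omega r y -> g2 y = green alpha r (inversion lam x) y * h y.
  by move=> yO; rewrite /g2 greenE.
have f10 y : 0 <= f1 y.
  by apply: mulr_ge0 => //; apply: mulr_ge0 => //; exact: kern_ge0.
have g20 y : 0 <= g2 y.
  by apply: mulr_ge0 => //; apply: mulr_ge0 => //; exact: kern_ge0.
have mf1 : measurable_fun setT f1.
  by apply: measurable_funM => //; apply: measurable_kern_dist; exact: measurable_defect.
have mg2 : measurable_fun setT g2.
  by apply: measurable_funM => //; apply: measurable_kern_dist; exact: measurable_defect.
clearbody f1 g2.
pose f2 (y : V) := kelv lam x * g2 y.
have f2E y : Omega r y ->
    f2 y = kelv lam x * green alpha r (inversion lam x) y * h y.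
  by move=> yO; rewrite /f2 g2E// mulrA.
have f20 y : 0 <= f2 y by apply: mulr_ge0 => //; exact: ltW.
have mf2 : measurable_fun setT f2 by exact: measurable_funM.
have int1 : (\int[mu]_(y in @Omega R n r) (green alpha r x y * h y)%:E =
    \int[mu]_(y in @Omega R n r) (f1 y)%:E)%E.
  by apply: eq_integral => y /set_mem yO; rewrite f1E.
have int2 : ((kelv lam x)%:E *
     \int[mu]_(y in @Omega R n r) (green alpha r (inversion lam x) y * h y)%:E =
    \int[mu]_(y in @Omega R n r) (f2 y)%:E)%E.
  under [RHS]eq_integral do rewrite EFinM.
  rewrite ge0_integralZl//; last 3 first.
  - by apply/measurable_EFinP; exact: measurable_funTS.
  - by move=> y _; rewrite lee_fin.
  - by rewrite lee_fin ltW.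
  by congr (_ * _)%E; apply: eq_integral => y /set_mem yO; rewrite g2E.
clearbody f2.
have mfold (f : V -> R) : measurable_fun setT f ->
    measurable_fun setT (fun y : V => f y + inversion_jacobian lam y * f (inversion lam y)).
  move=> mf; apply: measurable_funD => //; apply: measurable_funM => //.
    exact: measurable_inversion_jacobian.
  exact: (measurableT_comp mf (measurable_inversion lam)).
have fold0 (f : V -> R) y : (forall y, 0 <= f y) ->
    0 <= f y + inversion_jacobian lam y * f (inversion lam y).
  by move=> f0; rewrite addr_ge0// mulr_ge0// inversion_jacobian_ge0.
have F1 := integral_fold n0 r0 rl mf1 f10.
have F2 := integral_fold n0 r0 rl mf2 f20.
rewrite [X in (X + _ <= _)%E](etrans int1 F1).
rewrite [X in (_ <= X + _)%E](etrans int2 F2).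
rewrite [leLHS]addeAC [leRHS]addeAC; apply: leeD; last first.
  apply: ge0_le_integral => //.
  - by move=> y _; rewrite lee_fin.
  - by apply/measurable_EFinP; exact: measurable_funTS.
  - by apply/measurable_EFinP; exact: measurable_funTS.
  - move=> y yB; rewrite lee_fin.
    have yO : Omega r y by rewrite (OmegaE r0 rl); right; right.
    by rewrite f1E// f2E// ler_wpM2r// green_beyond.
have mG := measurable_reflected_green lam x.
pose e y := reflected_green lam x y * E y.
have me : measurable_fun setT e by exact: measurable_funM.
have e0 y : 0 <= e y by apply: mulr_ge0 => //; exact: reflected_green_ge0.
pose p1 y := f1 y + inversion_jacobian lam y * f1 (inversion lam y).
pose p2 y := f2 y + inversion_jacobian lam y * f2 (inversion lam y).
have mp1 : measurable_fun setT p1 by exact: mfold.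
have mp2 : measurable_fun setT p2 by exact: mfold.
have p10 y : 0 <= p1 y by exact: fold0.
have p20 y : 0 <= p2 y by exact: fold0.
have pointwise y : annulus r lam y -> y != x -> h y <= kelvin_source lam h y + E y ->
    p1 y + kelvin_gap y <= p2 y + e y.
  move=> yA yx hy; have [yO y0 ylO] := annulus_inversion_Omega yA.
  have [mg _ ab] := four_greens yA yx.
  have -> : p1 y = green alpha r x y * h y + mixed_green lam x y * kelvin_source lam h y.
    have -> : mixed_green lam x y = kelv lam y * green alpha r x (inversion lam y).
      by apply/esym; exact: green_inversionr.
    rewrite /p1 f1E// f1E// jacobian_kelvin// /kelvin_source.
    move: (green _ _ _ _) (green _ _ _ _) (kelv _ _) (_ `^ _) (h _) (h _) => *.
    by ring.
  have -> : p2 y = kelv lam x * green alpha r (inversion lam x) y * h y +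
      reflected_green lam x y * kelvin_source lam h y.
    have -> : reflected_green lam x y = kelv lam x * (kelv lam y *
        green alpha r (inversion lam x) (inversion lam y)).
      by apply/esym; exact: green_inversionlr.
    rewrite /p2 f2E// f2E// jacobian_kelvin// /kelvin_source.
    move: (kelv _ _) (kelv _ _) (green _ _ _ _) (green _ _ _ _) (_ `^ _) (h _) (h _) => *.
    by ring.
  by apply: reflection_inequality => //; exact: mixed_green_ge0.
have toE (f : V -> R) : measurable_fun setT f ->
    measurable_fun (annulus r lam) (fun y : V => (f y)%:E).
  by move=> mf; apply/measurable_EFinP; exact: measurable_funTS.
have toE0 (f : V -> R) : (forall y, 0 <= f y) ->
    forall y, annulus r lam y -> (0 <= (f y)%:E)%E.
  by move=> f0 y _; rewrite lee_fin.
have mgap := measurable_kelvin_gap.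
rewrite -/(p1 _).
have S1 := ge0_integralD mu mA (toE0 _ p10) (toE _ mp1) (toE0 _ kelvin_gap_ge0) (toE _ mgap).
have S2 := ge0_integralD mu mA (toE0 _ p20) (toE _ mp2) (toE0 _ e0) (toE _ me).
rewrite -[leLHS]S1 -[leRHS]S2.
clearbody p1 p2 e.
apply: ae_ge0_le_integral => //.
- by move=> y yA; apply: adde_ge0; rewrite lee_fin// kelvin_gap_ge0.
- by apply: emeasurable_funD; exact: toE.
- by move=> y yA; apply: adde_ge0; rewrite lee_fin.
- by apply: emeasurable_funD; exact: toE.
have xnull : {ae mu, forall y : V, (y : 'rV[R]_n) != x}.
  exists [set x : V]; split; [exact: measurable_point|exact: lebesgue_point|].
  by move=> y /= /negP; rewrite negbK => /eqP.
apply: filterS2 hE xnull => y hy yx yA.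
by rewrite -!EFinD lee_fin; apply: pointwise => //; exact: hy.
Qed.

End comparison.
End kelvin_comparison.

(** * The nonlinearity *)

(** Induction along a real interval: a property that holds on an initial segment
  and can always be continued a little further holds up to the end. *)
Lemma sup_induction (R : realType) (P : R -> Prop) (a b : R) : a <= b ->
  (forall s t, P t -> s <= t -> P s) ->
  (forall s, a <= s -> s <= b -> (forall t, a <= t -> t < s -> P t) ->
    exists2 e, 0 < e & P (Num.min b (s + e))) ->
  P b.
Proof.
move=> ab Pdown step.
pose T := [set t | a <= t <= b /\ P t].
have Ta : T a.
  split; first by rewrite lexx ab.
  have [|e e0] := step a (lexx a) ab; first by move=> t; lra.
  by move=> /Pdown; apply; rewrite le_min ab; lra.
have Tsup : has_sup T.
  by split; [exists a|exists b => t [/andP[_ tb] _]].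
pose s := sup T.
have as_ : a <= s by apply: ub_le_sup => //; case: Tsup.
have sb : s <= b by apply: ge_sup => [|t [/andP[]//]]; exists a.
have [t at_ ts|e e0 Pe] := step s as_ sb.
  have [t' [_ Pt'] tt'] := sup_gt (proj1 Tsup) ts.
  exact: Pdown Pt' (ltW tt').
have : T (Num.min b (s + e)).
  split=> //; rewrite le_min ab ge_min lexx/= andbT; lra.
move=> /(ub_le_sup (proj2 Tsup)); rewrite -/s ge_min.
move=> /orP[bs|]; last lra.
by move: Pe; rewrite min_l//; lra.
Qed.

Section nonlinearity.
Context {R : realType}.
Variables (n : nat) (alpha r : R) (f : 'rV[R]_n -> R -> R).
Hypotheses (n2 : (2 <= n)%N) (al0 : 0 < alpha) (al2 : alpha <= 2) (r0 : 0 < r).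

Lemma alpha_le_n : alpha <= n%:R.
Proof. by apply: le_trans al2 _; rewrite ler_nat. Qed.

(** The local constants are patched together along the compact segment [[0, M]]. *)
Lemma locally_lipschitz_segment (g : 'rV[R]_n -> R -> R) (om : set 'rV[R]_n) M :
  locally_lipschitz r g -> om `<=` Omega r ->
  (exists M', forall x, om x -> enorm x <= M') -> 0 <= M ->
  exists2 L, 0 <= L & forall x v w, om x -> 0 <= v -> v <= w -> w <= M ->
    g x w - g x v <= L * (w - v).
Proof.
move=> lip omO omb M0.
pose P t := exists2 L, 0 <= L & forall x v w, om x -> 0 <= v -> v <= w -> w <= t ->
    g x w - g x v <= L * (w - v).
apply: (@sup_induction R P 0 M) => //.
  move=> s t [L L0 hL] st; exists L => // x v w ox v0 vw ws.
  by apply: hL => //; exact: le_trans st.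
move=> s s0 sM Ps.
have [V [oV Vs] [L hL]] := lip s om s0 omO omb.
have [e /= e0 he] := (proj1 (nbhs_ballP _ _) (open_nbhs_nbhs (conj oV Vs))).
have Vt t : `|s - t| < e -> V t by move=> st; apply: he.
have near L' v w x : om x -> L <= L' -> `|s - v| < e -> `|s - w| < e -> 0 <= v ->
    v <= w -> g x w - g x v <= L' * (w - v).
  move=> ox LL' sv sw v0 vw; have w0 : 0 <= w by exact: le_trans vw.
  have := hL x w v ox (Vt w sw) w0 (Vt v sv) v0.
  rewrite [`|w - v|]ger0_norm ?subr_ge0// => h.
  have := ler_norm (g x w - g x v).
  have : L * (w - v) <= L' * (w - v) by rewrite ler_wpM2r ?subr_ge0.
  lra.
exists (e / 2); first lra.
have [es|se] := ltP (s - e / 2) 0.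
  exists (Num.max 0 L); first by rewrite le_max lexx.
  move=> x v w ox v0 vw; rewrite le_min => /andP[wM ws].
  apply: near => //; first by rewrite le_max lexx orbT.
    by rewrite ltr_norml; apply/andP; split; lra.
  by rewrite ltr_norml; apply/andP; split; lra.
have [L1 L10 hL1] := Ps (s - e / 2) se ltac:(lra).
pose t1 := s - e / 2; exists (Num.max L1 L); first by rewrite le_max L10.
have LL1 : L1 <= Num.max L1 L by rewrite le_max lexx.
have LL2 : L <= Num.max L1 L by rewrite le_max lexx orbT.
move: (Num.max L1 L) LL1 LL2 => L' LL1 LL2.
move=> x v w ox v0 vw; rewrite le_min => /andP[wM ws].
have low v' w' : 0 <= v' -> v' <= w' -> w' <= t1 -> g x w' - g x v' <= L' * (w' - v').
  move=> v0' vw' wt; have := hL1 x v' w' ox v0' vw' wt.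
  have : L1 * (w' - v') <= L' * (w' - v') by rewrite ler_wpM2r ?subr_ge0.
  lra.
have [wt|tw] := leP w t1; first exact: low.
have wV : `|s - w| < e by rewrite /t1 in tw; rewrite ltr_norml; apply/andP; split; lra.
have [vt|tv] := leP v t1; last first.
  by apply: near => //; rewrite /t1 in tv; rewrite ltr_norml; apply/andP; split; lra.
have h1 := low v t1 v0 vt (lexx _).
have h2 : g x w - g x t1 <= L' * (w - t1).
  apply: near => //; last exact: ltW.
  by rewrite /t1 ltr_norml; apply/andP; split; lra.
nra.
Qed.

(** The exponent is raised to a positive one below [alpha / n%:R], which on a
  bounded set only costs a constant factor. *)
Lemma lipschitz_bound : f2 alpha r f -> forall Lam M, r < Lam -> 0 <= M ->
  exists theta L, [/\ 0 < theta, theta < alpha / n%:R, 0 <= L &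
    forall y v w, Omega r y -> enorm y <= Lam -> 0 <= w -> w <= v -> v <= M ->
      f y v <= f y w + L * (enorm y - r) `^ (- theta) * (v - w)].
Proof.
have A0 := al0; have R0 := r0.
move=> [theta0 th0 lip] Lam M rL M0.
have nR : 0 < n%:R :> R by rewrite ltr0n; exact: leq_trans n2.
have an : 0 < alpha / n%:R by rewrite divr_gt0.
pose om : set 'rV[R]_n := [set y | r < enorm y <= Lam].
have [||L L0 hL] := @locally_lipschitz_segment _ om M lip _ _ M0.
- by move=> y /andP[].
- by exists Lam => y /andP[].
pose theta := Num.max theta0 (alpha / n%:R / 2).
have tt : theta0 <= theta by rewrite le_max lexx.
have tp : 0 < theta by rewrite lt_max; apply/orP; right; lra.
have ta : theta < alpha / n%:R by rewrite gt_max th0/=; lra.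
exists theta, (L * Lam `^ (theta - theta0)); split => //.
  by rewrite mulr_ge0 ?powR_ge0.
move=> y v w yO yL w0 wv vM.
have d0 : 0 < enorm y - r by rewrite subr_gt0.
have oy : om y by rewrite /om /= yL andbT.
have := hL y w v oy w0 wv vM.
rewrite -mulrBr -lerBlDl => h.
have p0 : 0 < (enorm y - r) `^ theta0 by exact: powR_gt0.
have {}h : f y v - f y w <= L * (v - w) * (enorm y - r) `^ (- theta0).
  by rewrite powRN ler_pdivlMr// mulrC.
apply: le_trans h _.
have -> : (enorm y - r) `^ (- theta0) =
    (enorm y - r) `^ (theta - theta0) * (enorm y - r) `^ (- theta).
  by rewrite -powRD ?(gt_eqF d0) ?implybT//; congr (_ `^ _); ring.
have : (enorm y - r) `^ (theta - theta0) <= Lam `^ (theta - theta0).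
  by rewrite ge0_ler_powR ?nnegrE ?subr_ge0//; lra.
have := powR_ge0 (enorm y - r) (- theta).
have : 0 <= L * (v - w) by rewrite mulr_ge0// subr_ge0.
move: ((enorm y - r) `^ (- theta)) ((enorm y - r) `^ (theta - theta0)).
move: (Lam `^ (theta - theta0)) => c a b Lv0 a0 bc.
have : L * (v - w) * (b * a) <= L * (v - w) * (c * a).
  by rewrite ler_wpM2l// ler_wpM2r.
by move=> /le_trans; apply; rewrite le_eqVlt; apply/orP; left; apply/eqP; ring.
Qed.

(** Both alternatives of subcriticality say the same: one compares the parameters
  [1] and [m] at [x], the other [m^-1] and [1] at the dilated point. *)
Lemma subcritical_dilation : subcritical alpha r f ->
  forall x v m, Omega r x -> 0 < v -> 1 < m ->
  f x v < scale_fun alpha f m x v.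
Proof.
have R0 := r0; move=> sub x v m xO v0 m1.
have m0 : 0 < m by lra.
have sp1 z : scale_point alpha 1 z = z :> 'rV[R]_n.
  by rewrite /scale_point powR1 scale1r if_same.
have sf1 z w : scale_fun alpha f 1 z w = f z w.
  by rewrite /scale_fun sp1 powR1 expr1n !mul1r invr1 mul1r if_same.
have spO : Omega r (scale_point alpha m x).
  have dil c : 1 <= c -> Omega r (c *: x).
    move=> c1; rewrite /Omega /= enormZ ger0_norm; last lra.
    apply: lt_le_trans xO _; rewrite ler_peMl// enorm_ge0//.
  rewrite /scale_point; case: ifPn => an; apply: dil; last exact: ltW.
  rewrite [X in X <= _](_ : _ = m `^ 0); last by rewrite powRr0.
  apply: ler_powR; first exact: ltW.
  by rewrite divr_ge0// subr_ge0 ltW.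
case: sub => sub.
  rewrite -[X in X < _]sf1; apply: sub => //; rewrite /= ?in_itv/= ?lexx//; last by rewrite sp1.
  by rewrite ltW.
have v'0 : 0 < m^-1 * v by rewrite mulr_gt0 ?invr_gt0.
have v'E : (if alpha < n%:R then m^-1 * v else v) > 0 by case: ifP.
have mV : 0 < m^-1 by rewrite invr_gt0.
have mV1 : m^-1 < 1 by rewrite invf_lt1.
have spV : scale_point alpha m^-1 (scale_point alpha m x) = x.
  rewrite /scale_point; case: (alpha < n%:R); rewrite scalerA.
    rewrite -powRM ?(ltW m0) ?(ltW mV)// mulVf ?gt_eqF// powR1 scale1r//.
  by rewrite mulVf ?gt_eqF// scale1r.
have := sub _ _ spO v'E m^-1 1; rewrite /= !in_itv/= mV (ltW mV1) ltr01 lexx.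
rewrite spV sp1 => /(_ isT isT xO spO mV1); rewrite sf1 /scale_fun spV.
case: (alpha < n%:R).
  rewrite invrK mulrA mulfV ?gt_eqF// mul1r.
  rewrite -(powR_inv1 (ltW m0)) -powRrM mulN1r powRN mulrC ltr_pdivrMr ?powR_gt0//.
  by rewrite mulrC.
by rewrite exprVn mulrC ltr_pdivrMr ?exprn_gt0// mulrC.
Qed.

(** The inversion of [y] is a dilation of [y] with a ratio larger than [1];
  subcriticality therefore makes the Kelvin transform of a solution a strict
  supersolution. *)
Lemma subcritical_kelvin : subcritical alpha r f ->
  forall lam (y : 'rV[R]_n) v, annulus r lam y -> 0 < v ->
  f y (kelvin alpha lam y * v) <
  (lam / enorm y) `^ (n%:R + alpha) * f (inversion lam y) v.
Proof.
have R0 := r0.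
move=> sub lam y v /andP[ry yl] v0.
have y0 : 0 < enorm y by lra.
have ly1 : 1 < lam / enorm y by rewrite ltr_pdivlMr// mul1r.
have ly0 : 0 < lam / enorm y by lra.
have invE : inversion lam y = (lam / enorm y) ^+ 2 *: y.
  by rewrite /inversion expr_div_n.
have /orP[/eqP an|an] : (alpha == n%:R) || (alpha < n%:R).
- by rewrite -le_eqVlt alpha_le_n.
- rewrite /kelvin an subrr powRr0 mul1r invE.
  have := subcritical_dilation sub ry v0 (m := (lam / enorm y) ^+ 2).
  rewrite exprn_egt1// => /(_ isT).
  rewrite /scale_fun /scale_point an ltxx -exprM -powR_mulrn ?(ltW ly0)//.
  by rewrite mul2n -addnn natrD.
have na : 0 < n%:R - alpha by rewrite subr_gt0.
have kv0 : 0 < kelvin alpha lam y * v by rewrite mulr_gt0// powR_gt0.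
have := subcritical_dilation sub ry kv0 (m := (lam / enorm y) `^ (n%:R - alpha)).
have -> : 1 < (lam / enorm y) `^ (n%:R - alpha).
  rewrite [X in X < _](_ : _ = 1 `^ (n%:R - alpha)); last by rewrite powR1.
  by rewrite gt0_ltr_powR ?nnegrE ?ler01 ?(ltW ly0).
rewrite /scale_fun /scale_point an -!powRrM invE -powR_mulrn ?(ltW ly0)// => /(_ isT).
rewrite /kelvin mulKf ?gt_eqF ?powR_gt0//.
have -> : (n%:R - alpha) * ((n%:R + alpha) / (n%:R - alpha)) = n%:R + alpha.
  by field; rewrite gt_eqF.
have -> : (n%:R - alpha) * (2 / (n%:R - alpha)) = 2.
  by field; rewrite gt_eqF.
by [].
Qed.

End nonlinearity.

(** * Continuity and compactness *)

Section topology.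
Context {R : realType} {n : nat}.
Implicit Types (x y : 'rV[R]_n) (a b r lam : R).

Lemma enorm_continuous : continuous (@enorm R n).
Proof.
move=> x; rewrite /enorm.
apply: (@continuous_comp _ _ _ (fun x : 'rV[R]_n => \sum_i x ord0 i ^+ 2) Num.sqrt).
  have sqc i : continuous (fun x : 'rV[R]_n => x ord0 i ^+ 2).
    move=> y.
    apply: (@continuous_comp _ _ _ (fun x : 'rV[R]_n => x ord0 i) (fun z => z ^+ 2)).
      exact: coord_continuous.
    exact: exprn_continuous.
  apply: continuous_big => //; exact: add_continuous.
exact: sqrt_continuous.
Qed.

Lemma near_enorm_lt x a : enorm x < a -> \forall y \near x, enorm y < a.
Proof. by move=> xa; have /cvgr_lt/(_ _ xa) := @enorm_continuous x. Qed.

Lemma near_enorm_gt x a : a < enorm x -> \forall y \near x, a < enorm y.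
Proof. by move=> xa; have /cvgr_gt/(_ _ xa) := @enorm_continuous x. Qed.

Lemma Omega_near r x : Omega r x -> \forall y \near x, Omega r y.
Proof. exact: near_enorm_gt. Qed.

Lemma closed_shell a b : closed [set x : 'rV[R]_n | a <= enorm x <= b].
Proof.
rewrite (_ : [set _ | _] = @enorm R n @^-1` `[a, b]%classic).
  apply: closed_comp; last exact: interval_closed.
  by move=> x _; exact: enorm_continuous.
by apply/seteqP; split => x; rewrite /= in_itv.
Qed.

Lemma compact_shell a b : compact [set x : 'rV[R]_n | a <= enorm x <= b].
Proof.
apply: (subclosed_compact (@closed_shell a b)
  (B := [set v : 'rV[R]_n | forall i, `[- b, b]%classic (v ord0 i)])).
  by apply: (@rV_compact R n (fun=> `[- b, b]%classic)) => i; exact: segment_compact.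
move=> x /andP[_ xb] i; rewrite /= in_itv/= -ler_norml (le_trans _ xb)//.
exact: coord_le_enorm.
Qed.

Lemma closure_Omega r x : 0 < r -> closure (@Omega R n r) x <-> r <= enorm x.
Proof.
move=> r0; split.
  move=> xc; rewrite leNgt; apply/negP => xr.
  by have [y [yO yr]] := xc _ (near_enorm_lt xr); move: yO; rewrite /Omega /= ltNge (ltW yr).
rewrite le_eqVlt => /orP[/eqP rx|rx]; last first.
  by apply: subset_closure.
move=> B xB.
have cv : (fun t : R => t *: x) @ (1 : R)^'+ --> x.
  apply: cvg_at_right_filter; rewrite -[X in _ --> X]scale1r.
  by apply: cvgZr_tmp; exact: cvg_id.
have [t [tB t1]] : exists t, B (t *: x) /\ 1 < t.
  have /filter_ex[t []] : \forall t \near (1 : R)^'+, B (t *: x) /\ 1 < t.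
    by near=> t; split; near: t; [exact: cv|exact: nbhs_right_gt].
  by exists t.
exists (t *: x); split => //.
rewrite /Omega /= enormZ gtr0_norm; last lra.
by rewrite -rx ltr_pMl.
Unshelve. all: by end_near. Qed.

Lemma positive_annulus r lam x : (0 < n)%N -> annulus r lam x ->
  (0 < lebesgue_rV R n (annulus r lam))%E.
Proof.
move=> n0 /andP[rx xl].
have : \forall y \near x, r < enorm y < lam.
  near=> y; apply/andP; split; near: y; [exact: near_enorm_gt|exact: near_enorm_lt].
move=> /nbhs_ballP[e /= e0 he].
apply: (@lt_le_trans _ _ (lebesgue_rV R n (cube x e))).
  by rewrite lebesgue_cube ?(ltW e0)// lte_fin exprn_gt0// mulr_gt0.
apply: (@le_measure _ _ _ (lebesgue_rV R n)); rewrite ?inE.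
- exact: measurable_cube.
- exact: measurable_annulus.
- move=> y yc; apply: he; split => // i j; rewrite (ord1 i) /ball /=.
  have := yc j; rewrite /= in_itv/= => /andP[h1 h2].
  by rewrite ltr_norml; apply/andP; split; lra.
Unshelve. all: by end_near. Qed.

Lemma powR_continuous (p a : R) : 0 < a -> {for a, continuous (fun z => z `^ p)}.
Proof.
move=> a0; apply: differentiable_continuous; apply/derivable1_diffP.
by apply: derivable_powR; rewrite in_itv/= a0.
Qed.

Lemma inversion_continuous lam x : x != 0 ->
  (fun p : R * 'rV[R]_n => inversion p.1 p.2) @ (lam, x) --> inversion lam x.
Proof.
move=> x0; rewrite /inversion; apply: cvgZ; last exact: cvg_snd.
have sqr_cont : continuous (fun z : R => z ^+ 2) by exact: exprn_continuous.
apply: cvgM.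
  by apply: (continuous_cvg _ (sqr_cont lam)); exact: cvg_fst.
apply: cvgV; first by rewrite expf_neq0// enorm_eq0.
apply: (continuous_cvg _ (sqr_cont (enorm x))).
by apply: (continuous_cvg _ (@enorm_continuous x)); exact: cvg_snd.
Qed.

Lemma kelvin_continuous (alpha : R) lam x : 0 < lam -> x != 0 ->
  (fun p : R * 'rV[R]_n => kelvin alpha p.1 p.2) @ (lam, x) --> kelvin alpha lam x.
Proof.
move=> l0 x0; rewrite /kelvin.
have lx : 0 < lam / enorm x by rewrite divr_gt0 ?enorm_gt0.
have cvgq : (fun p : R * 'rV[R]_n => p.1 / enorm p.2) @ (lam, x) --> lam / enorm x.
  apply: cvgM; first exact: cvg_fst.
  apply: cvgV; first by rewrite enorm_eq0.
  by apply: (continuous_cvg _ (@enorm_continuous x)); exact: cvg_snd.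
exact: (continuous_cvg _ (@powR_continuous (n%:R - alpha) _ lx) cvgq).
Qed.

End topology.

(** * Solutions with a Borel source *)

Section null_sets.
Context {R : realType} {n : nat}.
Local Notation RB := (measurableTypeR R).
Local Notation V := 'rV[RB]_n.
Local Notation mu := (lebesgue_rV R n).

(** Inversion preserves null sets because its Jacobian is positive. *)
Lemma ae_inversion (lam : R) (P : V -> Prop) : (0 < n)%N -> 0 < lam ->
  {ae mu, forall y, P y} ->
  {ae mu, forall y : V, (y : 'rV[R]_n) != 0 -> P (inversion lam y)}.
Proof.
move=> n0 l0 [N [mN N0 PN]].
have mI : measurable ((fun y : V => inversion lam y : V) @^-1` N).
  by apply: measurable_preimage mN; exact: measurable_inversion.
have mJ D : measurable_fun D (fun y : V => (inversion_jacobian lam y)%:E).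
  apply/measurable_EFinP; apply: measurable_funTS.
  exact: measurable_inversion_jacobian.
have J0 : (\int[mu]_(y in (fun y : V => inversion lam y : V) @^-1` N)
    `|(inversion_jacobian lam y)%:E| = 0)%E.
  have := lebesgue_inversion n0 l0 mN; rewrite N0 inverted_lebesgueE => <-.
  by apply: eq_integral => y _; rewrite gee0_abs// lee_fin inversion_jacobian_ge0.
have [N' [mN' N'0 JN']] := (proj1 (ae_eq_integral_abs mu mI (mJ _)) J0).
exists N'; split => // y Py; apply: JN' => /= Jy; apply: Py => y0.
apply: contrapT => Piy; have : N (inversion lam y) by exact: PN.
move=> /Jy [] /eqP; rewrite expf_eq0 mulf_eq0 invr_eq0 enorm_eq0 (negbTE y0).
by rewrite (gt_eqF l0) andbF.
Qed.

End null_sets.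

(** The composition of the nonlinearity with [u] agrees with a Borel function only
  almost everywhere on the domain. The integral equation does not see the
  difference and holds with a source [h] that is Borel and nonnegative on the
  whole space. *)
Record borel_solution (R : realType) (n : nat) (alpha r : R)
    (f : 'rV[R]_n -> R -> R) (u : 'rV[R]_n -> R)
    (h : 'rV[measurableTypeR R]_n -> R) : Prop := BorelSolution {
  source_measurable : measurable_fun setT h ;
  source_ge0 : forall y, 0 <= h y ;
  sourceE : {ae lebesgue_rV R n, forall y, Omega r y -> h y = f y (u y)} ;
  solution_ge0 : forall x, r <= enorm x -> 0 <= u x ;
  solution_continuous : forall x, r <= enorm x ->
    u @ within [set y : 'rV[R]_n | r <= enorm y] (nbhs x) --> u x ;
  solutionE : forall x, r <= enorm x -> (u x)%:E =
    (\int[lebesgue_rV R n]_(y in @Omega R n r) (green alpha r x y * h y)%:E)%E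
}.

Lemma green_ge0 (R : realType) (n : nat) (alpha r : R) (x y : 'rV[R]_n) :
  0 < r -> 0 <= green alpha r x y.
Proof.
move=> r0; have [xO|xO] := boolP (r < enorm x); last by rewrite /green (negbTE xO).
have [yO|yO] := boolP (r < enorm y); last by rewrite /green (negbTE yO) andbF.
by rewrite greenE// mulr_ge0 ?green_cst_ge0// kern_ge0.
Qed.

Lemma nonneg_solution_borel (R : realType) (n : nat) (alpha r : R)
    (f : 'rV[R]_n -> R -> R) (u : 'rV[R]_n -> R) : 0 < r ->
  (forall x v, Omega r x -> 0 <= v -> 0 <= f x v) ->
  nonneg_solution alpha r f u -> exists h, borel_solution alpha r f u h.
Proof.
move=> r0 f0 [uc u0 [h0 mh0 [N [mN N0 hN]]] uE].
have clE (x : 'rV[R]_n) : r <= enorm x -> closure (@Omega R n r) x.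
  by move=> rx; apply/closure_Omega.
have mO := @measurable_Omega R n r.
pose D := @Omega R n r `\` N.
have hD y : D y -> f y (u y) = h0 y.
  by move=> [yO yN]; apply: contrapT => h; apply: yN; apply: hN => /= /(_ yO).
have uge0 x : r <= enorm x -> 0 <= u x by move=> /clE; exact: u0.
have Our (y : 'rV[R]_n) : Omega r y -> r <= enorm y by move=> /ltW.
pose h := h0 \_ D.
have hE y : D y -> h y = f y (u y) by move=> Dy; rewrite /h patchE mem_set// hD.
have hge0 y : 0 <= h y.
  rewrite /h patchE; case: ifPn => // /set_mem Dy.
  by rewrite -hD//; case: Dy => yO _; apply: f0 => //; exact/uge0/Our.
exists h; split => //.
- apply: (iffLR (measurable_restrictT _ _)); first exact: measurableD.
  by apply: measurable_funS mh0 => // y [].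
- exists N; split => // y hy; apply: contrapT => yN; apply: hy => yO.
  exact: hE.
- move=> x rx; move: uc => /subspace_continuousP /(_ x (clE x rx)).
  rewrite (_ : closure _ = [set y : 'rV[R]_n | r <= enorm y])//.
  by apply/seteqP; split => y /=; rewrite closure_Omega.
- move=> x rx; rewrite uE; last exact: clE.
  apply: nneg_integral_eq_off_null mN N0 _ _ _ => y yO.
  + by rewrite lee_fin mulr_ge0 ?green_ge0//; apply: f0 => //; exact/uge0/Our.
  + by rewrite lee_fin mulr_ge0 ?green_ge0.
  + by move=> yN; rewrite hE.
Qed.

Section borel_solutions.
Context {R : realType}.
Variables (n : nat) (alpha r : R) (f : 'rV[R]_n -> R -> R).
Variables (u : 'rV[R]_n -> R) (h : 'rV[measurableTypeR R]_n -> R).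
Hypotheses (n2 : (2 <= n)%N) (al0 : 0 < alpha) (al2 : alpha <= 2) (r0 : 0 < r).
Hypothesis sol : borel_solution alpha r f u h.
Hypothesis C0 : 0 < green_cst n alpha.
Local Notation mu := (lebesgue_rV R n).

Let n0 : (0 < n)%N. Proof. exact: leq_trans n2. Qed.

Lemma OmegaW (y : 'rV[R]_n) : Omega r y -> r <= enorm y.
Proof. by move=> /ltW. Qed.

Lemma measurable_green_source x : Omega r x ->
  measurable_fun (@Omega R n r : set 'rV[measurableTypeR R]_n)
    (fun y => green alpha r x y * h y).
Proof.
move=> xO.
have mk : measurable_fun (@Omega R n r : set 'rV[measurableTypeR R]_n)
    (fun y : 'rV[measurableTypeR R]_n => green_cst n alpha *
    kern n alpha (enorm (x - y : 'rV[R]_n) ^+ 2) (defect r x * defect r y / r ^+ 2) * h y).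
  apply: measurable_funTS; apply: measurable_funM; last exact: source_measurable sol.
  by apply: measurable_kern_dist => //; exact: measurable_defect.
apply: eq_measurable_fun mk => y /set_mem yO; by rewrite greenE.
Qed.

(** A solution vanishing at one point has a vanishing source, because the
  Green's function is positive. *)
Lemma solution_positive x : Omega r x ->
  (exists2 z, r <= enorm z & u z != 0) -> 0 < u x.
Proof.
move=> xO [z zr uz]; rewrite lt_def (solution_ge0 sol) ?OmegaW// andbT.
apply: contra_neq uz => ux.
have mO := @measurable_Omega R n r.
have := solutionE sol (OmegaW xO); rewrite ux => /esym I0.
have Gh0 w y : 0 <= green alpha r w y * h y.
  by rewrite mulr_ge0 ?green_ge0 ?(source_ge0 sol).
have mGh : measurable_fun (@Omega R n r : set 'rV[measurableTypeR R]_n)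
    (fun y => (green alpha r x y * h y)%:E).
  by apply/measurable_EFinP; exact: measurable_green_source.
have {}I0 : (\int[mu]_(y in @Omega R n r) `|(green alpha r x y * h y)%:E| = 0)%E.
  by rewrite -[RHS]I0; apply: eq_integral => y _; rewrite gee0_abs// lee_fin.
have [N [mN N0 GN]] := proj1 (ae_eq_integral_abs mu mO mGh) I0.
apply: EFin_inj; rewrite (solutionE sol zr).
rewrite (@nneg_integral_eq_off_null _ _ _ _ _ (N `|` [set x]) _ (cst 0%E)).
- by rewrite integral0.
- by apply: measurableU => //; exact: measurable_point.
- apply/eqP; rewrite -measure_le0 -[leRHS]N0.
  apply: le_measure_null (lebesgue_point x n0) _ => //; last exact: measurable_point.
  by apply: measurableU => //; exact: measurable_point.
- by move=> y _; rewrite lee_fin.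
- by [].
- move=> y yO /not_orP[yN yx] /=; congr EFin.
  suff -> : h y = 0 by rewrite mulr0.
  have : green alpha r x y * h y = 0.
    by apply: contrapT => H; apply: yN; apply: GN => /= /(_ yO) [].
  move/eqP; rewrite mulf_eq0 => /orP[|/eqP//].
  rewrite greenE// mulf_eq0 gt_eqF//= gt_eqF//.
  apply: kern_gt0 => //; last by rewrite divr_gt0 ?mulr_gt0 ?exprn_gt0// defect_gt0.
  by rewrite exprn_gt0// enorm_gt0 subr_eq0; apply/eqP => xy; apply: yx.
Qed.

End borel_solutions.

(** * A solution and its reflections *)

Section reflections.
Context {R : realType}.
Variables (n : nat) (alpha r : R) (f : 'rV[R]_n -> R -> R).
Variables (u : 'rV[R]_n -> R) (h : 'rV[measurableTypeR R]_n -> R).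
Hypotheses (n2 : (2 <= n)%N) (al0 : 0 < alpha) (al2 : alpha <= 2) (r0 : 0 < r).
Hypotheses (sub_f : subcritical alpha r f) (f1_f : f1 r f).
Hypothesis sol : borel_solution alpha r f u h.
Hypothesis C0 : 0 < green_cst n alpha.
Hypothesis u_gt0 : forall x, Omega r x -> 0 < u x.
Local Notation mu := (lebesgue_rV R n).
Local Notation V := 'rV[measurableTypeR R]_n.
Local Notation kelv := (kelvin alpha).

Let n0 : (0 < n)%N. Proof. exact: leq_trans n2. Qed.

Definition reflected (lam : R) (x : 'rV[R]_n) : R :=
  kelv lam x * u (inversion lam x).

Definition below_reflection (lam : R) := forall x : 'rV[R]_n,
  annulus r lam x -> u x <= reflected lam x.

Lemma annulusW lam (y : 'rV[R]_n) : annulus r lam y ->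
  [/\ Omega r y, 0 < lam, y != 0 & Omega r (inversion lam y)].
Proof.
move=> yA; have /andP[ry yl] := yA.
have [yO y0 iO] := annulus_inversion_Omega r0 ry yl yA.
by split => //; exact: lt_trans (lt_trans r0 ry) yl.
Qed.

Lemma reflected_gt0 lam y : annulus r lam y -> 0 < reflected lam y.
Proof.
by move=> yA; have [yO l0 y0 iO] := annulusW yA; rewrite mulr_gt0 ?kelvin_gt0// u_gt0.
Qed.

Lemma ae_source_inversion lam : 0 < lam -> {ae mu, forall y, annulus r lam y ->
  h y = f y (u y) /\
  kelvin_source alpha lam h y =
  (lam / enorm y) `^ (n%:R + alpha) * f (inversion lam y) (u (inversion lam y))}.
Proof.
move=> l0; have hE := sourceE sol; have hI := ae_inversion n0 l0 hE.
have aeF := ae_filter_ringOfSetsType mu.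
apply: filterS2 hE hI => y hy hiy yA; have [yO _ y0 iO] := annulusW yA.
by split; [exact: hy|rewrite /kelvin_source hiy].
Qed.

Lemma subcritical_source lam y : annulus r lam y ->
  f y (reflected lam y) <
  (lam / enorm y) `^ (n%:R + alpha) * f (inversion lam y) (u (inversion lam y)).
Proof.
move=> yA; have [yO l0 y0 iO] := annulusW yA.
exact: (subcritical_kelvin n2 al2 r0 sub_f yA (u_gt0 iO)).
Qed.

(** The two potentials in [kelvin_comparison] are [u x] and, up to the Kelvin
  factor, the value of [u] at the inversion of [x]. *)
Lemma solution_comparison lam x (E : V -> R) : annulus r lam x ->
  measurable_fun setT E -> (forall y, 0 <= E y) ->
  {ae mu, forall y, annulus r lam y -> h y <= kelvin_source alpha lam h y + E y} ->
  ((u x)%:E + \int[mu]_(y in annulus r lam) (kelvin_gap alpha r lam x h y)%:E <=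
   (reflected lam x)%:E +
   \int[mu]_(y in annulus r lam) (reflected_green alpha r lam x y * E y)%:E)%E.
Proof.
move=> xA mE E0 hE; have [xO l0 x0 iO] := annulusW xA.
have /andP[rx xl] := xA.
have := kelvin_comparison n2 al0 al2 r0 rx xl (source_measurable sol)
  (source_ge0 sol) mE E0 hE.
rewrite [X in (X + _ <= _)%E](esym (solutionE sol (OmegaW xO))).
by rewrite [X in (_ <= _ * X + _)%E](esym (solutionE sol (OmegaW iO))) -EFinM.
Qed.

(** If equality held at one point, [kelvin_gap] would vanish almost everywhere on
  the annulus; but both of its factors are positive, by the strict monotonicity
  of the kernel and by strict subcriticality. *)
Lemma strictly_below lam : below_reflection lam -> forall x, annulus r lam x ->
  u x < reflected lam x.
Proof.
move=> bel x xA; have [xO l0 x0 iO] := annulusW xA.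
have /andP[rx xl] := xA.
have gap : {ae mu, forall y, annulus r lam y -> h y < kelvin_source alpha lam h y}.
  apply: filterS (ae_source_inversion l0) => y hy yA; have [-> ->] := hy yA.
  have [yO _ _ _] := annulusW yA.
  apply: le_lt_trans (subcritical_source yA); apply: f1_f => //.
    exact/ltW/u_gt0.
  exact: bel.
have mA := @measurable_annulus R n r lam.
have mG : measurable_fun (annulus r lam)
    (fun y : V => (kelvin_gap alpha r lam x h y)%:E).
  apply/measurable_EFinP; apply: measurable_funTS.
  exact: (measurable_kelvin_gap n2 al0 al2 r0 rx xl (source_measurable sol)).
have G0 y : (0 <= (kelvin_gap alpha r lam x h y)%:E)%E.
  by rewrite lee_fin kelvin_gap_ge0.
rewrite lt_neqAle bel// andbT; apply/eqP => ux.
have mc : measurable_fun setT (cst 0 : V -> R) by [].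
have := solution_comparison xA mc (fun=> lexx _).
rewrite (_ : (\int[mu]_(y in _) (_ * cst 0 y)%:E = 0)%E); last first.
  by apply: integral0_eq => y _; rewrite mulr0.
rewrite adde0 -ux -[leRHS]adde0 leeD2lE// => H.
have {}H : (\int[mu]_(y in annulus r lam) `|(kelvin_gap alpha r lam x h y)%:E| = 0)%E.
  under eq_integral do rewrite gee0_abs//.
  apply: le_anti; rewrite integral_ge0// andbT; apply: H.
  by apply: filterS gap => y hy yA; rewrite addr0 ltW// hy.
have [N [mN N0 GN]] := proj1 (ae_eq_integral_abs mu mA mG) H.
have [N' [mN' N'0 gN']] := gap.
have := positive_annulus n0 xA; rewrite lt_neqAle => /andP[/eqP + _]; apply.
apply/esym/eqP; rewrite -measure_le0.
have NN' : mu (N `|` N') = 0%E.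
  apply/eqP; rewrite -measure_le0 -[leRHS]N0.
  by apply: le_measure_null N'0 _ => //; exact: measurableU.
apply: (@le_trans _ _ (mu (N `|` N'))); last by rewrite NN'.
apply: (le_measure_null (N := [set x : V])) => //.
- exact: measurableU.
- exact: measurable_point.
- exact: lebesgue_point.
move=> y yA; have [->|yx] := eqVneq y x; first by right.
left; apply: contrapT => /not_orP[yN yN'].
have hy : h y < kelvin_source alpha lam h y.
  by apply: contrapT => hy; apply: yN'; apply: gN' => /= /(_ yA).
have [_ /(_ C0) mg _] := four_greens n2 al0 al2 r0 rx xl yA yx.
apply: yN; apply: GN => /= /(_ yA) [] /eqP.
rewrite /kelvin_gap !max_r ?subr_ge0 ?ltW// mulf_eq0 !subr_eq0.
by rewrite (gt_eqF mg) (gt_eqF hy).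
Qed.

Lemma solution_bounded Lam : exists2 M, 0 <= M & forall x : 'rV[R]_n,
  r <= enorm x -> enorm x <= Lam -> u x <= M.
Proof.
have /compact_near_coveringP cov := @compact_shell R n r Lam.
have := cov R (+oo : set_system R) (fun M x => r <= enorm x -> u x <= M) _ _.
case.
  move=> x /andP[rx xL].
  have h1 : \forall x' \near x, r <= enorm x' -> u x' < u x + 1.
    have /cvgr_lt H := solution_continuous sol rx.
    have u1 : u x < u x + 1 by rewrite ltrDl.
    exact: H u1.
  have h2 : \forall M \near +oo, u x + 1 < M by apply: nbhs_pinfty_gt; exact: num_real.
  exists ([set x' | r <= enorm x' -> u x' < u x + 1], [set M | u x + 1 < M]) => //.
  move=> [x' M] [/= hx hM] rx'; apply: ltW; exact: lt_trans (hx rx') hM.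
move=> M0 [_ hM]; exists (Num.max 0 (M0 + 1)); first by rewrite le_max lexx.
move=> x rx xL; rewrite le_max; apply/orP; right.
by apply: hM => //=; [rewrite ltrDl|rewrite rx].
Qed.

End reflections.

(** * The narrow region principle *)

Section narrow.
Context {R : realType}.
Variables (n : nat) (alpha r : R) (f : 'rV[R]_n -> R -> R).
Variables (u : 'rV[R]_n -> R) (h : 'rV[measurableTypeR R]_n -> R).
Hypotheses (n2 : (2 <= n)%N) (al0 : 0 < alpha) (al2 : alpha <= 2) (r0 : 0 < r).
Hypotheses (sub_f : subcritical alpha r f) (f1_f : f1 r f) (f2_f : f2 alpha r f).
Hypothesis sol : borel_solution alpha r f u h.
Hypothesis C0 : 0 < green_cst n alpha.
Hypothesis u_gt0 : forall x, Omega r x -> 0 < u x.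
Local Notation mu := (lebesgue_rV R n).
Local Notation V := 'rV[measurableTypeR R]_n.

Let n0 : (0 < n)%N. Proof. exact: leq_trans n2. Qed.

(** Bounding the smaller base by the larger one suffices. *)
Lemma young_powR (a b be : R) : 0 <= a -> 0 <= b ->
  0 < be -> be < 1 -> a `^ (1 - be) * b `^ be <= a + b.
Proof.
move=> a0 b0 be0 be1; have b1 : 0 < 1 - be by lra.
wlog ab : a b be a0 b0 be0 be1 b1 / a <= b.
  move=> W; have [|ba] := leP a b; first exact: W.
  have beE : 1 - (1 - be) = be by ring.
  have H := W b a (1 - be) b0 a0 b1; rewrite beE in H.
  by rewrite [leLHS]mulrC [leRHS]addrC; apply: H => //; [rewrite gtrBl|exact: ltW].
apply: (@le_trans _ _ (b `^ (1 - be) * b `^ be)).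
  by rewrite ler_wpM2r ?powR_ge0// ge0_ler_powR ?nnegrE ?(ltW b1).
rewrite -powRD; last by rewrite subrK oner_eq0.
by rewrite subrK powRr1// lerDr.
Qed.

(** The codefects are bounded by [Lam ^+ 2]. *)
Lemma reflected_green_le Lam gam : 0 < gam -> gam < alpha / 2 ->
  exists2 B, 0 <= B & forall lam (x y : 'rV[R]_n), lam <= Lam ->
    annulus r lam x -> annulus r lam y ->
    reflected_green alpha r lam x y <=
    B * enorm (x - y) `^ (- (n%:R - 2 * gam)).
Proof.
move=> g0 ga; have [C1 C10 hC] := kern_le n2 al0 al2 g0 ga.
exists (green_cst n alpha * (C1 * (Lam ^+ 2 * Lam ^+ 2 / r ^+ 2) `^ (alpha / 2 - gam))).
  by rewrite mulr_ge0 ?(ltW C0)// mulr_ge0 ?powR_ge0.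
move=> lam x y lL xA yA; rewrite /reflected_green -[leRHS]mulrA ler_wpM2l ?(ltW C0)//.
have cod (z : 'rV[R]_n) : annulus r lam z -> 0 <= codefect r lam z <= Lam ^+ 2.
  move=> zA; have [zO l0 z0 iO] := annulusW r0 zA; have /andP[rz zl] := zA.
  have [d1 d2] := codefect_gt_defect r0 rz zl zA.
  rewrite (ltW (lt_trans d1 d2))/=; apply: (@le_trans _ _ (lam ^+ 2)).
    rewrite /codefect gerBl; apply: divr_ge0; last exact: sqr_ge0.
    by apply: mulr_ge0; exact: sqr_ge0.
  by rewrite lerXn2r ?nnegrE ?(ltW l0) ?(le_trans (ltW l0) lL).
have /andP[cx0 cxL] := cod x xA; have /andP[cy0 cyL] := cod y yA.
have r2 : 0 < r ^+ 2 by rewrite exprn_gt0.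
apply: le_trans (hC _ _ (sqr_ge0 _) _) _.
  by apply: divr_ge0; [exact: mulr_ge0|exact: ltW].
have -> : (enorm (x - y) ^+ 2) `^ (- (n%:R / 2 - gam)) =
    enorm (x - y) `^ (- (n%:R - 2 * gam)).
  by rewrite -powR_mulrn ?enorm_ge0// -powRrM; congr (_ `^ _); lra.
rewrite ler_wpM2r ?powR_ge0// ler_wpM2l// ge0_ler_powR ?nnegrE ?subr_ge0 ?(ltW ga)//.
- by apply: divr_ge0; [exact: mulr_ge0|exact: ltW].
- by apply: divr_ge0; [apply: mulr_ge0; exact: sqr_ge0|exact: ltW].
- by rewrite ler_pM2r ?invr_gt0// ler_pM.
Qed.

(** Since [theta < alpha / n], Young's inequality splits the product of the two
  singularities into singularities that are both locally integrable. *)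
Lemma singular_product theta : 0 < theta -> theta < alpha / n%:R ->
  exists gam s1 s2, [/\ 0 < gam, gam < alpha / 2, 0 < s1, s1 < n%:R & 0 < s2] /\
    [/\ s2 < 1 & forall d w : R, 0 <= d -> 0 <= w ->
      d `^ (- (n%:R - 2 * gam)) * w `^ (- theta) <= d `^ (- s1) + w `^ (- s2)].
Proof.
move=> t0 ta; have A0 := al0; have A2 := al2.
have nR : 2 <= n%:R :> R by rewrite ler_nat.
have nR0 : 0 < n%:R :> R by lra.
pose q := alpha / n%:R; have q1 : q <= 1 by rewrite /q ler_pdivrMr// mul1r; lra.
have nq : n%:R * q = alpha by rewrite /q mulrC divfK// gt_eqF.
(* [be] lies strictly between [theta] and [alpha / n]; the first inequality makes
   the boundary exponent [theta / be] less than 1, the second leaves room for a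
   [gam] below [alpha / 2] with diagonal exponent less than [n] *)
pose be := (theta + q) / 2; pose gam := (n%:R * be + alpha) / 4.
have qt : theta < q by [].
have be_t : theta < be by rewrite /be; lra.
have be_q : be < q by rewrite /be; lra.
have be0 : 0 < be by lra.
have be1 : 0 < 1 - be by lra.
have nbe : n%:R * be < alpha by rewrite -nq ltr_pM2l.
have nbe0 : 0 < n%:R * be by rewrite mulr_gt0.
have gp : 0 < gam by rewrite /gam; lra.
have ga : gam < alpha / 2 by rewrite /gam; lra.
have ng : 0 < n%:R - 2 * gam by lra.
exists gam, ((n%:R - 2 * gam) / (1 - be)), (theta / be); split; split => //.
- by rewrite divr_gt0.
- by rewrite ltr_pdivrMr// mulrBr mulr1 ler_ltB// /gam; lra.
- by rewrite divr_gt0.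
- by rewrite ltr_pdivrMr// mul1r.
move=> d w d0 w0.
have := @young_powR (d `^ (- ((n%:R - 2 * gam) / (1 - be)))) (w `^ (- (theta / be))) be
  (powR_ge0 _ _) (powR_ge0 _ _) be0 ltac:(lra).
rewrite -!powRrM.
have -> : - ((n%:R - 2 * gam) / (1 - be)) * (1 - be) = - (n%:R - 2 * gam).
  by rewrite mulNr divfK ?gt_eqF.
by have -> : - (theta / be) * be = - theta by rewrite mulNr divfK ?gt_eqF.
Qed.

(** If [S] bounds [u - reflected alpha u lam], then [solution_comparison] gives the
  better bound [S / 2]: only the shell between [t] and [lam] contributes, there
  the sources differ by at most the Lipschitz bound times [S], and the shell is
  so thin that the integral of the singular weight is small. Iterating, the
  difference is at most [0]. *)
Lemma narrow_region Lam : r < Lam -> exists2 delta, 0 < delta &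
  forall lam t, r < lam -> lam <= Lam -> r <= t -> t < lam -> lam - t <= delta ->
  (forall x : 'rV[R]_n, annulus r lam x -> enorm x <= t -> u x <= reflected alpha u lam x) ->
  below_reflection alpha r u lam.
Proof.
move=> rL; have [M M0 hM] := solution_bounded sol Lam.
have [theta [L [t0 ta L0 hL]]] := lipschitz_bound n2 al0 r0 f2_f rL M0.
have [gam [s1 [s2 [[g0 ga s10 s1n s20] [s21 hyoung]]]]] := singular_product t0 ta.
have [B B0 hB] := reflected_green_le Lam g0 ga.
have BL0 : 0 <= B * L by rewrite mulr_ge0.
(* chosen so that [B * L * eta <= 1 / 2] *)
pose eta := ((B * L + 1) * 2)^-1.
have eta0 : 0 < eta by rewrite invr_gt0; lra.
have [delta d0 hd] := integral_thin_shell n0 r0 rL s10 s1n s20 s21 eta0.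
exists delta => // lam t rl lL rt tl ltd hin.
have l0 : 0 < lam by have := r0; lra.
pose shell : set V := sector t lam setT.
have mshell : measurable shell by exact: measurable_sector.
have mA := @measurable_annulus R n r lam.
have step S : 0 <= S ->
    (forall x, annulus r lam x -> u x - reflected alpha u lam x <= S) ->
    (forall x, annulus r lam x -> u x - reflected alpha u lam x <= S / 2).
  move=> S0 hS x xA.
  have [xO _ x0 iO] := annulusW r0 xA.
  pose E (y : V) := L * S * (`|enorm (y : 'rV[R]_n) - r| `^ (- theta) * \1_shell y).
  have LS0 : 0 <= L * S by rewrite mulr_ge0.
  have mE : measurable_fun setT E.
    apply: measurable_funM => //; apply: measurable_funM; last exact: measurable_indic.
    apply: (measurableT_comp (measurable_powR _)); apply: measurableT_comp => //.
    by apply: measurable_funB => //; exact: measurable_enorm.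
  have E0 y : 0 <= E y by rewrite mulr_ge0 ?mulr_ge0 ?powR_ge0.
  have hE : {ae mu, forall y, annulus r lam y -> h y <= kelvin_source alpha lam h y + E y}.
    have aeF := ae_filter_ringOfSetsType mu.
    apply: filterS (ae_source_inversion n2 r0 sol l0) => y hy yA.
    have [-> ->] := hy yA; have [yO _ y0 yiO] := annulusW r0 yA.
    have /andP[ry yl] := yA.
    have lt1 := subcritical_source n2 al2 r0 sub_f u_gt0 yA.
    have [ur|ru] := leP (u y) (reflected alpha u lam y).
      have := f1_f yO (ltW (u_gt0 yO)) ur.
      have := E0 y; lra.
    have ty : t < enorm y.
      rewrite ltNge; apply/negP => yt; have := hin y yA yt; lra.
    have -> : E y = L * S * (enorm y - r) `^ (- theta).
      rewrite /E indicE mem_set ?mulr1; last by split => //; rewrite ty ltW.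
      by rewrite ger0_norm// subr_ge0 ltW.
    have := hL y (u y) (reflected alpha u lam y) yO _ _ (ltW ru) (hM y (ltW ry) _).
    rewrite (ltW (reflected_gt0 alpha r0 u_gt0 yA)) (le_trans (ltW yl) lL) => /(_ isT isT isT).
    have : L * (enorm y - r) `^ (- theta) * (u y - reflected alpha u lam y) <=
        L * (enorm y - r) `^ (- theta) * S.
      by rewrite ler_wpM2l ?mulr_ge0 ?powR_ge0// hS.
    move: (_ `^ (- theta)) lt1 => w; move: (_ * _) => z; lra.
  have := solution_comparison n2 al0 al2 r0 sol xA mE E0 hE.
  have gap0 : (0 <= \int[mu]_(y in annulus r lam) (kelvin_gap alpha r lam x h y)%:E)%E.
    by apply: integral_ge0 => y _; rewrite lee_fin kelvin_gap_ge0.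
  have int_le : (\int[mu]_(y in annulus r lam)
      (reflected_green alpha r lam x y * E y)%:E <= (S / 2)%:E)%E.
    have mW := measurable_singular_weight r s1 s2 x.
    apply: (@le_trans _ _ (\int[mu]_(y in annulus r lam)
        ((B * L * S) * (singular_weight r s1 s2 x y * \1_shell y))%:E)%E).
      apply: ge0_le_integral => //.
      - by move=> y _; rewrite lee_fin mulr_ge0 ?reflected_green_ge0.
      - apply/measurable_EFinP; apply: measurable_funTS; apply: measurable_funM => //.
        exact: measurable_reflected_green.
      - apply/measurable_EFinP; apply: measurable_funTS; apply: measurable_funM => //.
        by apply: measurable_funM => //; exact: measurable_indic.
      - move=> y yA; rewrite lee_fin /E.
        have i0 : 0 <= \1_shell y :> R by [].
        have := hyoung _ _ (enorm_ge0 (x - y)) (normr_ge0 (enorm y - r)).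
        rewrite -/(singular_weight r s1 s2 x y).
        have := hB lam x y lL xA yA.
        have := powR_ge0 `|enorm y - r| (- theta).
        move: (\1_shell y : R) i0 (reflected_green _ _ _ _ _) (singular_weight _ _ _ _ _).
        move: (`|enorm y - r| `^ (- theta)) (enorm _ `^ _) => w d i i0 g W w0 gd dW.
        apply: (@le_trans _ _ (B * d * (L * S * (w * i)))).
          by rewrite ler_wpM2r// mulr_ge0// mulr_ge0.
        have -> : B * d * (L * S * (w * i)) = B * L * S * i * (d * w) by ring.
        have -> : B * L * S * (W * i) = B * L * S * i * W by ring.
        by rewrite ler_wpM2l// mulr_ge0// mulr_ge0.
    apply: (@le_trans _ _ (\int[mu]_(y in setT)
        ((B * L * S) * (singular_weight r s1 s2 x y * \1_shell y))%:E)%E).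
      apply: ge0_subset_integral => //.
      - apply/measurable_EFinP; apply: measurable_funM => //.
        by apply: measurable_funM => //; exact: measurable_indic.
      - by move=> y _; rewrite lee_fin mulr_ge0 ?mulr_ge0 ?singular_weight_ge0.
    have -> : (\int[mu]_(y in setT)
        ((B * L * S) * (singular_weight r s1 s2 x y * \1_shell y))%:E =
        (B * L * S)%:E * \int[mu]_(y in shell) (singular_weight r s1 s2 x y)%:E)%E.
      under eq_integral do rewrite EFinM.
      rewrite ge0_integralZl//; last 3 first.
      - apply/measurable_EFinP; apply: measurable_funM => //; exact: measurable_indic.
      - by move=> y _; rewrite lee_fin mulr_ge0 ?singular_weight_ge0.
      - by rewrite lee_fin mulr_ge0.
      congr (_ * _)%E; rewrite [RHS]integral_mkcond; apply: eq_integral => y _.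
      by rewrite patchE indicE; case: ifPn => _; rewrite ?mulr1 ?mulr0.
    have := hd x t lam rt (ltW tl) lL ltd; rewrite -/shell => I1.
    apply: le_trans (lee_wpmul2l _ I1) _; first by rewrite lee_fin mulr_ge0.
    rewrite -EFinM lee_fin /eta.
    rewrite ler_pdivrMr; last by lra.
    have -> : S / 2 * ((B * L + 1) * 2) = B * L * S + S by field.
    by rewrite lerDl.
  move=> H; have := le_trans (leeDl (u x)%:E gap0) (le_trans H (leeD2l _ int_le)).
  rewrite -EFinD lee_fin; lra.
have bound k x : annulus r lam x -> u x - reflected alpha u lam x <= M * 2^-1 ^+ k.
  elim: k x => [|k IH] x xA.
    have [xO _ x0 iO] := annulusW r0 xA; have /andP[rx xl] := xA.
    rewrite expr0 mulr1; have := reflected_gt0 alpha r0 u_gt0 xA.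
    have := hM x (ltW rx) (le_trans (ltW xl) lL); lra.
  have := step (M * 2^-1 ^+ k) _ IH x xA.
  by rewrite exprSr mulrA; apply; rewrite mulr_ge0// exprn_ge0.
move=> x xA; rewrite -subr_le0.
have cv : M * 2^-1 ^+ k @[k --> \oo] --> (0 : R).
  by apply: (@cvg_geometric R M 2^-1); rewrite ger0_norm ?invf_lt1 ?ltr1n.
by apply: (cvgr_to_ge cv); apply: nearW => k; exact: bound.
Qed.

End narrow.

(** * Scaling the sphere from the boundary to infinity *)

Section continuation.
Context {R : realType}.
Variables (n : nat) (alpha r : R) (f : 'rV[R]_n -> R -> R).
Variables (u : 'rV[R]_n -> R) (h : 'rV[measurableTypeR R]_n -> R).
Hypotheses (n2 : (2 <= n)%N) (al0 : 0 < alpha) (al2 : alpha <= 2) (r0 : 0 < r).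
Hypotheses (sub_f : subcritical alpha r f) (f1_f : f1 r f) (f2_f : f2 alpha r f).
Hypothesis sol : borel_solution alpha r f u h.
Hypothesis C0 : 0 < green_cst n alpha.
Hypothesis u_gt0 : forall x, Omega r x -> 0 < u x.

Lemma solution_continuous_Omega (x : 'rV[R]_n) : Omega r x -> u @ x --> u x.
Proof.
move=> xO A uA; have H := solution_continuous sol (OmegaW xO) uA.
change (\forall y \near x, A (u y)).
have H' : \forall y \near x, r <= enorm y -> A (u y) by exact: H.
by apply: filterS2 H' (Omega_near xO) => y H1 ry; apply: H1; exact: OmegaW.
Qed.

Lemma solution_boundary (x : 'rV[R]_n) : enorm x = r -> u x = 0.
Proof.
move=> xr; apply: EFin_inj; rewrite (solutionE sol); last by rewrite xr.
by apply: integral0_eq => y _; rewrite /green xr ltxx mul0r.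
Qed.

Lemma reflected_continuous s (x : 'rV[R]_n) : 0 < s -> x != 0 ->
  Omega r (inversion s x) ->
  (fun p : R * 'rV[R]_n => reflected alpha u p.1 p.2) @ (s, x) -->
    reflected alpha u s x.
Proof.
move=> s0 x0 iO; apply: cvgM; first exact: kelvin_continuous.
exact: (continuous_cvg _ (solution_continuous_Omega iO) (@inversion_continuous _ _ s _ x0)).
Qed.

Lemma below_reflection_limit s : r < s ->
  (forall t, r < t -> t < s -> below_reflection alpha r u t) ->
  below_reflection alpha r u s.
Proof.
move=> rs bel x xA; have [xO s0 x0 iO] := annulusW r0 xA; have /andP[rx xs] := xA.
have cv : (fun t : R => reflected alpha u t x) @ s^'- --> reflected alpha u s x.
  apply: cvg_at_left_filter.
  have cvp : (fun t : R => (t, x)) @ s --> (s, x).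
    move=> A [[B C] /= [Bs Cx] BC]; apply: filterS Bs => t Bt.
    exact: (BC (t, x) (conj Bt (nbhs_singleton Cx))).
  exact: (cvg_comp _ _ cvp (reflected_continuous s0 x0 iO)).
apply: (@cvgr_to_ge _ (s^'-) _ R _ _ _ cv); near=> t.
have xt : enorm x < t by near: t; exact: nbhs_left_gt.
apply: bel; last by rewrite /annulus /= rx xt.
  exact: lt_trans xt.
by near: t; exact: nbhs_left_lt.
Unshelve. all: by end_near. Qed.

(** The radius grows from [r], where the whole annulus is narrow. At a radius [s]
  that has been reached, the inequality is strict on the compact shell between
  [r] and [s - delta / 2], hence it persists there for slightly larger radii,
  and the remaining shell is narrow. *)
Lemma below_reflection_all Lam : r < Lam -> below_reflection alpha r u Lam.
Proof.
move=> rL; have [delta d0 hd] := narrow_region n2 al0 al2 r0 sub_f f1_f f2_f sol C0 u_gt0 rL.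
pose P t := forall s, r < s -> s <= t -> below_reflection alpha r u s.
suff : P Lam by apply.
apply: (@sup_induction R P r Lam (ltW rL)).
  by move=> s t Pt st s' rs' s's; apply: Pt => //; exact: le_trans st.
move=> s; rewrite le_eqVlt => /orP[/eqP <-|rs] sL below_s.
  exists delta => // m rm; rewrite le_min => /andP[mL md].
  apply: (hd m r rm mL (lexx _) rm); first by rewrite lerBlDl.
  by move=> x /andP[rx _]; rewrite leNgt rx.
have bel_s : below_reflection alpha r u s.
  apply: below_reflection_limit => // t rt ts.
  by apply: (below_s t (ltW rt) ts).
have s0 : 0 < s by exact: lt_trans rs.
pose t := Num.max r (s - delta / 2).
have rt : r <= t by rewrite le_max lexx.
have ts : t < s by rewrite gt_max rs/=; lra.
have std : s - delta / 2 <= t by rewrite le_max lexx orbT.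
have /compact_near_coveringP cov := @compact_shell R n r t.
have := cov R (nbhs s)
  (fun m x => r <= enorm x -> u x <= reflected alpha u m x) _ _.
case.
  move=> x /andP[rx xt].
  have x0 : x != 0 by rewrite -enorm_gt0; exact: lt_le_trans rx.
  have iO : Omega r (inversion s x).
    apply/(Omega_inversion r s0 x0); rewrite expr2.
    by apply: ltr_pM => //; [exact: ltW|exact: enorm_ge0|exact: le_lt_trans ts].
  have ux : u x < reflected alpha u s x.
    move: rx; rewrite le_eqVlt => /orP[/eqP xr|rx].
      by rewrite solution_boundary// mulr_gt0 ?kelvin_gt0// u_gt0.
    apply: (strictly_below n2 al0 al2 r0 sub_f f1_f sol C0 u_gt0 bel_s).
    by rewrite /annulus /= rx (le_lt_trans xt).
  pose m := (u x + reflected alpha u s x) / 2.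
  have um : u x < m by rewrite /m; lra.
  have mr : m < reflected alpha u s x by rewrite /m; lra.
  have h1 : \forall x' \near x, r <= enorm x' -> u x' < m.
    have /cvgr_lt H := solution_continuous sol rx; exact: H um.
  have /cvgr_gt /(_ _ mr) [[A B] /= [As Bx] AB] := reflected_continuous s0 x0 iO.
  exists ([set x' | r <= enorm x' -> u x' < m] `&` B, A).
    by split => //=; exact: filterI.
  move=> [x' s'] [/= [hx' Bx'] As'] rx'.
  apply: ltW; apply: lt_trans (hx' rx') _; exact: (AB (s', x')).
move=> e /= e0 he; exists (Num.min (e / 2) (delta / 2)).
  by rewrite lt_min !divr_gt0.
move=> m rm; rewrite le_min => /andP[mL].
have [ms|sm] := leP m s.
  move=> _; move: ms; rewrite le_eqVlt => /orP[/eqP ->//|ms].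
  exact: (below_s m (ltW rm) ms).
rewrite -lerBlDl le_min => /andP[me md].
apply: (hd m t rm mL rt (lt_trans ts sm)); first by lra.
move=> x /andP[rx _] xt; apply: (he m) => //=.
- by rewrite ltr_norml; apply/andP; split; lra.
- by rewrite (ltW rx).
- exact: ltW.
Qed.

End continuation.

(** * Iteration of exponents and boxes in a cone *)

Section exponents.
Context {R : realType}.

(** Since [t |-> a + p * t - t] is affine and positive at both ends of
  [[m0, - a / p]], the iteration advances by a fixed amount at each step until
  it leaves this interval. *)
Lemma exponent_iteration (Q : R -> Prop) (a p m0 : R) : 0 < a -> 0 < p ->
  m0 < a + p * m0 -> Q m0 -> (forall m, Q m -> Q (a + p * m)) ->
  exists2 m, Q m & 0 <= a + p * m.
Proof.
move=> a0 p0 m0lt Qm0 QS; apply: contrapT => noQ.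
have neg m : Q m -> a + p * m < 0.
  by move=> Qm; rewrite ltNge; apply/negP => hm; apply: noQ; exists m.
(* the increments of the iteration at the two ends of the interval *)
pose d := Num.min (a + p * m0 - m0) (a / p).
have d0 : 0 < d by rewrite lt_min subr_gt0 m0lt divr_gt0.
have step m : Q m -> m0 <= m -> m + d <= a + p * m.
  move=> Qm mm; have := neg m Qm; rewrite -lerBrDl ge_min => hm.
  have [p1|p1] := leP 1 p; apply/orP; [left|right].
    by have : 0 <= (p - 1) * (m - m0) by [rewrite mulr_ge0 ?subr_ge0|]; nra.
  have m1 : m < - (a / p).
    by rewrite ltrNr ltr_pdivrMr// mulNr mulrC; lra.
  have := divr_gt0 a0 p0; set b := a / p in m1 *; move=> b0.
  have -> : a = p * b by rewrite /b mulrC divfK// gt_eqF.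
  by nra.
have chain k : exists2 m, Q m & m0 + k%:R * d <= m.
  elim: k => [|k [m Qm hm]]; first by exists m0; rewrite // mul0r addr0.
  exists (a + p * m); first exact: QS.
  have mm : m0 <= m by apply: le_trans hm; rewrite lerDl mulr_ge0// ltW.
  by apply: le_trans (step m Qm mm); rewrite -natr1 mulrDl mul1r addrA lerD2r.
have [k hk] : exists k, - m0 < k%:R * d.
  exists (Num.truncn (- m0 / d)).+1.
  by rewrite -ltr_pdivrMr//; exact: truncnS_gt.
have [m Qm hm] := chain k; have := neg m Qm.
have m00 : 0 < m by lra.
by have := mulr_gt0 p0 m00; lra.
Qed.

Lemma powR_comparable (e rho t : R) : 0 < rho -> rho <= t -> t <= 4 * rho ->
  Num.min 1 (4 `^ e) * rho `^ e <= t `^ e.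
Proof.
move=> rho0 rt t4.
have t0 : 0 <= t by lra.
have [e0|e0] := leP 0 e.
  apply: (@le_trans _ _ (rho `^ e)); last by rewrite ge0_ler_powR ?nnegrE// ltW.
  by rewrite ler_piMl ?powR_ge0// ge_min lexx.
apply: (@le_trans _ _ ((4 * rho) `^ e)).
  rewrite powRM ?(ltW rho0)//; apply: ler_wpM2r; first exact: powR_ge0.
  by rewrite ge_min lexx orbT.
have tp : 0 < t by lra.
rewrite -[e]opprK !(powRN _ (- e)) lef_pV2 ?posrE ?powR_gt0//; last by lra.
by rewrite ge0_ler_powR ?nnegrE//; lra.
Qed.

End exponents.

Section boxes.
Context {R : realType} {n : nat}.
Local Notation V := 'rV[measurableTypeR R]_n.

(** When the interior point is the origin, it is replaced by a nearby one. *)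
Lemma solid_cone_interior_neq0 (C : set 'rV[R]_n) : (0 < n)%N ->
  interior C !=set0 -> exists2 z : 'rV[R]_n, z != 0 & nbhs z C.
Proof.
move=> n0 [z zC]; have [z0|z0] := eqVneq z 0; last by exists z.
have cv : (fun t : R => t *: (const_mx 1 : 'rV[R]_n)) @ (0 : R)^'+ --> z.
  apply: cvg_at_right_filter; rewrite z0 -[X in _ --> X](scale0r (const_mx 1)).
  by apply: cvgZr_tmp; exact: cvg_id.
have oC : nbhs z (interior C) by apply: open_nbhs_nbhs; split => //; exact: open_interior.
have [t [tC t0]] : exists t : R, interior C (t *: (const_mx 1 : 'rV[R]_n)) /\ 0 < t.
  have /filter_ex[t []] : \forall t \near (0 : R)^'+,
      interior C (t *: (const_mx 1 : 'rV[R]_n)) /\ 0 < t.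
    by near=> t; split; near: t; [exact: (cv _ oC)|exact: nbhs_right_gt].
  by exists t.
exists (t *: const_mx 1) => //; apply/eqP => /rowP /(_ (Ordinal n0)).
by rewrite !mxE mulr1 => t00; move: t0; rewrite t00 ltxx.
Unshelve. all: by end_near. Qed.

(** Dilating one cube around an interior point of the cone, away from the origin.
  Its volume grows like [rho ^+ n] while its points stay at a distance comparable
  to [rho]. *)
Lemma solid_cone_box (C : set 'rV[R]_n) : (0 < n)%N -> solid_cone C ->
  exists2 m : R, 0 < m & forall rho, 0 < rho -> exists B : set V,
    [/\ measurable B, lebesgue_rV R n B = (m * rho ^+ n)%:E &
        forall y : 'rV[R]_n, B y -> [/\ C y, rho <= enorm y & enorm y <= 4 * rho]].
Proof.
move=> n0 [Cs /(solid_cone_interior_neq0 n0)[z z0 zC]].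
have ez0 : 0 < enorm z by rewrite enorm_gt0.
have : \forall y \near z, C y /\ enorm z / 2 < enorm y < 2 * enorm z.
  near=> y; split; first by near: y.
  apply/andP; split; near: y; [apply: near_enorm_gt|apply: near_enorm_lt]; lra.
move=> /nbhs_ballP[e /= e0 he].
pose k := enorm z / 2; have k0 : 0 < k by rewrite divr_gt0.
exists ((2 * (e / k)) ^+ n); first by rewrite exprn_gt0// mulr_gt0// divr_gt0.
move=> rho rho0; exists (cube ((rho / k) *: z) (rho / k * e)).
have rk0 : 0 < rho / k by rewrite divr_gt0.
split; first exact: measurable_cube.
  rewrite lebesgue_cube; last by rewrite ltW// mulr_gt0.
  by rewrite -exprMn; congr (_ ^+ _)%:E; ring.
move=> y yB; pose y' := (rho / k)^-1 *: y.
have yE : y = (rho / k) *: y' by rewrite /y' scalerA divff ?scale1r// gt_eqF.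
have /he[yC /andP[y1 y2]] : ball z e y'.
  split => // i j; rewrite (ord1 i) /ball /=.
  have := yB j; rewrite /= in_itv/= yE !mxE.
  rewrite -mulrBr -mulrDr !ltr_pM2l// => /andP[h1 h2].
  by rewrite ltr_norml; apply/andP; split; lra.
rewrite yE enormZ gtr0_norm//; split; first exact: Cs.
  rewrite mulrAC ler_pdivlMr// ler_pM2l//; exact: ltW.
rewrite mulrAC ler_pdivrMr// -mulrA mulrCA ler_pM2l//.
by apply: le_trans (ltW y2) _; rewrite /k; lra.
Unshelve. all: by end_near. Qed.

End boxes.

(** * Lower bounds outside a ball *)

Section bootstrap.
Context {R : realType}.
Variables (n : nat) (alpha r : R) (f : 'rV[R]_n -> R -> R).
Variables (u : 'rV[R]_n -> R) (h : 'rV[measurableTypeR R]_n -> R).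
Hypotheses (n2 : (2 <= n)%N) (al0 : 0 < alpha) (al2 : alpha <= 2) (r0 : 0 < r).
Hypotheses (sub_f : subcritical alpha r f) (f1_f : f1 r f) (f2_f : f2 alpha r f).
Hypothesis sol : borel_solution alpha r f u h.
Hypothesis C0 : 0 < green_cst n alpha.
Hypothesis u_gt0 : forall x, Omega r x -> 0 < u x.
Local Notation mu := (lebesgue_rV R n).
Local Notation V := 'rV[measurableTypeR R]_n.

Let n0 : (0 < n)%N. Proof. exact: leq_trans n2. Qed.

Lemma sphere_min s : r < s ->
  exists2 m, 0 < m & forall x : 'rV[R]_n, enorm x = s -> m <= u x.
Proof.
move=> rs; have /compact_near_coveringP cov := @compact_shell R n s s.
have := cov R ((0 : R)^'+) (fun m x => m <= u x) _ _.
case.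
  move=> x /andP[sx _]; have xO : Omega r x by exact: lt_le_trans sx.
  have ux := u_gt0 xO; have u2 : u x / 2 < u x by lra.
  have h1 : \forall x' \near x, u x / 2 < u x'.
    by have /cvgr_gt H := solution_continuous_Omega sol xO; exact: H u2.
  have h2 : \forall m \near (0 : R)^'+, m < u x / 2.
    by apply: nbhs_right_lt; rewrite divr_gt0.
  exists ([set x' | u x / 2 < u x'], [set m | m < u x / 2]) => //.
  move=> [x' m] [/= hx hm]; apply: ltW; exact: lt_trans hm hx.
move=> e /= e0 he; exists (e / 2); first by rewrite divr_gt0.
move=> x xs; apply: he => //=; last 2 first.
- by rewrite divr_gt0.
- by rewrite xs lexx.
by rewrite sub0r normrN gtr0_norm ?divr_gt0//; lra.
Qed.

(** The values on the sphere of radius [2 * r] are transported outwards by the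
  inversion exchanging [x] with a point of this sphere. *)
Lemma initial_lower_bound : exists2 c, 0 < c & forall x : 'rV[R]_n,
  2 * r < enorm x -> c * enorm x `^ (- ((n%:R - alpha) / 2)) <= u x.
Proof.
have r2 : r < 2 * r by have := r0; lra.
have r2p : 0 < 2 * r by exact: lt_trans r2.
have [m m0 hm] := sphere_min r2.
set d := (n%:R - alpha) / 2.
exists (m * (2 * r) `^ d); first by rewrite mulr_gt0// powR_gt0.
move=> x rx; have ex0 : 0 < enorm x by exact: lt_trans rx.
(* the point of the sphere of radius [2 * r] below [x], and the radius whose
   inversion exchanges the two points *)
pose y := (2 * r / enorm x) *: x.
have ey : enorm y = 2 * r.
  by rewrite /y enormZ gtr0_norm ?divr_gt0// divfK// gt_eqF.
pose lam := Num.sqrt (2 * r * enorm x).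
have lam2 : lam ^+ 2 = 2 * r * enorm x by rewrite sqr_sqrtr// mulr_ge0// ltW.
have lam0 : 0 < lam by rewrite sqrtr_gt0 mulr_gt0.
have ylam : 2 * r < lam.
  by rewrite -(@ltr_pXn2r _ 2)// ?nnegrE ?(ltW lam0) ?(ltW r2p)// lam2 expr2 ltr_pM2l.
have yA : annulus r lam y by rewrite /annulus /= ey r2 ylam.
have iy : inversion lam y = x.
  rewrite /inversion ey lam2 /y scalerA (_ : _ * _ = 1) ?scale1r//.
  by field; rewrite !gt_eqF// mulr_gt0.
have := below_reflection_all n2 al0 al2 r0 sub_f f1_f f2_f sol C0 u_gt0 (lt_trans r2 ylam) yA.
rewrite /reflected iy /kelvin ey => uy.
have {uy} := le_trans (hm y ey) uy.
pose z := enorm x / (2 * r).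
have z0 : 0 < z by rewrite divr_gt0.
have -> : (lam / (2 * r)) `^ (n%:R - alpha) = z `^ d.
  have -> : n%:R - alpha = 2%:R * d by rewrite /d mulrC divfK.
  rewrite powRrM powR_mulrn ?divr_ge0 ?(ltW lam0) ?(ltW r2p)//.
  rewrite expr_div_n lam2; congr (_ `^ _).
  by rewrite /z; field; rewrite gt_eqF.
have zE : enorm x `^ d = z `^ d * (2 * r) `^ d.
  by rewrite -powRM ?(ltW z0) ?(ltW r2p)// divfK// gt_eqF.
have Z0 : 0 < z `^ d by rewrite powR_gt0.
have Y0 : 0 < (2 * r) `^ d by rewrite powR_gt0.
rewrite powRN zE invfM [_^-1 * _]mulrC mulrA mulfK ?gt_eqF// => H.
by rewrite ler_pdivrMr// mulrC.
Qed.

(** When [y] is at least twice as far as [x], the squared distance is at most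
  [5 / 2 * enorm y ^+ 2] and the normalized product of the defects at least
  [9 / 4 * enorm y ^+ 2]; by scaling the kernel is then at least a constant
  times a power of [enorm y]. *)
Lemma green_lower_bound : exists2 c, 0 < c & forall x y : 'rV[R]_n,
  2 * r <= enorm x -> 2 * enorm x <= enorm y ->
  c * enorm y `^ (alpha - n%:R) <= green alpha r x y.
Proof.
have A0 := r0.
exists (green_cst n alpha * kern n alpha (5 / 2) (9 / 4)).
  by rewrite mulr_gt0// kern_gt0//; lra.
move=> x y rx xy.
have xO : Omega r x by rewrite /Omega/=; lra.
have yO : Omega r y by rewrite /Omega/=; lra.
have ey0 : 0 < enorm y by lra.
have yx : x - y != 0 by rewrite subr_eq0; apply/eqP => xy'; move: xy; rewrite xy'; lra.
rewrite greenE// -[leLHS]mulrA ler_wpM2l ?(ltW C0)//.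
have y20 : 0 < enorm y ^+ 2 by rewrite exprn_gt0.
rewrite (_ : enorm y `^ _ = (enorm y ^+ 2) `^ (- ((n%:R - alpha) / 2))); last first.
  rewrite -powR_mulrn ?(ltW ey0)// -powRrM; congr (_ `^ _).
  by field.
rewrite mulrC -kern_scale//.
have ra : r ^+ 2 <= enorm x ^+ 2 / 4 by nra.
have rb : r ^+ 2 <= enorm y ^+ 2 / 4 by nra.
have xyle : 4 * enorm x ^+ 2 <= enorm y ^+ 2 by nra.
have e0 : 0 < enorm (x - y) ^+ 2 by rewrite exprn_gt0// enorm_gt0.
apply: (@le_trans _ _ (kern n alpha (enorm (x - y) ^+ 2) (enorm y ^+ 2 * (9 / 4)))).
  apply: kern_nonincreasing => //; last by rewrite mulr_ge0// ltW.
  by apply: le_trans (enormB_sqr_le _ _) _; lra.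
apply: kern_nondecreasing => //.
rewrite ler_pdivlMr ?exprn_gt0// /defect.
set X := enorm x ^+ 2 in ra xyle *; set Y := enorm y ^+ 2 in rb y20 xyle *.
have R0 : 0 < r ^+ 2 by rewrite exprn_gt0.
set S := r ^+ 2 in ra rb R0 *; clearbody X Y S.
have : 0 <= (X - S - 3 * S) * (Y - S) by rewrite mulr_ge0//; lra.
have : 0 <= S * (Y - S - 3 / 4 * Y) by rewrite mulr_ge0//; lra.
nra.
Qed.

End bootstrap.

(** * Lower bounds inside the cone *)

Section cone.
Context {R : realType}.
Variables (n : nat) (alpha r : R) (f : 'rV[R]_n -> R -> R).
Variables (u : 'rV[R]_n -> R) (h : 'rV[measurableTypeR R]_n -> R).
Hypotheses (n2 : (2 <= n)%N) (al0 : 0 < alpha) (al2 : alpha <= 2) (r0 : 0 < r).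
Hypothesis sol : borel_solution alpha r f u h.
Hypothesis C0 : 0 < green_cst n alpha.
Variables (C : set 'rV[R]_n) (Cbar sigma tau p : R).
Hypotheses (Ccone : solid_cone C) (Cbar0 : 0 < Cbar) (p0 : 0 < p).
Hypothesis f_lower : forall x v, C x -> Omega (2 * sigma * r) x -> 0 <= v ->
  Cbar * enorm x `^ tau * v `^ p <= f x v.
Local Notation mu := (lebesgue_rV R n).
Local Notation V := 'rV[measurableTypeR R]_n.

Let n0 : (0 < n)%N. Proof. exact: leq_trans n2. Qed.

Definition power_lower_bound (m : R) := exists c L : R,
  0 < c /\ forall x : 'rV[R]_n, L < enorm x -> c * enorm x `^ m <= u x.

(** On a box of size [rho] the Green's function is at least of order
  [rho `^ (alpha - n%:R)], the source at least of order
  [rho `^ (tau + p * m)], and the volume is of order [rho ^+ n]. *)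
Lemma cone_contribution m : power_lower_bound m -> exists c L : R,
  [/\ 0 < c, 1 <= L & forall (x : 'rV[R]_n) rho, 2 * r <= enorm x ->
    2 * enorm x <= rho -> L <= rho -> exists B : set V,
    [/\ measurable B,
      forall y : 'rV[R]_n, B y -> rho <= enorm y /\ enorm y <= 4 * rho &
      ((c * rho `^ (alpha + tau + p * m))%:E <=
       \int[mu]_(y in B) (green alpha r x y * h y)%:E)%E]].
Proof.
move=> [c0 [L0 [c00 hu]]].
have [c1 c10 hg] := green_lower_bound n2 al0 al2 r0 C0.
have [v v0 hbox] := solid_cone_box n0 Ccone.
set e := alpha - n%:R + tau + p * m.
pose k := Num.min 1 (4 `^ e) : R.
have k0 : 0 < k by rewrite lt_min ltr01 powR_gt0.
pose L := Num.max 1 (Num.max L0 (2 * sigma * r) + 1).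
exists (c1 * Cbar * c0 `^ p * k * v), L; split.
- by rewrite !mulr_gt0// powR_gt0.
- by rewrite le_max lexx.
move=> x rho rx xrho Lrho.
have rho0 : 0 < rho by apply: lt_le_trans Lrho; rewrite lt_max ltr01.
have [B [mB muB hB]] := hbox rho rho0.
exists B; split => //; first by move=> y /hB[].
set K := c1 * Cbar * c0 `^ p * k.
have K0 : 0 <= K by rewrite !mulr_ge0 ?powR_ge0 ?(ltW c10) ?(ltW Cbar0) ?(ltW k0).
have [N [mN N0 hN]] := sourceE sol.
have rhoE : rho `^ (alpha + tau + p * m) = rho `^ e * rho ^+ n.
  rewrite -powR_mulrn ?(ltW rho0)// -powRD; last by rewrite (gt_eqF rho0) implybT.
  by congr (_ `^ _); rewrite /e; ring.
have Kle : forall y : 'rV[R]_n, B y -> ~ N y ->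
    ((K * rho `^ e)%:E <= (green alpha r x y * h y)%:E)%E.
  move=> y By Ny; have [Cy y1 y4] := hB y By; rewrite lee_fin.
  have y0 : 0 < enorm y by exact: lt_le_trans y1.
  have yO : Omega r y by rewrite /Omega/=; have := r0; lra.
  have := le_trans Lrho y1; rewrite ge_max => /andP[_ hL].
  have /andP[yL0 ys] : (L0 < enorm y) && (2 * sigma * r < enorm y).
    by rewrite -gt_max; apply: lt_le_trans hL; rewrite ltrDl.
  have -> : h y = f y (u y) by apply: contrapT => hy; apply: Ny; apply: hN => /= /(_ yO).
  have uy := hu y yL0.
  have m0 : 0 <= enorm y `^ m by exact: powR_ge0.
  have cm0 : 0 <= c0 * enorm y `^ m by rewrite mulr_ge0// ltW.
  have fy : Cbar * enorm y `^ tau * (c0 `^ p * enorm y `^ (p * m)) <= f y (u y).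
    apply: le_trans (f_lower Cy ys (le_trans cm0 uy)).
    apply: ler_wpM2l; first by rewrite mulr_ge0 ?powR_ge0// ltW.
    rewrite [p * m]mulrC powRrM -powRM ?(ltW c00)//.
    by apply: ge0_ler_powR; rewrite ?nnegrE ?(ltW p0)//; exact: le_trans uy.
  have gy := hg x y rx (le_trans xrho y1).
  apply: (@le_trans _ _ (c1 * enorm y `^ (alpha - n%:R) *
    (Cbar * enorm y `^ tau * (c0 `^ p * enorm y `^ (p * m))))).
    rewrite (_ : c1 * _ * _ = c1 * Cbar * c0 `^ p *
      (enorm y `^ (alpha - n%:R) * enorm y `^ tau * enorm y `^ (p * m))); last ring.
    have yi a b : enorm y `^ a * enorm y `^ b = enorm y `^ (a + b).
      by rewrite powRD// (gt_eqF y0) implybT.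
    rewrite !yi -/e /K -mulrA; apply: ler_wpM2l.
      by rewrite !mulr_ge0 ?powR_ge0 ?(ltW c10) ?(ltW Cbar0).
    exact: powR_comparable.
  apply: ler_pM => //; first by rewrite mulr_ge0 ?powR_ge0// ltW.
  by rewrite !mulr_ge0 ?powR_ge0// ltW.
rewrite rhoE (_ : _ * (_ * _) = (K * rho `^ e) * (v * rho ^+ n)); last by rewrite /K; ring.
rewrite EFinM -muB -integral_cst//.
apply: (nneg_integral_le_off_null mN N0 _ _ Kle) => y By.
  by rewrite lee_fin mulr_ge0// powR_ge0.
by rewrite lee_fin mulr_ge0 ?green_ge0 ?(source_ge0 sol).
Qed.

Lemma solution_subset_integral x (B : set V) : Omega r x -> measurable B ->
  B `<=` @Omega R n r ->
  (\int[mu]_(y in B) (green alpha r x y * h y)%:E <= (u x)%:E)%E.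
Proof.
move=> xO mB BO; rewrite (solutionE sol (OmegaW xO)).
apply: ge0_subset_integral => //.
- exact: measurable_Omega.
- by apply/measurable_EFinP; exact: (measurable_green_source n2 al0 al2 sol).
- by move=> y _; rewrite lee_fin mulr_ge0 ?green_ge0 ?(source_ge0 sol).
Qed.

(** The box of size [2 * enorm x] alone gives the new exponent. *)
Lemma power_lower_bound_step m :
  power_lower_bound m -> power_lower_bound (alpha + tau + p * m).
Proof.
move=> /cone_contribution[c [L [c0 L1 hc]]].
set e := alpha + tau + p * m in hc *.
exists (c * 2 `^ e), (Num.max (2 * r) L); split; first by rewrite mulr_gt0// powR_gt0.
move=> x; rewrite gt_max => /andP[rx Lx].
have ex := enorm_ge0 x; have R0 := r0.
have [|B [mB hB]] := hc x (2 * enorm x) (ltW rx) (lexx _); first by lra.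
rewrite powRM// mulrA -lee_fin => /le_trans; apply.
apply: solution_subset_integral => //; first by rewrite /Omega/=; lra.
by move=> y /hB[y1 _]; rewrite /Omega/=; lra.
Qed.

(** Disjoint boxes of sizes [2 * s, 16 * s, ...] contribute a fixed amount
  each, so that the integral defining [u] diverges. *)
Lemma lower_bound_diverges m : power_lower_bound m ->
  0 <= alpha + tau + p * m -> False.
Proof.
move=> /cone_contribution[c [L [c0 L1 hc]]] e0.
set e := alpha + tau + p * m in hc e0 *.
have R0 := r0.
pose w : 'rV[R]_n := const_mx 1.
have w0 : w != 0.
  apply/eqP => /rowP /(_ (Ordinal n0)); rewrite !mxE => /eqP.
  by rewrite oner_eq0.
have ew : 0 < enorm w by rewrite enorm_gt0.
pose x := (2 * r / enorm w) *: w.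
have ex : enorm x = 2 * r.
  by rewrite /x enormZ gtr0_norm ?divr_gt0 ?mulr_gt0// divfK// gt_eqF.
have xO : Omega r x by rewrite /Omega/= ex; lra.
have G0 (y : V) : (0 <= (green alpha r x y * h y)%:E)%E.
  by rewrite lee_fin mulr_ge0 ?green_ge0 ?(source_ge0 sol).
have mG (B : set V) : measurable B -> B `<=` @Omega R n r ->
    measurable_fun B (fun y : V => (green alpha r x y * h y)%:E).
  move=> mB BO; apply: measurable_funS BO _; first exact: measurable_Omega.
  by apply/measurable_EFinP; exact: (measurable_green_source n2 al0 al2 sol).
have tail k : forall s, 4 * r <= s -> L <= s ->
    ((k%:R * c)%:E <= \int[mu]_(y in @Omega R n s) (green alpha r x y * h y)%:E)%E.
  elim: k => [|k IH] s rs Ls; first by rewrite mul0r integral_ge0.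
  have [|||B [mB hB cB]] := hc x (2 * s); rewrite ?ex; [lra|lra|lra|].
  have BO : B `<=` @Omega R n s by move=> y /hB[y1 _]; rewrite /Omega/=; lra.
  have O8 : @Omega R n (8 * s) `<=` @Omega R n s.
    by move=> y; rewrite /Omega/= => y8; lra.
  have sO : @Omega R n s `<=` @Omega R n r.
    by move=> y; rewrite /Omega/= => y8; lra.
  have mO8 := @measurable_Omega R n (8 * s).
  apply: (@le_trans _ _ (\int[mu]_(y in B `|` @Omega R n (8 * s))
      (green alpha r x y * h y)%:E)%E); last first.
    apply: ge0_subset_integral => //.
    - exact: measurableU.
    - exact: measurable_Omega.
    - by apply: mG => //; exact: measurable_Omega.
    - by rewrite subUset.
  rewrite ge0_integral_setU//; last 2 first.
  - by apply: mG; [exact: measurableU|rewrite subUset; split; apply: subset_trans sO].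
  - apply/disj_setPS => y [/hB[_ y1]]; rewrite /Omega/=; lra.
  rewrite -natr1 mulrDl mul1r addrC EFinD leeD//.
    apply: le_trans cB; rewrite lee_fin ler_peMr ?(ltW c0)//.
    by rewrite -[X in X <= _](powRr0 (2 * s)) ler_powR//; lra.
  by apply: IH; lra.
pose s := Num.max (4 * r) L.
have rs : 4 * r <= s by rewrite le_max lexx.
have Ls : L <= s by rewrite le_max lexx orbT.
have [k hk] : exists k, u x < k%:R * c.
  exists (Num.truncn (u x / c)).+1.
  by rewrite -ltr_pdivrMr//; exact: truncnS_gt.
have := tail k s rs Ls; rewrite leNgt => /negP; apply.
apply: (@le_lt_trans _ _ (u x)%:E); last by rewrite lte_fin.
apply: solution_subset_integral => //; first exact: measurable_Omega.
by move=> y; rewrite /Omega/=; lra.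
Qed.

End cone.

(** * The Liouville theorem *)

Theorem theorem1p6 (R : realType) (n : nat) (alpha r : R)
    (f : 'rV[R]_n -> R -> R) (u : 'rV[R]_n -> R) :
  (2 <= n)%N -> 0 < alpha -> alpha <= 2 -> 0 < r ->
  (forall x v, Omega r x -> 0 <= v -> 0 <= f x v) ->
  subcritical alpha r f -> f1 r f -> f2 alpha r f -> f3 alpha r f ->
  nonneg_solution alpha r f u ->
  forall x, closure (@Omega R n r) x -> u x = 0.
Proof.
move=> n2 al0 al2 r0 f_ge0 sub_f f1_f f2_f f3_f solu.
have [h sol] := nonneg_solution_borel r0 f_ge0 solu.
move=> z /(closure_Omega _ r0) rz.
(* this case distinction replaces the evaluation of the Gamma integrals *)
have := green_cst_ge0 n alpha; rewrite le_eqVlt => /orP[/eqP C0|C0].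
  apply: EFin_inj; rewrite (solutionE sol rz); apply: integral0_eq => y _.
  by rewrite /green -C0 !mul0r if_same mul0r.
apply: contrapT => /eqP uz.
have u_gt0 x : Omega r x -> 0 < u x.
  by move=> xO; apply: (solution_positive n2 al0 al2 r0 sol C0 xO); exists z.
have [C [Cbar [sigma [tau [p [Ccone Cbar0 _ exps f_lower]]]]]] := f3_f.
have [c c0 hc] := initial_lower_bound n2 al0 al2 r0 sub_f f1_f f2_f sol C0 u_gt0.
have Q0 : power_lower_bound u (- ((n%:R - alpha) / 2)) by exists c, (2 * r).
have [p0 [m Qm]] : 0 < p /\ exists2 m, power_lower_bound u m & 0 <= alpha + tau + p * m.
  case: exps => [[aln [tau_gt p0 pn]]|[aln [tau_ge p0]]]; split => //; last first.
    exists (- ((n%:R - alpha) / 2)) => //; rewrite aln subrr mul0r oppr0 mulr0 addr0; lra.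
  apply: (exponent_iteration _ p0 _ Q0); first by lra.
    by move: pn; rewrite ltr_pdivlMr ?subr_gt0//; nra.
  move=> m; exact: (power_lower_bound_step n2 al0 al2 r0 sol C0 Ccone Cbar0 p0 f_lower).
exact: (lower_bound_diverges n2 al0 al2 r0 sol C0 Ccone Cbar0 p0 f_lower Qm).
Qed.
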